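(* Let $\nu\ge 2$ be an even integer and consider the two-field order-$\nu$ contact setting described in the context, with the contact points $z_p$ and the incoming and outgoing sections depending smoothly on $p$. After shrinking a common grazing box (a neighbourhood of the contact, common to all $p$ near $0$), every orbit of the physical field with sufficiently small $\rho>0$ has a unique first entry into $\{h_p>0\}$ and a unique first exit from it, both within time $O(\rho^{1/\nu})$ of the reference contact, and has no other seam events in the box. Let $\mathcal D_{\mathrm{gr}}(\rho,p)$ be the outgoing $I_p$-coordinate of the physical excursion minus that of the reference $X_p^-$-excursion launched from the same incoming point. Then $$\mathcal D_{\mathrm{gr}}(\rho,p)=\begin{cases}0,&\rho\le 0,\\ \rho^{1+1/\nu}\mathcal A_\nu(\rho^{1/\nu},p),&\rho\ge 0,\end{cases}$$ where $\mathcal A_\nu(s,p)$ is jointly smooth on its one-sided domain $s\ge 0$ and $$\mathcal A_\nu(0,p)=\mathfrak g_\nu(p):=\frac{2\nu}{\nu+1}\left(\frac{\nu!}{\kappa_\nu(p)}\right)^{1/\nu}\beta(p).$$ Equivalently, for a jointly smooth $B_\nu$, $$\mathcal D_{\mathrm{gr}}(\rho,p)=\mathfrak g_\nu(p)\,\rho_+^{1+1/\nu}+\rho_+^{1+2/\nu}B_\nu(\rho_+^{1/\nu},p).$$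
   Context: Smooth means $C^\infty$; $x_+=\max\{x,0\}$. The parameter $p$ ranges near $0\in\mathbb R^m$. Two-field contact setting. In a two-dimensional phase space, $h_p$ is a jointly smooth (in state and parameter) defining function for a seam $\Sigma_p=\{h_p=0\}$, and $X_p^-,X_p^+$ are jointly smooth vector fields on a common neighbourhood with $X_p^+=X_p^-$ on $\Sigma_p$. The physical field is $X_p=X_p^-$ on $\{h_p\le0\}$ and $X_p=X_p^+$ on $\{h_p\ge0\}$. There is a jointly smooth vector field $W_p$ with $X_p^+-X_p^-=h_pW_p$. There is a contact point $z_p$, depending smoothly on $p$, such that $h_p(z_p)=0$, $dh_p(z_p)\ne0$, $X_p^-(z_p)\neq0$, $(X_p^-)^jh_p(z_p)=0$ for $1\le j<\nu$, and $\kappa_\nu(p):=-(X_p^-)^\nu h_p(z_p)>0$ (iterated Lie derivatives). Put $\beta(p)=dh_p(z_p)[W_p(z_p)]$. $I_p$ is the (jointly smooth) local first integral of $X_p^-$ normalized by $X_p^-I_p=0$, $I_p(z_p)=0$, $dI_p(z_p)=dh_p(z_p)$. Small sections transverse to $X_p^-$ are fixed before (incoming) and after (outgoing) the contact; $\rho=I_p$ on the incoming section is the signed coordinate of the orbit launched there. A reference excursion follows $X_p^-$ from the incoming to the outgoing section; a physical excursion follows the physical field $X_p$. A seam event is a time at which the physical orbit meets $\Sigma_p$. Time ''of the reference contact'' is measured in $X_p^-$-flow-box time $t$ in which $z_p$ is at $t=0$. *)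

(* Defs.v *)
From HB Require Import structures.
From mathcomp Require Export all_boot all_order all_algebra.
From mathcomp Require Export all_classical all_reals all_analysis.
Export Order.TTheory GRing.Theory Num.Theory.
Export numFieldNormedType.Exports.

Set Implicit Arguments.
Unset Strict Implicit.
Unset Printing Implicit Defensive.

Local Open Scope classical_set_scope.
Local Open Scope ring_scope.

(* In finite dimension this is the usual C^k: 'D_v f being C^k for every v is
   the same as all partial derivatives of f being C^k. *)
Fixpoint Ck_on (R : realType) (E F : normedModType R) (k : nat) (U : set E)
    (f : E -> F) : Prop :=
  match k with
  | 0%N => forall x, U x -> {for x, continuous f}
  | k'.+1 => (forall x, U x -> differentiable f x) /\
             (forall v : E, Ck_on k' U ('D_v f))
  end.

Definition smooth_on (R : realType) (E F : normedModType R) (U : set E)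
    (f : E -> F) : Prop :=
  open U /\ forall k, Ck_on k U f.

Definition smooth_near (R : realType) (E F : normedModType R) (x : E)
    (f : E -> F) : Prop :=
  exists2 U : set E, U x & smooth_on U f.

(* Smoothness on a set that need not be open, e.g. up to the face s = 0 of a
   one-sided domain s >= 0. *)
Definition smooth_within (R : realType) (E F : normedModType R) (D : set E)
    (f : E -> F) : Prop :=
  exists (U : set E) (g : E -> F),
    [/\ D `<=` U, smooth_on U g & forall x, D x -> f x = g x].

Definition joint (A B C : Type) (f : A -> B -> C) : A * B -> C :=
  fun q => f q.1 q.2.

Definition Lie (R : realType) (E : normedModType R) (X : E -> E) (f : E -> R) :
    E -> R :=
  fun x => 'd f x (X x).

(* A solution on [a, b], staying in B, of the equation phi' = F(phi). *)
Definition orbit (R : realType) (E : normedModType R) (B : set E) (F : E -> E)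
    (a b : R) (phi : R -> E) : Prop :=
  [/\ a <= b,
      {within `[a, b], continuous phi},
      forall t, a < t < b -> is_derive t 1 phi (F (phi t))
    & forall t, a <= t <= b -> B (phi t)].

Definition reaches (R : realType) (E : normedModType R) (B : set E) (F : E -> E)
    (x y : E) : Prop :=
  exists (a b : R) (phi : R -> E),
    [/\ a < b, orbit B F a b phi, phi a = x & phi b = y].

Definition physical (R : realType) (E : normedModType R) (h : E -> R)
    (Xm Xp : E -> E) : E -> E :=
  fun x => if h x <= 0 then Xm x else Xp x.

Definition kappa (R : realType) (m : nat) (nu : nat)
    (h : 'rV[R]_m -> 'rV[R]_2 -> R) (Xm : 'rV[R]_m -> 'rV[R]_2 -> 'rV[R]_2)
    (z : 'rV[R]_m -> 'rV[R]_2) (p : 'rV[R]_m) : R :=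
  - iter nu (Lie (Xm p)) (h p) (z p).

Definition beta (R : realType) (m : nat)
    (h : 'rV[R]_m -> 'rV[R]_2 -> R) (W : 'rV[R]_m -> 'rV[R]_2 -> 'rV[R]_2)
    (z : 'rV[R]_m -> 'rV[R]_2) (p : 'rV[R]_m) : R :=
  'd (h p) (z p) (W p (z p)).

Record contact_setting (R : realType) (m : nat) (nu : nat)
    (U : set ('rV[R]_m * 'rV[R]_2))
    (h : 'rV[R]_m -> 'rV[R]_2 -> R)
    (Xm Xp W : 'rV[R]_m -> 'rV[R]_2 -> 'rV[R]_2)
    (z : 'rV[R]_m -> 'rV[R]_2) : Prop := ContactSetting {
  contact_dom : U (0, z 0);
  smooth_h : smooth_on U (joint h);
  smooth_Xm : smooth_on U (joint Xm);
  smooth_Xp : smooth_on U (joint Xp);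
  smooth_W : smooth_on U (joint W);
  fields_agree : forall p x, U (p, x) -> h p x = 0 -> Xp p x = Xm p x;
  fields_diff : forall p x, U (p, x) -> Xp p x - Xm p x = h p x *: W p x;
  smooth_z : smooth_near 0 z;
  contact_h : \forall p \near (0 : 'rV[R]_m), h p (z p) = 0;
  contact_dh : \forall p \near (0 : 'rV[R]_m),
    'd (h p) (z p) <> cst 0 :> ('rV[R]_2 -> R);
  contact_Xm : \forall p \near (0 : 'rV[R]_m), Xm p (z p) != 0;
  contact_Lie : \forall p \near (0 : 'rV[R]_m),
    forall j, (1 <= j < nu)%N -> iter j (Lie (Xm p)) (h p) (z p) = 0;
  contact_kappa : \forall p \near (0 : 'rV[R]_m), 0 < kappa nu h Xm z p
}.

Record first_integral (R : realType) (m : nat)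
    (h : 'rV[R]_m -> 'rV[R]_2 -> R) (Xm : 'rV[R]_m -> 'rV[R]_2 -> 'rV[R]_2)
    (z : 'rV[R]_m -> 'rV[R]_2) (I : 'rV[R]_m -> 'rV[R]_2 -> R) : Prop :=
  FirstIntegral {
  smooth_I : smooth_near (0, z 0) (joint I);
  Lie_I : \forall q \near ((0 : 'rV[R]_m), z 0), Lie (Xm q.1) (I q.1) q.2 = 0;
  I_contact : \forall p \near (0 : 'rV[R]_m), I p (z p) = 0;
  dI_contact : \forall p \near (0 : 'rV[R]_m),
    'd (I p) (z p) = 'd (h p) (z p) :> ('rV[R]_2 -> R)
}.

(* The time coordinate of a flow box of Xm whose origin is the contact point;
   (tau p, I p) are flow-box coordinates. *)
Record flow_box_time (R : realType) (m : nat)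
    (Xm : 'rV[R]_m -> 'rV[R]_2 -> 'rV[R]_2)
    (z : 'rV[R]_m -> 'rV[R]_2) (tau : 'rV[R]_m -> 'rV[R]_2 -> R) : Prop :=
  FlowBoxTime {
  smooth_tau : smooth_near (0, z 0) (joint tau);
  Lie_tau : \forall q \near ((0 : 'rV[R]_m), z 0),
    Lie (Xm q.1) (tau q.1) q.2 = 1;
  tau_contact : \forall p \near (0 : 'rV[R]_m), tau p (z p) = 0
}.

(* A smooth family of curves u |-> sigma p u, for (p, u) near (0, 0),
   transverse to Xm. *)
Definition transverse_section (R : realType) (m : nat)
    (Xm : 'rV[R]_m -> 'rV[R]_2 -> 'rV[R]_2)
    (sigma : 'rV[R]_m -> R -> 'rV[R]_2) : Prop :=
  smooth_near (0, 0) (joint sigma) /\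
  \forall q \near ((0 : 'rV[R]_m), (0 : R)),
    free [:: Xm q.1 (sigma q.1 q.2); 'D_1 (sigma q.1) q.2].

(* It suffices to say at p = 0 that the section cuts the Xm-orbit of the
   contact point: by transversality it then cuts that of z p for p near 0. *)
Definition incoming_section (R : realType) (m : nat) (B : set 'rV[R]_2)
    (Xm : 'rV[R]_m -> 'rV[R]_2 -> 'rV[R]_2) (z : 'rV[R]_m -> 'rV[R]_2)
    (sigma : 'rV[R]_m -> R -> 'rV[R]_2) : Prop :=
  transverse_section Xm sigma /\ reaches B (Xm 0) (sigma 0 0) (z 0).

Definition outgoing_section (R : realType) (m : nat) (B : set 'rV[R]_2)
    (Xm : 'rV[R]_m -> 'rV[R]_2 -> 'rV[R]_2) (z : 'rV[R]_m -> 'rV[R]_2)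
    (sigma : 'rV[R]_m -> R -> 'rV[R]_2) : Prop :=
  transverse_section Xm sigma /\ reaches B (Xm 0) (z 0) (sigma 0 0).

Definition section_of_size (R : realType) (m : nat)
    (sigma : 'rV[R]_m -> R -> 'rV[R]_2) (r : R) (p : 'rV[R]_m) :
    set 'rV[R]_2 :=
  [set sigma p u | u in [set u | `|u| < r]].

(* d is the outgoing I-coordinate of a physical excursion minus that of a
   reference excursion, both from one point of Sin with coordinate rho to Sout.
   A relation in d: that it is the graph of a function of rho is part of what
   is to be claimed. *)
Definition is_displacement (R : realType) (B Sin Sout : set 'rV[R]_2)
    (h : 'rV[R]_2 -> R) (Xm Xp : 'rV[R]_2 -> 'rV[R]_2) (I : 'rV[R]_2 -> R)
    (rho d : R) : Prop :=
  exists x yphys yref : 'rV[R]_2,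
    [/\ Sin x /\ I x = rho,
        Sout yphys /\ reaches B (physical h Xm Xp) x yphys,
        Sout yref /\ reaches B Xm x yref
      & d = I yphys - I yref].

(* The clock is set so that an orbit launched at x is at x at time tau x, hence
   the reference orbit from x is at every time t at flow-box time t.  With entry
   time Te and exit time Tx, every physical orbit through x lying in the box has
   h > 0 exactly on ]Te, Tx[ and h = 0 exactly at Te and Tx; both times, and the
   flow-box times of both event points, are at most eps in absolute value, and
   the excursion from x to Sout does run through both events. *)
Definition one_grazing_passage (R : realType) (B Sout : set 'rV[R]_2)
    (h : 'rV[R]_2 -> R) (F : 'rV[R]_2 -> 'rV[R]_2) (tau : 'rV[R]_2 -> R)
    (x : 'rV[R]_2) (eps : R) : Prop :=
  exists Te Tx : R,
    [/\ tau x < Te < Tx,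
        `|Te| <= eps /\ `|Tx| <= eps,
        exists (b : R) (phi : R -> 'rV[R]_2),
          [/\ Tx < b, orbit B F (tau x) b phi, phi (tau x) = x & Sout (phi b)]
      & forall (a b : R) (phi : R -> 'rV[R]_2),
          orbit B F a b phi -> a <= tau x <= b -> phi (tau x) = x ->
          forall t, a <= t <= b ->
            [/\ 0 < h (phi t) <-> Te < t < Tx,
                h (phi t) = 0 <-> (t = Te \/ t = Tx)
              & h (phi t) = 0 -> `|tau (phi t)| <= eps]].

Definition grazing_coeff (R : realType) (m : nat) (nu : nat)
    (h : 'rV[R]_m -> 'rV[R]_2 -> R)
    (Xm W : 'rV[R]_m -> 'rV[R]_2 -> 'rV[R]_2)
    (z : 'rV[R]_m -> 'rV[R]_2) (p : 'rV[R]_m) : R :=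
  (2 * nu%:R / (nu%:R + 1)) *
  ((nu`!)%:R / kappa nu h Xm z p) `^ (nu%:R^-1) * beta h W z p.

(* Main.v *)
From HB Require Import structures.
Require Import Defs.
From mathcomp Require Import ring lra.
Set Implicit Arguments.
Unset Strict Implicit.
Unset Printing Implicit Defensive.
Local Open Scope classical_set_scope.
Local Open Scope ring_scope.

(** The chart (tau, I) straightens the reference field: in the coordinates
    (t, r) = (tau, I) its orbits are the lines r = cst, and the whole geometry
    is in the height H (p, t, r) of the seam function at the point X (p, t, r),
    X being the inverse chart ([chart_exists]). As dI = dh at the contact, the
    derivative of H in r is 1 there; as the contact has order nu, H (p, t, 0)
    vanishes to order nu at t = 0. Hence H = r E1 - t ^ nu c with E1 = 1 and
    c = kappa / nu! at the contact ([normal_form]). Writing W = a Xm + b d/dr, a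
    physical orbit parametrized by flow-box time is a graph r (t) with

      dr / dt = H_+ b / (1 + H_+ a),                      H_+ = max (H, 0).

    For rho <= 0 the height is nonpositive along r = rho, nu being even, and the
    orbit is a reference orbit. For rho > 0 put s = rho ^ (1 / nu), t = s u and
    r = s ^ nu w. Then H = s ^ nu K with K = w E1 - u ^ nu c smooth up to s = 0,
    and dw / du is s times a smooth function. At s = 0 the orbit is w = 1 and
    K = 1 - u ^ nu c has exactly two zeros, both simple. So entry and exit are
    smooth functions of (p, s) by the implicit function theorem, the solution
    w = 1 + s y is smooth in (p, s) by the smooth dependence of solutions on
    parameters, and the first integral changes by s ^ nu (w - 1) = s ^ (nu + 1) A
    with A the value of y at exit. At s = 0 this is the integral of
    (1 - u ^ nu c) b between the two zeros, which is the grazing coefficient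
    ([blow_up]). One more application of Hadamard's formula to A gives B_nu.

    It remains to go back to orbits. The graph r (t) becomes an orbit of the
    physical field after a change of clock ([phys_orbit]), and it is the only
    one through its points because Xm + max (h, 0) W is Lipschitz, although not
    differentiable across the seam ([physical_lip], [orbit_unique]). The record
    [passage] gathers what this gives for one pair (p, rho), on a box that is
    common to all of them ([grazing_box]). Since I is constant along the orbit
    before entry and after exit, the sections only decide where the excursion
    is cut off, and the displacement does not depend on them ([excursion],
    [displacement]).

    The calculus behind this is developed for functions all of whose iterated
    directional derivatives exist. Differentiability is always obtained from an
    increment f y - f x = sum_i c_i (y - x) a_i y with a_i continuous at x
    ([caratheodory]): for integrals depending on a parameter the a_i are averages
    of derivatives ([Ck_on_mean01]), and for solutions of a differential equation
    they come from solving explicitly the linear equation satisfied by the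
    difference of two solutions ([sol_increment]). *)


(** * Finite-dimensional spaces and differentiability *)

(** Finite dimension in the form that expands a derivative in an arbitrary
    direction along finitely many fixed directions: a spanning family with
    continuous linear coordinates. *)
Record coordinates (R : realType) (E : normedModType R) (n : nat)
    (e : 'I_n -> E) (c : 'I_n -> E -> R) : Prop := Coordinates {
  coord_lin : forall i a x y, c i (a *: x + y) = a * c i x + c i y;
  coord_cont : forall i, continuous (c i);
  coord_sum : forall x, x = \sum_i c i x *: e i
}.

Definition findim (R : realType) (E : normedModType R) : Prop :=
  exists n (e : 'I_n -> E) (c : 'I_n -> E -> R), coordinates e c.

Lemma near_dist (R : realType) (F : normedModType R) (T : topologicalType)
    (f : T -> F) (x : T) (eps : R) :
  {for x, continuous f} -> 0 < eps -> \forall y \near x, `|f y - f x| < eps.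
Proof. by move=> cf; apply: pseudometric_normed_Zmodule.cvgr_distC_lt. Qed.

Lemma near_cont (S T : topologicalType) (f : S -> T) (x : S) (P : T -> Prop) :
  {for x, continuous f} -> (\forall z \near f x, P z) ->
  \forall y \near x, P (f y).
Proof. by move=> cf H; exact: (cf _ H). Qed.

Lemma cont_pair (S T U : topologicalType) (f : S -> T) (g : S -> U) (x : S) :
  {for x, continuous f} -> {for x, continuous g} ->
  {for x, continuous (fun y => (f y, g y))}.
Proof. by move=> cf cg; exact: (cvg_pair cf cg). Qed.

Lemma near_lt0 (T : topologicalType) (R : realType) (g : T -> R) (p : T) (c : R) :
  {for p, continuous g} -> g p < c -> \forall y \near p, g y < c.
Proof.
move=> cg gp; apply: (@near_cont _ _ g p (fun r => is_true (r < c))) => //.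
exact: lt_nbhsl.
Qed.

Lemma near_gt0 (T : topologicalType) (R : realType) (g : T -> R) (p : T) (c : R) :
  {for p, continuous g} -> c < g p -> \forall y \near p, c < g y.
Proof.
move=> cg gp; apply: (@near_cont _ _ g p (fun r => is_true (c < r))) => //.
exact: lt_nbhsr.
Qed.

Lemma near_all (T : topologicalType) (x : T) (P : T -> Prop) :
  (forall y, P y) -> \forall y \near x, P y.
Proof. by move=> Py; exact: nearW. Qed.

Lemma near_ex_open (T : topologicalType) (x : T) (P : T -> Prop) :
  (\forall y \near x, P y) ->
  exists U : set T, [/\ open U, U x & forall y, U y -> P y].
Proof.
by rewrite /prop_near1 nbhsE => -[U [oU Ux] UP]; exists U.
Qed.

Section Findim.
Variable R : realType.

Lemma findim_real : findim R.
Proof.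
exists 1%N, (fun=> 1), (fun=> id); split.
- by [].
- by move=> i x; exact: cvg_id.
- by move=> x; rewrite big_ord1 /= [_ *: _]mulr1.
Qed.

Lemma findim_row m : findim 'rV[R]_m.
Proof.
exists m, (fun i => delta_mx 0 i), (fun i (x : 'rV[R]_m) => x 0 i); split.
- by move=> i a x y; rewrite !mxE.
- by move=> i x; exact: coord_continuous.
- by move=> x; rewrite {1}(row_sum_delta x).
Qed.

Lemma findim_prod (E F : normedModType R) :
  findim E -> findim F -> findim (E * F)%type.
Proof.
move=> [n [e [c [cl cc cs]]]] [m [e' [c' [cl' cc' cs']]]].
exists (n + m)%N,
  (fun i => match fintype.split i with inl j => (e j, 0) | inr j => (0, e' j) end),
  (fun i x => match fintype.split i with inl j => c j x.1 | inr j => c' j x.2 end).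
split.
- by move=> i a x y; case: (fintype.split i) => j; rewrite /= ?cl ?cl'.
- move=> i x; case: (fintype.split i) => j /=.
  + by apply: (@continuous_comp _ _ _ fst (c j)); [exact: cvg_fst|exact: cc].
  + by apply: (@continuous_comp _ _ _ snd (c' j)); [exact: cvg_snd|exact: cc'].
- move=> [x y]; rewrite big_split_ord /=.
  under eq_bigr => i _ do rewrite (unsplitK (inl i : 'I_n + 'I_m)) /=.
  under [X in _ + X]eq_bigr => i _ do
    rewrite (unsplitK (inr i : 'I_n + 'I_m)) /=.
  have sum1 : forall (u : 'I_n -> R), \sum_i u i *: ((e i, 0) : E * F)
      = (\sum_i u i *: e i, 0).
    move=> u; elim/big_rec2 : _ => // i a b _ ->.
    by congr pair; rewrite /= ?scaler0 ?addr0.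
  have sum2 : forall (u : 'I_m -> R), \sum_i u i *: ((0, e' i) : E * F)
      = (0, \sum_i u i *: e' i).
    move=> u; elim/big_rec2 : _ => // i a b _ ->.
    by congr pair; rewrite /= ?scaler0 ?addr0.
  by rewrite sum1 sum2; congr pair; rewrite /= ?addr0 ?add0r -?cs -?cs'.
Qed.

End Findim.

Section Caratheodory.
Variables (R : realType) (E F : normedModType R).

Lemma cvg_bigsum (T : Type) (G : set_system T) n (a : 'I_n -> T -> F)
    (l : 'I_n -> F) : Filter G ->
  (forall i, a i x @[x --> G] --> l i) ->
  \sum_i a i x @[x --> G] --> \sum_i l i.
Proof.
by move=> FG al; apply: cvg_big => //; exact: add_continuous.
Qed.

Lemma differentiable_eps (f : E -> F) (x : E) (L : {linear E -> F}) :
  continuous L ->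
  (forall e : R, 0 < e -> \forall y \near x,
     `|f y - f x - L (y - x)| <= e * `|y - x|) ->
  differentiable f x /\ 'd f x = L :> (E -> F).
Proof.
move=> cL fL.
have H : f \o shift x = cst (f x) + L +o_ 0 id.
  apply/eqaddoP => e e0; have := fL e e0.
  rewrite (near_shift 0 x) subr0; apply: filterS => v /=.
  by rewrite !fctE opprD addrA addrK.
have dL := diff_unique cL H.
split; last by [].
apply/diff_locallyP.
by rewrite dL.
Qed.

Lemma coord_bounded n (e : 'I_n -> E) (c : 'I_n -> E -> R) :
  coordinates e c -> exists2 M : R, 0 < M & forall i v, `|c i v| <= M * `|v|.
Proof.
move=> [cl cc cs].
have bd i : exists2 M : R, 0 < M & forall v, `|c i v| <= M * `|v|.
  pose L : {linear E -> R} :=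
    HB.pack (c i) (GRing.isLinear.Build R E R _ (c i) (cl i)).
  have cL : continuous L by exact: cc.
  have := linear_lipschitz (cL : continuous L).
  by move=> [M M0 HM]; exists M.
have [M HM] := choice (fun i => let: ex_intro2 M p q := bd i in
  ex_intro (fun M => 0 < M /\ forall v, `|c i v| <= M * `|v|) M (conj p q)).
exists (1 + \sum_i M i).
  by rewrite ltr_pwDl// sumr_ge0// => i _; exact: ltW (HM i).1.
move=> i v; apply: le_trans ((HM i).2 v) _; apply: ler_wpM2r => //.
rewrite (bigD1 i)//= addrCA lerDl addr_ge0// sumr_ge0// => j _.
exact: ltW (HM j).1.
Qed.

(** The increment is linear up to replacing a_i y by a_i x, an error that is
    small compared with y - x. Derivatives of integrals and of solutions of
    differential equations are obtained in this way. *)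
Lemma caratheodory n (e : 'I_n -> E) (c : 'I_n -> E -> R) (f : E -> F) (x : E)
    (a : 'I_n -> E -> F) :
  coordinates e c -> (forall i, {for x, continuous (a i)}) ->
  (\forall y \near x, f y = f x + \sum_i c i (y - x) *: a i y) ->
  differentiable f x /\ forall v, 'D_v f x = \sum_i c i v *: a i x.
Proof.
move=> co ca fa; have [cl cc cs] := co.
have [M M0 cM] := coord_bounded co.
pose L0 (v : E) : F := \sum_i c i v *: a i x.
have L0lin : linear L0.
  move=> k u v; rewrite /L0 scaler_sumr -big_split; apply: eq_bigr => i _ /=.
  by rewrite cl scalerDl scalerA.
pose L : {linear E -> F} := HB.pack L0 (GRing.isLinear.Build R E F _ L0 L0lin).
have cL : continuous L.
  by move=> v; apply: cvg_bigsum => i; apply: cvgZr_tmp; exact: cc.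
suff [df dL] : differentiable f x /\ 'd f x = L :> (E -> F).
  by split=> // v; rewrite deriveE// dL.
apply: differentiable_eps cL _ => eps eps0.
have ca' : \forall y \near x, forall i, `|a i y - a i x| <= eps / (M * n.+1%:R).
  apply: filter_forall => i.
  have e'0 : 0 < eps / (M * n.+1%:R) by rewrite divr_gt0 ?mulr_gt0.
  by have := near_dist (ca i) e'0; apply: filterS => y /ltW.
apply: filterS2 fa ca' => y fy ay.
rewrite fy [f x + _]addrC addrK {fy}; set v := y - x.
rewrite /L /= /L0 -sumrB.
apply: le_trans (ler_norm_sum _ _ _) _.
have -> : eps * `|v| = \sum_(i < n.+1) (M * `|v| * (eps / (M * n.+1%:R))).
  rewrite sumr_const card_ord -[RHS]mulr_natr.
  by field; rewrite nat1r pnatr_eq0 (gt_eqF M0).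
rewrite big_ord_recr /=.
apply: ler_wpDr.
  by rewrite !mulr_ge0// ?invr_ge0 ?mulr_ge0// ltW.
apply: ler_sum => i _; rewrite -scalerBr normrZ.
exact: ler_pM.
Qed.

End Caratheodory.

(** * Functions of class C^k *)

Section CkBasic.
Variables (R : realType) (E F : normedModType R).
Implicit Types (f g : E -> F) (U V : set E) (x : E).

Lemma near_eq_differentiable f g x :
  (\forall y \near x, f y = g y) -> differentiable f x -> differentiable g x.
Proof.
move=> fg df.
suff [] : differentiable g x /\ 'd g x = 'd f x :> (E -> F) by [].
have fgx := nbhs_singleton fg.
apply: differentiable_eps; first exact: diff_continuous.
move=> e e0.
have /eqaddoP/(_ e e0) H := diff_locally df.
have sx : (y - x) @[y --> x] --> (0 : E).
  by rewrite -(subrr x); apply: cvgB; [exact: cvg_id|exact: cvg_cst].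
apply: filterS2 fg (sx _ H) => y fgy.
by rewrite /= !fctE /= addrNK -fgx fgy opprD addrA.
Qed.

Lemma near_open U x (P : E -> Prop) : open U -> U x ->
  (forall y, U y -> P y) -> \forall y \near x, P y.
Proof. by move=> oU Ux UP; apply: filterS (open_nbhs_nbhs (conj oU Ux)). Qed.

Lemma Ck_on_sub k U V f : V `<=` U -> Ck_on k U f -> Ck_on k V f.
Proof.
elim: k f => [|k IH] f VU /=; first by move=> cf x /VU; exact: cf.
by move=> [df Df]; split=> [x /VU|v]; [exact: df | apply: IH].
Qed.

Lemma Ck_on_congr k U f g : open U -> (forall x, U x -> f x = g x) ->
  Ck_on k U f -> Ck_on k U g.
Proof.
move=> oU; elim: k f g => [|k IH] f g fg /=.
  move=> cf x Ux; rewrite /prop_for /continuous_at -fg//.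
  apply: cvg_trans (cf x Ux); apply: near_eq_cvg.
  by apply: near_open oU Ux _ => y Uy; rewrite fg.
move=> [df Df]; split=> [x Ux|v].
  by apply: near_eq_differentiable (df x Ux); exact: near_open oU Ux _.
apply: IH (Df v) => x Ux; apply: near_eq_derive.
exact: near_open oU Ux _.
Qed.

Lemma Ck_onS k U f : Ck_on k.+1 U f -> Ck_on k U f.
Proof.
elim: k f => [|k IH] f /= [df Df].
  by move=> x Ux; exact: differentiable_continuous (df x Ux).
by split=> // v; exact: IH (Df v).
Qed.

Lemma Ck_onW k l U f : (k <= l)%N -> Ck_on l U f -> Ck_on k U f.
Proof.
move=> /subnK <-; elim: (_ - _)%N => // j IH.
by rewrite addSn => /Ck_onS.
Qed.

Lemma Ck_on_cont k U f x : Ck_on k U f -> U x -> {for x, continuous f}.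
Proof. by move=> /(Ck_onW (leq0n k)); exact. Qed.

Lemma Ck_on_derive k U f v : Ck_on k.+1 U f -> Ck_on k U ('D_v f).
Proof. by move=> [_ Df]; exact: Df. Qed.

(** [Ck_on] requires conditions at each point separately, so that it can be
    checked on singletons. *)
Lemma Ck_on_bigcup k U f : (forall x, U x -> Ck_on k [set x] f) -> Ck_on k U f.
Proof.
elim: k f => [|k IH] f Uf /=; first by move=> x Ux; exact: (Uf x Ux x erefl).
split=> [x Ux|v]; first by have [/(_ x erefl)] := Uf x Ux.
by apply: IH => x Ux; have [_] := Uf x Ux; exact.
Qed.

Lemma Ck_on_cst k U (a : F) : Ck_on k U (fun=> a).
Proof.
elim: k a => [|k IH] a /=; first by move=> x _; exact: cst_continuous.
split=> [x _|v]; first exact: differentiable_cst.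
by rewrite (_ : 'D_v _ = fun=> 0)//; apply/funext => x; exact: derive_cst.
Qed.

Lemma derive_lin (L : E -> F) v x : linear L -> continuous L ->
  differentiable L x /\ 'D_v L x = L v.
Proof.
move=> lL cL.
pose L' : {linear E -> F} := HB.pack L (GRing.isLinear.Build R E F _ L lL).
have dL : differentiable L x by exact: (@linear_differentiable _ _ _ L').
by split=> //; rewrite deriveE// (@diff_lin _ _ _ L').
Qed.

Lemma Ck_on_lin k U (L : E -> F) : linear L -> continuous L -> Ck_on k U L.
Proof.
move=> lL cL; case: k => [|k] /=; first by move=> x _; exact: cL.
split=> [x _|v]; first by have [] := derive_lin 0 x lL cL.
rewrite (_ : 'D_v L = fun=> L v); first exact: Ck_on_cst.
by apply/funext => x; have [] := derive_lin v x lL cL.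
Qed.

Lemma Ck_onD k U f g : open U -> Ck_on k U f -> Ck_on k U g ->
  Ck_on k U (fun x => f x + g x).
Proof.
move=> oU; elim: k f g => [|k IH] f g /=.
  by move=> cf cg x Ux; apply: cvgD; [exact: cf|exact: cg].
move=> [df Df] [dg Dg]; split=> [x Ux|v].
  by apply: differentiableD; [exact: df|exact: dg].
apply: Ck_on_congr oU _ (IH _ _ (Df v) (Dg v)) => x Ux.
by rewrite [RHS]deriveD//; apply: diff_derivable; [exact: df|exact: dg].
Qed.

Lemma Ck_on_sum k U n (f : 'I_n -> E -> F) : open U ->
  (forall i, Ck_on k U (f i)) -> Ck_on k U (fun x => \sum_i f i x).
Proof.
move=> oU; elim: n f => [|n IH] f Cf.
  by under eq_fun do rewrite big_ord0; exact: Ck_on_cst.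
under eq_fun do rewrite big_ord_recl; apply: Ck_onD => //.
exact: IH.
Qed.

Lemma differentiable_scale (a : E -> R) f x :
  differentiable a x -> differentiable f x ->
  differentiable (fun y => a y *: f y) x /\
  forall v, 'D_v (fun y => a y *: f y) x = 'D_v a x *: f x + a x *: 'D_v f x.
Proof.
move=> da df.
have sb : bilinear_for (GRing.Scale.Law.clone _ _ *:%R _)
    (GRing.Scale.Law.clone _ _ *:%R _) (@GRing.scale R F).
  split=> [u'|u] k y z /=; first by rewrite scalerDl scalerA.
  by rewrite scalerDr !scalerA mulrC.
pose B : {bilinear R -> F -> F} := HB.pack (@GRing.scale R F)
  (@bilinear_isBilinear.Build R R F F _ _ (@GRing.scale R F) sb).
have cB : continuous (fun p : R * F => B p.1 p.2) by exact: scale_continuous.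
have dB := @differentiable_bilin _ _ _ _ B (a x, f x) cB.
have dp := differentiable_pair da df.
have dc : differentiable ((fun p : R * F => B p.1 p.2) \o (fun y => (a y, f y))) x.
  exact: differentiable_comp.
split=> // v.
rewrite deriveE//.
have -> : 'd (fun y => a y *: f y) x v =
    'd (fun p : R * F => B p.1 p.2) (a x, f x)
      ('d (fun y => (a y, f y)) x v).
  exact: (congr1 (fun h => h v) (diff_comp dp dB)).
rewrite (@diff_bilin _ _ _ _ B (a x, f x) cB) diff_pair//=.
by rewrite addrC -!deriveE.
Qed.

End CkBasic.

Section CkOps.
Variables (R : realType) (E : normedModType R).
Implicit Types (U : set E).

Lemma Ck_onZ (F : normedModType R) k U (a : E -> R) (f : E -> F) : open U ->
  Ck_on k U a -> Ck_on k U f -> Ck_on k U (fun x => a x *: f x).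
Proof.
move=> oU; elim: k a f => [|k IH] a f.
  by move=> cf cg x Ux; apply: cvgZ; [exact: cf|exact: cg].
move=> Ca Cf; have [da Da] := Ca; have [df Df] := Cf; split=> [x Ux|v].
  by have [] := differentiable_scale (da x Ux) (df x Ux).
have H := Ck_onD oU (IH _ _ (Da v) (Ck_onS Cf)) (IH _ _ (Ck_onS Ca) (Df v)).
apply: Ck_on_congr oU _ H => x Ux.
by have [_ ->] := differentiable_scale (da x Ux) (df x Ux).
Qed.

Lemma Ck_on_comp_lin (F G : normedModType R) k U (c : F -> G) (f : E -> F) :
  linear c -> continuous c -> open U -> Ck_on k U f ->
  Ck_on k U (fun x => c (f x)).
Proof.
move=> lc cc oU; elim: k f => [|k IH] u.
  move=> cu x Ux; apply: (@continuous_comp _ _ _ u c); first exact: cu.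
  exact: cc.
move=> [du Du]; split=> [x Ux|w].
  apply: (@differentiable_comp _ _ _ _ u c); first exact: du.
  by have [] := derive_lin 0 (u x) lc cc.
apply: Ck_on_congr oU _ (IH _ (Du w)) => x Ux.
have [dc Dc] := derive_lin ('D_w u x) (u x) lc cc.
rewrite [RHS]deriveE; last by apply: differentiable_comp => //; exact: du.
by rewrite diff_comp//=; [rewrite -!deriveE//; exact: du|exact: du].
Qed.

(** Finite dimension of the middle space writes the derivative of the
    composite as a finite sum of products to which the induction applies: the
    chain rule by itself only gives 'd g (f x) applied to a moving vector. *)
Lemma Ck_on_comp (F G : normedModType R) k U (V : set F) (f : E -> F) (g : F -> G) :
  findim F -> open U -> Ck_on k U f -> Ck_on k V g ->
  (forall x, U x -> V (f x)) -> Ck_on k U (fun x => g (f x)).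
Proof.
move=> [n [e [c [cl cc cs]]]] oU; elim: k f g => [|k IH] f g.
  move=> cf cg UV x Ux; apply: (@continuous_comp _ _ _ f g); first exact: cf.
  by apply: cg; exact: UV.
move=> Cf Cg UV; have [df Df] := Cf; have [dg Dg] := Cg; split=> [x Ux|v].
  by apply: (@differentiable_comp _ _ _ _ f g); [exact: df|exact/dg/UV].
have H : Ck_on k U (fun x => \sum_i c i ('D_v f x) *: 'D_(e i) g (f x)).
  apply: Ck_on_sum => // i; apply: Ck_onZ => //.
    by apply: (@Ck_on_comp_lin F R) (Df v); [exact: cl|exact: cc|].
  by apply: IH (Ck_onS Cf) (Dg (e i)) UV.
apply: Ck_on_congr oU _ H => x Ux.
have dfx := df x Ux; have dgx := dg _ (UV x Ux).
rewrite [RHS]deriveE; last exact: differentiable_comp.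
rewrite diff_comp//= -(deriveE _ dfx) [X in 'd g _ X]cs linear_sum.
by apply: eq_bigr => i _; rewrite linearZ (deriveE _ dgx).
Qed.

Lemma Ck_on_pair (F G : normedModType R) k U (f : E -> F) (g : E -> G) : open U ->
  Ck_on k U f -> Ck_on k U g -> Ck_on k U (fun x => (f x, g x)).
Proof.
move=> oU Cf Cg.
have -> : (fun y => (f y, g y)) = (fun y => (f y, 0) + (0, g y) : F * G).
  by apply/funext => y; congr pair; rewrite /= ?addr0 ?add0r.
apply: Ck_onD => //.
  apply: (@Ck_on_comp_lin F (F * G)%type k U (fun z => (z, 0))) => //.
    by move=> a u v; congr pair; rewrite /= ?scaler0 ?addr0.
  by move=> z; apply: cvg_pair; [exact: cvg_id|exact: cvg_cst].
apply: (@Ck_on_comp_lin G (F * G)%type k U (fun z => (0, z))) => //.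
  by move=> a u v; congr pair; rewrite /= ?scaler0 ?addr0.
by move=> z; apply: cvg_pair; [exact: cvg_cst|exact: cvg_id].
Qed.

Lemma Ck_onM k U (a b : E -> R) : open U -> Ck_on k U a -> Ck_on k U b ->
  Ck_on k U (fun x => a x * b x).
Proof. exact: Ck_onZ. Qed.

Lemma Ck_onN k U (F : normedModType R) (f : E -> F) : open U -> Ck_on k U f ->
  Ck_on k U (fun x => - f x).
Proof.
move=> oU Cf; have := Ck_onZ oU (@Ck_on_cst R E R k U (-1)) Cf.
by under eq_fun do rewrite scaleN1r.
Qed.

Lemma Ck_onV k U (a : E -> R) : open U -> (forall x, U x -> a x != 0) ->
  Ck_on k U a -> Ck_on k U (fun x => (a x)^-1).
Proof.
move=> oU a0; elim: k => [|k IH] Ca.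
  by move=> x Ux; apply: cvgV; [exact: a0|exact: Ca].
have [da Da] := Ca; split=> [x Ux|v].
  by apply: differentiableV; [exact: da|exact: a0].
have CV := IH (Ck_onS Ca).
have := Ck_onN oU (Ck_onM oU (Da v) (Ck_onM oU CV CV)).
apply: Ck_on_congr oU _ => x Ux.
rewrite [RHS]deriveV; [|exact: a0|exact/diff_derivable/da].
by rewrite [RHS]/GRing.scale/= mulNr mulrC -invfM -expr2.
Qed.

End CkOps.

(** * Germs of smooth functions *)

Section Smooth.
Variables (R : realType).
Implicit Types (E F G : normedModType R).

Lemma smooth_onP E F (U : set E) (f : E -> F) : open U ->
  (forall x, U x -> smooth_near x f) -> smooth_on U f.
Proof.
move=> oU H; split=> // k; apply: Ck_on_bigcup => x /H[V Vx [oV /(_ k)]].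
by apply: Ck_on_sub => _ ->.
Qed.

Lemma smooth_on_near E F (U : set E) (f : E -> F) x : U x -> smooth_on U f ->
  smooth_near x f.
Proof. by move=> Ux fU; exists U. Qed.

Lemma smooth_near_near E F (f : E -> F) x : smooth_near x f ->
  \forall y \near x, smooth_near y f.
Proof.
move=> [U Ux fU]; have [oU _] := fU.
by apply: near_open oU Ux _ => y Uy; exists U.
Qed.

Lemma smooth_near_congr E F (f g : E -> F) x : smooth_near x f ->
  (\forall y \near x, f y = g y) -> smooth_near x g.
Proof.
move=> [U Ux [oU fU]]; rewrite /prop_near1 nbhsE => -[V [oV Vx] Vfg].
exists (U `&` V) => //; split; first exact: openI.
move=> k; apply: (@Ck_on_congr _ _ _ _ _ f) => [|y [_ /Vfg]//|]; first exact: openI.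
by apply: Ck_on_sub (fU k) => y [].
Qed.

Lemma smooth_near_op2 E F F' G (f : E -> F) (g : E -> F') (h : E -> G) x :
  (forall k (U : set E), open U -> Ck_on k U f -> Ck_on k U g -> Ck_on k U h) ->
  smooth_near x f -> smooth_near x g -> smooth_near x h.
Proof.
move=> H [U Ux [oU fU]] [V Vx [oV gV]]; exists (U `&` V) => //.
split; first exact: openI.
by move=> k; apply: H; [exact: openI|apply: Ck_on_sub (fU k) => y []|
  apply: Ck_on_sub (gV k) => y []].
Qed.

Lemma smooth_cst E F (a : F) (x : E) : smooth_near x (fun=> a).
Proof. by exists setT => //; split; [exact: openT|move=> k; exact: Ck_on_cst]. Qed.

Lemma smooth_lin E F (f : E -> F) x : linear f -> continuous f -> smooth_near x f.
Proof.
by move=> lf cf; exists setT => //; split; [exact: openT|move=> k; exact: Ck_on_lin].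
Qed.

Lemma smooth_id E (x : E) : smooth_near x (fun y => y).
Proof. by apply: smooth_lin => // y; exact: cvg_id. Qed.

Lemma smoothD E F (f g : E -> F) x : smooth_near x f -> smooth_near x g ->
  smooth_near x (fun y => f y + g y).
Proof. by apply: smooth_near_op2 => k U; exact: Ck_onD. Qed.

Lemma smoothN E F (f : E -> F) x : smooth_near x f -> smooth_near x (fun y => - f y).
Proof.
by move=> sf; apply: (smooth_near_op2 _ sf sf) => k U oU fU _; exact: Ck_onN.
Qed.

Lemma smoothB E F (f g : E -> F) x : smooth_near x f -> smooth_near x g ->
  smooth_near x (fun y => f y - g y).
Proof. by move=> sf sg; apply: smoothD => //; exact: smoothN. Qed.

Lemma smoothZ E F (a : E -> R) (f : E -> F) x :
  smooth_near x a -> smooth_near x f -> smooth_near x (fun y => a y *: f y).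
Proof. by apply: smooth_near_op2 => k U; exact: Ck_onZ. Qed.

Lemma smoothM E (a b : E -> R) x :
  smooth_near x a -> smooth_near x b -> smooth_near x (fun y => a y * b y).
Proof. exact: smoothZ. Qed.

Lemma smoothX E (a : E -> R) x n :
  smooth_near x a -> smooth_near x (fun y => a y ^+ n).
Proof.
move=> sa; elim: n => [|n IH].
  by under eq_fun do rewrite expr0; exact: smooth_cst.
by under eq_fun do rewrite exprS; exact: smoothM.
Qed.

Lemma smooth_sum E F n (f : 'I_n -> E -> F) x :
  (forall i, smooth_near x (f i)) -> smooth_near x (fun y => \sum_i f i y).
Proof.
elim: n f => [|n IH] f sf.
  by under eq_fun do rewrite big_ord0; exact: smooth_cst.
under eq_fun do rewrite big_ord_recl; apply: smoothD => //.
exact: IH.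
Qed.

Lemma smooth_near_cont E F (f : E -> F) x : smooth_near x f -> {for x, continuous f}.
Proof. by move=> [U Ux [_ /(_ 0%N)]]; exact. Qed.

Lemma smooth_diff E F (f : E -> F) x : smooth_near x f -> differentiable f x.
Proof. by move=> [U Ux [_ /(_ 1%N)[df _]]]; exact: df. Qed.

Lemma smooth_derive E F (f : E -> F) x v : smooth_near x f -> smooth_near x ('D_v f).
Proof.
move=> [U Ux [oU fU]]; exists U => //; split=> // k.
by have [_] := fU k.+1; exact.
Qed.

Lemma smooth_comp E F G (f : E -> F) (g : F -> G) x : findim F ->
  smooth_near x f -> smooth_near (f x) g -> smooth_near x (fun y => g (f y)).
Proof.
move=> fF sf [V Vx [oV gV]]; have [U Ux [oU fU]] := sf.
have oW : open (U `&` f @^-1` V).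
  rewrite openE => y [Uy Vy]; apply: filterI; first exact: open_nbhs_nbhs.
  by apply: (fU 0%N y Uy); exact: open_nbhs_nbhs.
exists (U `&` f @^-1` V) => //; split=> // k.
apply: (Ck_on_comp fF oW _ (gV k)); last by move=> y [].
by apply: Ck_on_sub (fU k) => y [].
Qed.

Lemma smoothV E (a : E -> R) x : a x != 0 ->
  smooth_near x a -> smooth_near x (fun y => (a y)^-1).
Proof.
move=> a0 sa; apply: (@smooth_comp E R R a (fun t => t^-1)) => //.
  exact: findim_real.
exists [set t | t != 0] => //.
have o0 : open [set t : R | t != 0] by exact: open_neq.
by split=> // k; apply: Ck_onV => //; apply: Ck_on_lin => // t; exact: cvg_id.
Qed.

Lemma smooth_fst E F (x : E * F) : smooth_near x (fun y => y.1).
Proof. by apply: smooth_lin => // y; exact: cvg_fst. Qed.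

Lemma smooth_snd E F (x : E * F) : smooth_near x (fun y => y.2).
Proof. by apply: smooth_lin => // y; exact: cvg_snd. Qed.

Lemma smooth_pair E F G (f : E -> F) (g : E -> G) x :
  smooth_near x f -> smooth_near x g -> smooth_near x (fun y => (f y, g y)).
Proof. by apply: smooth_near_op2 => k U oU fU gU; exact: Ck_on_pair. Qed.

Lemma smooth_comp_lin E F G (c : F -> G) (f : E -> F) x :
  linear c -> continuous c -> smooth_near x f -> smooth_near x (fun y => c (f y)).
Proof.
move=> lc cc [U Ux [oU fU]]; exists U => //; split=> // k.
exact: Ck_on_comp_lin.
Qed.

Lemma smooth1 E F G (f : E -> F * G) x : smooth_near x f -> smooth_near x (fun y => (f y).1).
Proof. by apply: smooth_comp_lin => // y; exact: cvg_fst. Qed.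

Lemma smooth2 E F G (f : E -> F * G) x : smooth_near x f -> smooth_near x (fun y => (f y).2).
Proof. by apply: smooth_comp_lin => // y; exact: cvg_snd. Qed.

Lemma smooth_entry E m (f : E -> 'rV[R]_m) x i :
  smooth_near x f -> smooth_near x (fun y => f y 0 i).
Proof.
move=> sf; apply: (@smooth_comp E _ R f (fun z : 'rV_m => z 0 i)) => //.
  exact: findim_row.
by apply: smooth_lin => [a u v|z]; [rewrite !mxE|exact: coord_continuous].
Qed.

Lemma derive_scale1 F (f : R -> F) (v x : R) : differentiable f x ->
  'D_v f x = v *: 'D_1 f x.
Proof.
move=> df; rewrite !deriveE// -(linearZ_LR ('d f x)).
by rewrite /GRing.scale /= mulr1.
Qed.

Lemma smooth_expR (x : R) : smooth_near x (@expR R).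
Proof.
exists setT => //; split; first exact: openT.
elim=> [|k IH] /=; first by move=> y _; exact: continuous_expR.
split=> [y _|v]; first exact/derivable1_diffP/derivable_expR.
have -> : 'D_v (@expR R) = fun y => v *: expR y.
  apply/funext => y; have d : derivable (@expR R) y 1 by exact: derivable_expR.
  have dd : differentiable (@expR R) y by exact/derivable1_diffP.
  by rewrite derive_scale1// derive_val.
by apply: Ck_onZ => //; [exact: openT|exact: Ck_on_cst].
Qed.

Lemma derive_line E F (f : E -> F) (x v : E) (t : R) :
  differentiable f (x + t *: v) ->
  is_derive t 1 (fun u => f (x + u *: v)) ('D_v f (x + t *: v)).
Proof.
move=> df.
have dl : is_diff t (fun u : R => x + u *: v) (fun u => u *: v).
  have H := is_diffD (is_diff_cst x t) (is_diff_scalel t v).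
  by apply: is_diff_eq H _; apply/funext => u; rewrite /= fctE add0r.
have [dl1 dl2] := dl.
have dc : differentiable (f \o (fun u : R => x + u *: v)) t.
  exact: differentiable_comp.
apply: DeriveDef; first exact/derivable1_diffP.
rewrite deriveE// diff_comp//= dl2 scale1r.
by rewrite deriveE.
Qed.

End Smooth.

(** t handles the leaves that the algebraic rules do not reach. *)
Ltac smooth_by t := repeat (cbn beta; first
  [ t | exact: smooth_id | exact: smooth_cst | apply: smooth1 | apply: smooth2
  | apply: smoothD | apply: smoothN | apply: smoothM | apply: smoothZ
  | apply: smoothX | apply: smooth_pair ]).

Ltac smooth_tac := smooth_by ltac:(fail).

(** * Averages over the unit interval *)

Definition mean01 (R : realType) (f : R -> R) : R :=
  (\int[@lebesgue_measure R]_(t in `[0%R, 1%R]) f t)%R.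

Definition cont01 (R : realType) (f : R -> R) : Prop :=
  forall t : R, 0 <= t <= 1 -> {for t, continuous f}.

Section Tube.
(** Compactness of K turns neighbourhoods of x that depend on t into one. *)
Lemma tube (T X : topologicalType) (K : set X) (x : T) (P : T -> X -> Prop) :
  compact K ->
  (forall t, K t -> \forall q \near (x, t), P q.1 q.2) ->
  \forall y \near x, forall t, K t -> P y t.
Proof.
move=> /compact_near_coveringP cK H.
apply: (cK T (nbhs x) P) => t Kt.
have [[A B] /= [xA tB] AB] := H t Kt.
by exists (B, A) => //= -[u y] /= [Bu Ay]; exact: (AB (y, u)).
Qed.

Lemma compact_seg (R : realType) (a b : R) : compact [set t : R | a <= t <= b].
Proof.
have -> : [set t : R | a <= t <= b] = `[a, b]%classic.
  by apply/seteqP; split=> t /=; rewrite in_itv.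
exact: segment_compact.
Qed.

Lemma tube_seg (R : realType) (T : topologicalType) (a b : R) (x : T)
    (P : T -> R -> Prop) :
  (forall t : R, a <= t <= b -> \forall q \near (x, t), P q.1 q.2) ->
  \forall y \near x, forall t : R, a <= t <= b -> P y t.
Proof. exact/tube/compact_seg. Qed.

Lemma continuous_slice (R : realType) (T U V : topologicalType) (f : T * U -> V)
  (x : T) (t : U) : {for (x, t), continuous f} ->
  {for t, continuous (fun u => f (x, u))}.
Proof.
move=> cf; apply: (@continuous_comp _ _ _ (fun u => (x, u)) f) => //.
by apply: cvg_pair; [exact: cvg_cst|exact: cvg_id].
Qed.

Lemma continuous_slice1 (R : realType) (T U V : topologicalType) (f : T * U -> V)
  (x : T) (t : U) : {for (x, t), continuous f} ->
  {for x, continuous (fun u => f (u, t))}.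
Proof.
move=> cf; apply: (@continuous_comp _ _ _ (fun u => (u, t)) f) => //.
by apply: cvg_pair; [exact: cvg_id|exact: cvg_cst].
Qed.
End Tube.

Section Mean.
Variable R : realType.
Implicit Types f g F : R -> R.
Local Notation mu := (@lebesgue_measure R).

Lemma within_cont (T : topologicalType) (a b : R) (f : R -> T) : (forall t : R, a <= t <= b -> {for t, continuous f}) ->
  {within `[a, b], continuous f}.
Proof.
move=> cf; apply: continuous_in_subspaceT => t; rewrite inE /= in_itv /=.
exact: cf.
Qed.

Lemma cont_integrable (a b : R) f :
  (forall t : R, a <= t <= b -> {for t, continuous f}) ->
  mu.-integrable `[a, b] (EFin \o f).
Proof.
move=> cf; apply: continuous_compact_integrable; first exact: segment_compact.
exact: within_cont.
Qed.

Lemma mean01_ext f g : (forall t : R, 0 <= t <= 1 -> f t = g t) -> mean01 f = mean01 g.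
Proof.
by move=> fg; apply: eq_Rintegral => t; rewrite inE /= in_itv /=; exact: fg.
Qed.

Lemma mean01_cst (c : R) : mean01 (fun=> c) = c.
Proof.
rewrite /mean01 Rintegral_cst//= lebesgue_measure_itv/= lte_fin ltr01.
by rewrite oppr0 adde0 /= mulr1.
Qed.

Lemma mean01D f g : cont01 f -> cont01 g ->
  mean01 (fun t => f t + g t) = mean01 f + mean01 g.
Proof. by move=> cf cg; rewrite /mean01 RintegralD//; exact: cont_integrable. Qed.

Lemma mean01B f g : cont01 f -> cont01 g ->
  mean01 (fun t => f t - g t) = mean01 f - mean01 g.
Proof. by move=> cf cg; rewrite /mean01 RintegralB//; exact: cont_integrable. Qed.

Lemma mean01Z (c : R) f : cont01 f -> mean01 (fun t => c * f t) = c * mean01 f.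
Proof. by move=> cf; rewrite /mean01 RintegralZl//; exact: cont_integrable. Qed.

Lemma cont01_sum n (f : 'I_n -> R -> R) : (forall i, cont01 (f i)) ->
  cont01 (fun t => \sum_i f i t).
Proof. by move=> cf t t01; apply: (@cvg_bigsum R R) => i; exact: cf. Qed.

Lemma mean01_sum n (f : 'I_n -> R -> R) : (forall i, cont01 (f i)) ->
  mean01 (fun t => \sum_i f i t) = \sum_i mean01 (f i).
Proof.
elim: n f => [|n IH] f cf.
  by rewrite big_ord0; under eq_fun do rewrite big_ord0; exact: mean01_cst.
under eq_fun do rewrite big_ord_recl; rewrite mean01D ?big_ord_recl ?IH//.
exact: cont01_sum.
Qed.

Lemma mean01_le f (C : R) : cont01 f -> (forall t : R, 0 <= t <= 1 -> `|f t| <= C) ->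
  `|mean01 f| <= C.
Proof.
move=> cf fC; rewrite -[C in leRHS]mean01_cst.
have cf' := cont_integrable cf.
apply: le_trans (le_normr_Rintegral _ cf') _ => //.
apply: le_Rintegral => //=.
- by apply: cont_integrable => t t01; apply: cvg_norm; exact: cf.
- by apply: cont_integrable => t t01; exact: cvg_cst.
Qed.

Lemma is_derive_cont f (t d : R) : is_derive t 1 f d -> {for t, continuous f}.
Proof.
by move=> [df _]; apply: differentiable_continuous; exact/derivable1_diffP.
Qed.

Lemma mean01_FTC F f : cont01 f ->
  (forall t : R, 0 <= t <= 1 -> is_derive t 1 F (f t)) -> mean01 f = F 1 - F 0.
Proof.
move=> cf dF; rewrite /mean01 /Rintegral.
have cF t : 0 <= t <= 1 -> {for t, continuous F}.
  by move=> t01; exact: is_derive_cont (dF t t01).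
rewrite (@continuous_FTC2 _ f F)//=.
- exact: within_cont.
- split.
  + by move=> t; rewrite in_itv /= => /andP[a b]; have [] := dF t; rewrite ?(ltW a) ?(ltW b).
  + by apply: cvg_at_right_filter; apply: cF; rewrite lexx ler01.
  + by apply: cvg_at_left_filter; apply: cF; rewrite lexx ler01.
- move=> t; rewrite in_itv /= => /andP[a b].
  by rewrite derive1E; apply: derive_val; apply: dF; rewrite !ltW.
Qed.

Lemma is_derive_linarg F (v t d : R) : is_derive (t * v) 1 F d ->
  is_derive t 1 (fun s => F (s * v)) (d * v).
Proof.
move=> [dF vF].
have dF' : differentiable F (0 + t *: v) by rewrite add0r; exact/derivable1_diffP.
have := derive_line dF'.
have -> : 'D_v F (0 + t *: v) = d * v.
  by rewrite derive_scale1// add0r [t *: v]/(t * v) vF mulrC.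
by under [X in is_derive _ _ X]eq_fun do rewrite add0r.
Qed.

(** Writing the primitive as v times an average keeps the domain of
    integration fixed: its dependence on parameters is that of averages. *)
Lemma is_derive_prim f (a b v : R) : a < 0 -> 0 < b -> a < v < b ->
  (forall t : R, a <= t <= b -> {for t, continuous f}) ->
  is_derive v 1 (fun u => u * mean01 (fun t => f (t * u))) (f v).
Proof.
move=> a0 b0 /andP[av vb] cf.
pose P x := (\int[mu]_(t in `[a, x]) f t)%R.
have dP x : a < x < b -> is_derive x 1 P (f x).
  move=> /andP[ax xb].
  have [|d1 d2] := @continuous_FTC1_closed R f a x b xb (cont_integrable cf) ax.
    by apply: cf; rewrite !ltW.
  apply: DeriveDef; first exact: d1.
  by rewrite -derive1E; exact: d2.
have E u : a < u < b -> u * mean01 (fun t => f (t * u)) = P u - P 0.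
  move=> /andP[au ub].
  have tu t : 0 <= t <= 1 -> a < t * u < b.
    move=> /andP[t0 t1]; have [u0|u0] := lerP 0 u; apply/andP; split; nra.
  have cfu : cont01 (fun t => f (t * u)).
    move=> t t01; apply: (@continuous_comp R R R (fun s => s * u) f).
      by apply: cvgM; [exact: cvg_id|exact: cvg_cst].
    by apply: cf; have /andP[? ?] := tu t t01; rewrite !ltW.
  rewrite -mean01Z//; have -> : P u - P 0 = P (1 * u) - P (0 * u) by rewrite mul1r mul0r.
  apply: (@mean01_FTC (fun t => P (t * u))) => [t t01|t t01].
    by apply: cvgM; [exact: cvg_cst|exact: cfu].
  by rewrite mulrC; apply: is_derive_linarg; apply: dP; exact: tu.
have H : is_derive v 1 (fun u => P u - P 0) (f v).
  have dv := dP v; rewrite av vb in dv; have {}dv := dv isT.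
  by apply: is_derive_eq; rewrite subr0.
apply: near_eq_is_derive H.
have : \forall u \near v, u \in `]a, b[ by apply: near_in_itvoo; rewrite in_itv /= av.
by apply: filterS => u; rewrite in_itv /= => /E.
Qed.

Lemma is_derive0_cst (F : R -> R) (a b : R) :
  (forall t : R, a < t < b -> is_derive t 1 F 0) ->
  {within `[a, b], continuous F} ->
  forall t : R, a <= t <= b -> F t = F a.
Proof.
move=> dF cF t /andP[]; rewrite le_eqVlt => /predU1P[->//|at_ tb].
have [||c _] := @MVT R F (fun=> 0) a t at_.
- move=> x; rewrite in_itv /= => /andP[ax xt]; apply: dF.
  by rewrite ax (lt_le_trans xt).
- apply: continuous_subspaceW cF => x /=; rewrite !in_itv /= => /andP[-> xt].
  exact: le_trans xt tb.
by rewrite mul0r => /eqP; rewrite subr_eq0 => /eqP.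
Qed.

End Mean.

Section ParamMean.
Variable R : realType.

Lemma continuous_at_eps (T : topologicalType) (F : normedModType R) (f : T -> F)
    (x : T) :
  (forall e : R, 0 < e -> \forall y \near x, `|f y - f x| <= e) ->
  {for x, continuous f}.
Proof.
move=> H; apply/pseudometric_normed_Zmodule.cvgrPdist_le => e e0.
by apply: filterS (H e e0) => y; rewrite distrC.
Qed.

Lemma fiber_open (T : topologicalType) (O : set (T * R)) : open O ->
  open [set x | forall t : R, 0 <= t <= 1 -> O (x, t)].
Proof.
move=> oO; rewrite openE => x Ox; apply: (@tube_seg R T 0 1 x (fun y t => O (y, t))).
move=> t t01; have := open_nbhs_nbhs (conj oO (Ox t t01)).
by apply: filterS => -[].
Qed.

Lemma cont01_fiber (T : topologicalType) (O : set (T * R)) (f : T * R -> R) x :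
  (forall q, O q -> {for q, continuous f}) ->
  (forall t : R, 0 <= t <= 1 -> O (x, t)) -> cont01 (fun t => f (x, t)).
Proof. by move=> cf Ox t /Ox/cf/(continuous_slice R). Qed.

(** Compactness of the unit interval makes the continuity of f uniform in t. *)
Lemma mean01_cont (T : topologicalType) (O : set (T * R)) (f : T * R -> R) (x : T) :
  open O -> (forall q, O q -> {for q, continuous f}) ->
  (forall t : R, 0 <= t <= 1 -> O (x, t)) ->
  {for x, continuous (fun y => mean01 (fun t => f (y, t)))}.
Proof.
move=> oO cf Ox; apply: continuous_at_eps => e e0.
have fib := open_nbhs_nbhs (conj (fiber_open oO) Ox).
have e20 : 0 < e / 2 by rewrite divr_gt0.
have : \forall y \near x, forall t : R, 0 <= t <= 1 -> `|f (y, t) - f (x, t)| <= e.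
  apply: (@tube_seg R T 0 1 x (fun y t => is_true (`|f (y, t) - f (x, t)| <= e))).
  move=> t t01.
  have c1 := near_dist (cf _ (Ox t t01)) e20.
  have c2 : \forall q \near (x, t), `|f (x, q.2) - f (x, t)| < e / 2.
    have H := near_dist (continuous_slice R (cf _ (Ox t t01))) e20.
    exact: (@near_cont _ _ snd (x, t) _ cvg_snd H).
  apply: filterS2 c1 c2 => -[y s] /= h1 h2.
  have -> : f (y, s) - f (x, s) = (f (y, s) - f (x, t)) - (f (x, s) - f (x, t)).
    by ring.
  by apply: le_trans (ler_normB _ _) _; rewrite [leRHS]splitr lerD// ltW.
apply: filterS2 fib => y Oy fyx.
have cy := cont01_fiber cf Oy; have cx := cont01_fiber cf Ox.
rewrite -mean01B//; apply: mean01_le => // t t01.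
by apply: cvgB; [exact: cy|exact: cx].
Qed.

Lemma derive_slice_coord (E G F : normedModType R) n (e : 'I_n -> E)
    (c : 'I_n -> E -> R) (f : E * G -> F) q (v : E) :
  coordinates e c -> differentiable f q ->
  'D_(v, 0) f q = \sum_i c i v *: 'D_(e i, 0) f q.
Proof.
move=> [cl cc cs] df; rewrite deriveE//.
have -> : ((v, 0) : E * G) = \sum_i c i v *: ((e i, 0) : E * G).
  rewrite [v in LHS]cs; elim/big_rec2 : _ => // i a b _ <-.
  by congr pair; rewrite /= ?scaler0 ?addr0.
rewrite linear_sum; apply: eq_bigr => i _.
by rewrite linearZ (deriveE _ df).
Qed.

Lemma open_cont_preimage (S T : topologicalType) (f : S -> T) (A : set T) :
  continuous f -> open A -> open (f @^-1` A).
Proof. by move=> cf; apply: open_comp => x _; exact: cf. Qed.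

(** Integrate the derivative along the segment from x to y, expanded in the
    coordinates of y - x: an increment of the form used in [caratheodory]. *)
Lemma hadamard_slice (E G : normedModType R) n (e : 'I_n -> E)
    (c : 'I_n -> E -> R) (O : set (E * G)) (f : E * G -> R) (x y : E) (t : G) :
  coordinates e c -> Ck_on 1 O f ->
  (forall u : R, 0 <= u <= 1 -> O (x + u *: (y - x), t)) ->
  f (y, t) = f (x, t) +
    \sum_i c i (y - x) * mean01 (fun u => 'D_(e i, 0) f (x + u *: (y - x), t)).
Proof.
move=> co Cf Oxy; have [df _] := Cf; set v := y - x.
have lineE (u : R) : (x + u *: v, t) = (x, t) + u *: (v, 0).
  by congr pair; rewrite /= scaler0 addr0.
have cg i : cont01 (fun u => 'D_(e i, 0) f (x + u *: v, t)).
  move=> u u01.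
  apply: (@continuous_comp _ _ _ (fun u : R => (x + u *: v, t)) ('D_(e i, 0) f)).
    apply: cvg_pair; last exact: cvg_cst.
    apply: cvgD; first exact: cvg_cst.
    by apply: cvgZ; [exact: cvg_id|exact: cvg_cst].
  by apply: (Ck_on_cont (Ck_on_derive (e i, 0) Cf)); exact: Oxy.
pose g (u : R) := \sum_i c i v * 'D_(e i, 0) f (x + u *: v, t).
have -> : \sum_i c i v * mean01 (fun u => 'D_(e i, 0) f (x + u *: v, t)) = mean01 g.
  rewrite mean01_sum; last first.
    by move=> i u u01; apply: cvgM; [exact: cvg_cst|exact: cg].
  by apply: eq_bigr => i _; rewrite mean01Z.
have -> : mean01 g = f ((x, t) + 1 *: (v, 0)) - f ((x, t) + 0 *: (v, 0)).
  apply: (@mean01_FTC _ (fun u => f ((x, t) + u *: (v, 0)))) => u u01.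
    apply: (@cvg_bigsum R R) => i.
    by apply: cvgM; [exact: cvg_cst|exact: cg].
  have d := df _ (Oxy u u01).
  rewrite /g -(derive_slice_coord _ co d) lineE; apply: derive_line.
  by rewrite -lineE.
rewrite scale1r scale0r addr0 addrC subrK.
by congr f; congr pair; rewrite /= ?addr0 // /v addrC subrK.
Qed.

(** Differentiation under the integral sign. The average over t of Hadamard's
    formula in x is an increment of the form used in [caratheodory], with
    coefficients that are themselves averages, hence continuous; the derivative
    is then the average of the derivative, and the induction proceeds. *)
Lemma Ck_on_mean01 (E : normedModType R) k (U : set E) (O : set (E * R))
    (f : E * R -> R) : findim E -> open U -> open O ->
  (forall x t, U x -> 0 <= t <= 1 -> O (x, t)) -> Ck_on k O f ->
  Ck_on k U (fun x => mean01 (fun t => f (x, t))).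
Proof.
move=> [n [e [c co]]] oU oO UO; elim: k f => [|k IH] f Cf.
  by move=> x Ux; apply: (mean01_cont oO) => // t; exact: UO.
suff H x : U x -> differentiable (fun x => mean01 (fun t => f (x, t))) x /\
    forall v, 'D_v (fun x => mean01 (fun t => f (x, t))) x =
       mean01 (fun t => 'D_(v, 0) f (x, t)).
  split=> [x /H[]//|v].
  by apply: Ck_on_congr oU _ (IH _ (Ck_on_derive (v, 0) Cf)) => x /H[_ ->].
move=> Ux; have [df _] := Cf.
have C1 : Ck_on 1 O f by exact: Ck_onW Cf.
pose L (q : (E * R) * R) : E * R := (x + q.2 *: (q.1.1 - x), q.1.2).
have cL : continuous L.
  have fE : findim E by exists n, e, c.
  move=> q; apply: smooth_near_cont; apply: smooth_pair => //.
  - apply: smoothD; first exact: smooth_cst.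
    apply: smoothZ; first exact: smooth_snd.
    apply: smoothB; last exact: smooth_cst.
    by apply: smooth_lin => // u; apply: (@continuous_comp _ _ _ fst fst); exact: cvg_fst.
  - by apply: smooth_lin => // u; apply: (@continuous_comp _ _ _ fst snd); [exact: cvg_fst|exact: cvg_snd].
have oO2 : open (L @^-1` O) by exact: open_cont_preimage.
have oO1 := fiber_open oO2.
have oO0 := fiber_open oO1.
set O1 := (X in open X) in oO1; set O0 := (X in open X) in oO0.
have O0x : O0 x.
  by move=> t t01 u u01; rewrite /= /L /= subrr scaler0 addr0; exact: UO.
pose g i (q : E * R) := mean01 (fun u => 'D_(e i, 0) f (L (q, u))).
have cg i q : O1 q -> {for q, continuous (g i)}.
  move=> O1q; apply: (mean01_cont oO2 (f := fun q => 'D_(e i, 0) f (L q))) => //.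
  move=> q' Oq'; apply: (@continuous_comp _ _ _ L ('D_(e i, 0) f)); first exact: cL.
  exact: (Ck_on_cont (Ck_on_derive (e i, 0) Cf)).
have gx i t : 0 <= t <= 1 -> g i (x, t) = 'D_(e i, 0) f (x, t).
  move=> t01; rewrite -[RHS]mean01_cst; apply: mean01_ext => u _.
  by rewrite /L /= subrr scaler0 addr0.
have cf y t : O0 y -> 0 <= t <= 1 -> O (y, t).
  move=> /(_ t) H /H /(_ 1); rewrite /= ler01 lexx => /(_ isT).
  by rewrite /L /= scale1r addrC subrK.
have fE y : O0 y -> mean01 (fun t => f (y, t)) = mean01 (fun t => f (x, t)) +
    \sum_i c i (y - x) *: mean01 (fun t => g i (y, t)).
  move=> O0y.
  have cgi i : cont01 (fun t => g i (y, t)) by exact: cont01_fiber (cg i) O0y.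
  have cs i : cont01 (fun t => c i (y - x) * g i (y, t)).
    by move=> t t01; apply: cvgM; [exact: cvg_cst|exact: cgi].
  have -> : \sum_i c i (y - x) *: mean01 (fun t => g i (y, t)) =
      mean01 (fun t => \sum_i c i (y - x) * g i (y, t)).
    by rewrite mean01_sum//; apply: eq_bigr => i _; rewrite mean01Z.
  have cfx : cont01 (fun t => f (x, t)).
    by apply: (cont01_fiber (O := O)) => [q|t]; [exact: Ck_on_cont C1|exact: UO].
  rewrite -(mean01D cfx (cont01_sum cs)).
  apply: mean01_ext => t t01.
  by rewrite (hadamard_slice co C1 (x := x))// => u u01; exact: (O0y t t01 u u01).
have cg0 i : {for x, continuous (fun y => mean01 (fun t => g i (y, t)))}.
  by apply: (mean01_cont oO1 (cg i)) => t t01; exact: O0x.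
have near0 : \forall y \near x, mean01 (fun t => f (y, t)) = mean01 (fun t => f (x, t)) +
    \sum_i c i (y - x) *: mean01 (fun t => g i (y, t)).
  exact: near_open oO0 O0x fE.
have [d D] := caratheodory co cg0 near0.
split=> // v; rewrite D.
have E1 i : mean01 (fun t => g i (x, t)) = mean01 (fun t => 'D_(e i, 0) f (x, t)).
  by apply: mean01_ext => t t01; exact: gx.
have cD i : cont01 (fun t => 'D_(e i, 0) f (x, t)).
  apply: (@cont01_fiber _ O ('D_(e i, 0) f)) => [q Oq|t]; last exact: UO.
  exact: (Ck_on_cont (Ck_on_derive (e i, 0) Cf)).
under eq_bigr do rewrite E1.
rewrite (_ : (fun t => _) = fun t => 'D_(v, 0) f (x, t))//.
rewrite [RHS](mean01_ext (g := fun t => \sum_i c i v * 'D_(e i, 0) f (x, t))); last first.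
  by move=> t t01; rewrite (derive_slice_coord _ co)//; apply: df; exact: UO.
rewrite mean01_sum => [|i t t01].
  by apply: eq_bigr => i _; rewrite mean01Z.
by apply: cvgM; [exact: cvg_cst|exact: cD].
Qed.

Lemma smooth_mean01 (E : normedModType R) (f : E * R -> R) (x : E) : findim E ->
  (forall t : R, 0 <= t <= 1 -> smooth_near (x, t) f) ->
  smooth_near x (fun x => mean01 (fun t => f (x, t))).
Proof.
move=> fE sf; pose O := [set q | smooth_near q f].
have oO : open O by rewrite openE => q /smooth_near_near.
have [_ CO] : smooth_on O f by exact: smooth_onP.
exists [set x | forall t : R, 0 <= t <= 1 -> O (x, t)] => //.
split; first exact: fiber_open.
move=> k; apply: (Ck_on_mean01 fE (fiber_open oO) oO) => // y t Oy t01.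
exact: Oy.
Qed.

End ParamMean.

(** * Scalar implicit functions *)

Section Implicit.
Variables (R : realType) (E : normedModType R).

Lemma derive_neg_decr (f df : R -> R) (a b : R) :
  (forall t : R, a <= t <= b -> is_derive t 1 f (df t)) ->
  (forall t : R, a <= t <= b -> df t < 0) ->
  forall s t : R, a <= s -> s < t -> t <= b -> f t < f s.
Proof.
move=> d1 d2 s t as_ st tb.
have [||c] := @MVT R f df s t st.
- move=> x; rewrite in_itv /= => /andP[sx xt]; apply: d1.
  by rewrite (le_trans as_ (ltW sx)) (le_trans (ltW xt)).
- apply: within_cont => x /andP[sx xt]; apply: is_derive_cont; apply: d1.
  by rewrite (le_trans as_) ?(le_trans xt).
rewrite in_itv /= => /andP[sc ct] E1; rewrite -subr_lt0 E1 pmulr_llt0 ?subr_gt0//.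
by apply: d2; rewrite (le_trans as_ (ltW sc)) (le_trans (ltW ct)).
Qed.

Lemma derive_slice2 (f : E * R -> R) (q : E) (t : R) :
  differentiable f (q, t) ->
  is_derive t 1 (fun u => f (q, u)) ('D_(0, 1) f (q, t)).
Proof.
have lE u : (q, u) = (q, 0) + u *: (0, 1) :> E * R.
  by congr pair; rewrite /= ?scaler0 ?addr0 ?add0r//; rewrite [u *: _]mulr1.
move=> df; rewrite [in 'D_(0, 1) f _]lE.
rewrite (_ : (fun u => _) = fun u : R => f ((q, 0) + u *: (0, 1))).
  by apply: derive_line; rewrite -lE.
by apply/funext => u; rewrite -lE.
Qed.

Lemma hadamard_slice2 (O : set (E * R)) (f : E * R -> R) (q : E) (s t : R) :
  Ck_on 1 O f -> (forall u : R, 0 <= u <= 1 -> O (q, s + u * (t - s))) ->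
  f (q, t) = f (q, s) +
    (t - s) * mean01 (fun u => 'D_(0, 1) f (q, s + u * (t - s))).
Proof.
move=> Cf Oq; have [df _] := Cf.
have cD : cont01 (fun u => 'D_(0, 1) f (q, s + u * (t - s))).
  move=> u u01.
  apply: (@continuous_comp _ _ _ (fun u : R => (q, s + u * (t - s))) ('D_(0, 1) f)).
    apply: cont_pair; first exact: cvg_cst.
    apply: cvgD; first exact: cvg_cst.
    by apply: cvgM; [exact: cvg_id|exact: cvg_cst].
  exact: (Ck_on_cont (Ck_on_derive ((0, 1) : E * R) Cf) (Oq u u01)).
have lE u : (q, s + u * (t - s)) = (q, s) + u *: (0, t - s) :> E * R.
  by congr pair; rewrite /= ?scaler0 ?addr0.
rewrite -mean01Z//.
have -> : mean01 (fun u => (t - s) * 'D_(0, 1) f (q, s + u * (t - s))) =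
    f ((q, s) + 1 *: (0, t - s)) - f ((q, s) + 0 *: (0, t - s)).
  apply: (@mean01_FTC _ (fun u => f ((q, s) + u *: (0, t - s)))) => u u01.
    by apply: cvgM; [exact: cvg_cst|exact: cD].
  have d := df _ (Oq u u01).
  have -> : (t - s) * 'D_(0, 1) f (q, s + u * (t - s)) =
      'D_(0, t - s) f ((q, s) + u *: (0, t - s)).
    rewrite -lE !deriveE// -[LHS](linearZ_LR ('d f (q, s + u * (t - s)))).
    by congr ('d f _ _); congr pair; rewrite /= ?scaler0// [_ *: _]mulr1.
  by apply: derive_line; rewrite -lE.
by rewrite -!lE mul1r mul0r addr0 (addrC s) subrK addrC subrK.
Qed.

(** The zero is trapped in a fixed interval [a, b] on which f (q, _) decreases
    for every q near q0. Besides the zero, this gives the sign of f on the whole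
    of [a, b], which is what tells on which side of the seam an orbit is. *)
Lemma implicit_function (q0 : E) (f : E * R -> R) (a b : R) : findim E -> a < b ->
  (forall u : R, a <= u <= b -> smooth_near (q0, u) f) ->
  (forall u : R, a <= u <= b -> 'D_(0, 1) f (q0, u) < 0) ->
  0 < f (q0, a) -> f (q0, b) < 0 ->
  exists phi : E -> R, smooth_near q0 phi /\
    \forall q \near q0, [/\ a < phi q < b, f (q, phi q) = 0,
      (forall u, a <= u -> u < phi q -> 0 < f (q, u)) &
      (forall u, phi q < u -> u <= b -> f (q, u) < 0)].
Proof.
move=> [n [e [c co]]] ab sf df fa fb.
have aI : a <= a <= b by rewrite lexx ltW.
have bI : a <= b <= b by rewrite lexx ltW.
pose O := [set p : E * R | smooth_near p f /\ 'D_(0, 1) f p < 0].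
have oO : open O.
  rewrite openE => p [sp dp].
  have cd := smooth_near_cont (smooth_derive ((0, 1) : E * R) sp).
  by apply: filterS2 (smooth_near_near sp) (near_lt0 cd dp) => y.
have [_ CO] : smooth_on O f by apply: smooth_onP => // p [].
have cO p : O p -> {for p, continuous f} by move=> [/smooth_near_cont].
have : \forall q \near q0, (forall u, a <= u <= b -> O (q, u)) /\
    0 < f (q, a) /\ f (q, b) < 0.
  apply: filterI.
    apply: (@tube_seg R E a b q0 (fun q u => O (q, u))) => t tI.
    have Ot : O (q0, t) by split; [exact: sf|exact: df].
    by apply: filterS (open_nbhs_nbhs (conj oO Ot)) => -[].
  apply: filterI.
    by apply: (@near_gt0 _ _ (fun q => f (q, a))) => //; apply/(continuous_slice1 R)/smooth_near_cont/sf.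
  by apply: (@near_lt0 _ _ (fun q => f (q, b))) => //; apply/(continuous_slice1 R)/smooth_near_cont/sf.
move=> /near_ex_open[Q [oQ Qq0 HQ]].
have decr q : Q q -> forall s t : R, a <= s -> s < t -> t <= b -> f (q, t) < f (q, s).
  move=> /HQ[Oq _]; apply: (@derive_neg_decr (fun u => f (q, u)) (fun u => 'D_(0, 1) f (q, u))).
    by move=> t /Oq[/smooth_diff d _]; exact: derive_slice2.
  by move=> t /Oq[].
have zero q : exists u, Q q -> a < u < b /\ f (q, u) = 0.
  have [Qq|nQ] := pselect (Q q); last by exists 0.
  have [Oq [fqa fqb]] := HQ q Qq.
  have [||u] := @IVT R (fun u => f (q, u)) a b 0 (ltW ab).
  - by apply: within_cont => t /Oq/cO/(continuous_slice R).
  - by rewrite ge_min le_max (ltW fqb) (ltW fqa) orbT.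
  rewrite in_itv /= => /andP[au ub] fu; exists u => _; split=> //.
  rewrite !lt_neqAle au ub !andbT; apply/andP; split.
    by apply: contraTneq fqa => ->; rewrite fu ltxx.
  by apply: contraTneq fqb => <-; rewrite fu ltxx.
have [phi phiP] := choice zero.
have phiI q : Q q -> a <= phi q <= b.
  by move=> /phiP[/andP[u v] _]; rewrite !ltW.
have pos q u : Q q -> a <= u -> u < phi q -> 0 < f (q, u).
  move=> Qq au uphi; have [/andP[_ pb] <-] := phiP q Qq.
  by apply: decr => //; exact: ltW.
have neg q u : Q q -> phi q < u -> u <= b -> f (q, u) < 0.
  move=> Qq uphi ub; have [/andP[ap _] <-] := phiP q Qq.
  by apply: decr => //; exact: ltW.
exists phi; split; last first.
  apply: filterS (open_nbhs_nbhs (conj oQ Qq0)) => q Qq; have [pI p0] := phiP q Qq.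
  by split=> // u; [exact: pos|exact: neg].
have OP q : Q q -> O (q, phi q) by move=> Qq; have [Oq _] := HQ q Qq; apply/Oq/phiI.
have cphi q : Q q -> {for q, continuous phi}.
  move=> Qq; apply: continuous_at_eps => eps eps0.
  have [/andP[ap pb] _] := phiP q Qq; have [Oq _] := HQ q Qq.
  pose u1 := Num.max a (phi q - eps); pose u2 := Num.min b (phi q + eps).
  have u1p : u1 < phi q by rewrite /u1 gt_max ap ltrBlDr ltrDl.
  have u2p : phi q < u2 by rewrite /u2 lt_min pb ltrDl.
  have au1 : a <= u1 by rewrite /u1 le_max lexx.
  have u2b : u2 <= b by rewrite /u2 ge_min lexx.
  have N1 : \forall q' \near q, 0 < f (q', u1).
    apply: (@near_gt0 _ _ (fun q => f (q, u1))); last exact: pos.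
    by apply/(continuous_slice1 R)/cO/Oq; rewrite au1 ltW// (lt_trans u1p).
  have N2 : \forall q' \near q, f (q', u2) < 0.
    apply: (@near_lt0 _ _ (fun q => f (q, u2))); last exact: neg.
    by apply/(continuous_slice1 R)/cO/Oq; rewrite u2b andbT ltW// (lt_trans ap).
  have N3 : \forall q' \near q, Q q' by exact: open_nbhs_nbhs.
  apply: filterS (filterI N3 (filterI N1 N2)) => q' [Qq' [f1 f2]].
  have p1 : u1 < phi q'.
    rewrite ltNge; apply/negP => H; have := f1; rewrite ltNge => /negP; apply.
    have [/andP[ap' _] p0] := phiP q' Qq'.
    move: H; rewrite le_eqVlt => /predU1P[<-|H]; first by rewrite p0.
    by apply/ltW/neg => //; rewrite (le_trans (ltW u1p)) ?ltW.
  have p2 : phi q' < u2.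
    rewrite ltNge; apply/negP => H; have := f2; rewrite ltNge => /negP; apply.
    have [_ p0] := phiP q' Qq'.
    move: H; rewrite le_eqVlt => /predU1P[->|H]; first by rewrite p0.
    by apply/ltW/pos => //; rewrite (le_trans (ltW ap)) ?ltW.
  have q1 : phi q - eps < phi q' by move: p1; rewrite /u1 gt_max => /andP[].
  have q2 : phi q' < phi q + eps by move: p2; rewrite /u2 lt_min => /andP[].
  by rewrite ler_norml; apply/andP; split; lra.
exists Q => //; split=> // k; elim: k => [|k IH]; first by move=> q Qq; exact: cphi.
have main q : Q q -> differentiable phi q /\ forall v, 'D_v phi q =
    - ('D_(v, 0) f (q, phi q) * ('D_(0, 1) f (q, phi q))^-1).
  move=> Qq; have [_ p0] := phiP q Qq; have Op := OP q Qq.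
  have C1 : Ck_on 1 O f by exact: CO.
  have cD w p : O p -> {for p, continuous ('D_w f)}.
    exact: Ck_on_cont (Ck_on_derive w C1).
  (* the set of (q', w) such that the segments from (q, w) to (q', w) and from
     (q, phi q) to (q, w) stay in O *)
  pose L (x : (E * R) * R) : E * R := (q + x.2 *: (x.1.1 - q), x.1.2).
  pose L' (x : R * R) : E * R := (q, phi q + x.2 * (x.1 - phi q)).
  have cL : continuous L.
    move=> x; apply: smooth_near_cont; apply: smooth_pair => //.
    - apply: smoothD; first exact: smooth_cst.
      apply: smoothZ; first exact: smooth_snd.
      apply: smoothB; last exact: smooth_cst.
      by apply: smooth_lin => // u; apply: (@continuous_comp _ _ _ fst fst); exact: cvg_fst.
    - by apply: smooth_lin => // u; apply: (@continuous_comp _ _ _ fst snd); [exact: cvg_fst|exact: cvg_snd].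
  have cL' : continuous L'.
    move=> x; apply: smooth_near_cont; apply: smooth_pair => //; first exact: smooth_cst.
    apply: smoothD; first exact: smooth_cst.
    apply: smoothM; first exact: smooth_snd.
    by apply: smoothB; [exact: smooth_fst|exact: smooth_cst].
  have oLO : open (L @^-1` O) by exact: open_cont_preimage.
  have oLO' : open (L' @^-1` O) by exact: open_cont_preimage.
  have oV := fiber_open oLO; have oV' := fiber_open oLO'.
  set V := (X in open X) in oV; set V' := (X in open X) in oV'.
  have Vq : V (q, phi q).
    by move=> t t01; rewrite /= /L /= subrr scaler0 addr0.
  have V'q : V' (phi q).
    by move=> t t01; rewrite /= /L' /= subrr mulr0 addr0.
  pose m i (x : E * R) := mean01 (fun u => 'D_(e i, 0) f (L (x, u))).
  pose mu (w : R) := mean01 (fun u => 'D_(0, 1) f (L' (w, u))).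
  have cm i x : V x -> {for x, continuous (m i)}.
    move=> Vx; apply: (mean01_cont oLO (f := fun x => 'D_(e i, 0) f (L x))) => //.
    move=> y Oy; apply: (@continuous_comp _ _ _ L ('D_(e i, 0) f)); first exact: cL.
    exact: cD.
  have cmu w : V' w -> {for w, continuous mu}.
    move=> Vx; apply: (mean01_cont oLO' (f := fun x => 'D_(0, 1) f (L' x))) => //.
    move=> y Oy; apply: (@continuous_comp _ _ _ L' ('D_(0, 1) f)); first exact: cL'.
    exact: cD.
  have mq i : m i (q, phi q) = 'D_(e i, 0) f (q, phi q).
    rewrite -[RHS]mean01_cst; apply: mean01_ext => u _.
    by rewrite /L /= subrr scaler0 addr0.
  have muq : mu (phi q) = 'D_(0, 1) f (q, phi q).
    rewrite -[RHS]mean01_cst; apply: mean01_ext => u _.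
    by rewrite /L' /= subrr mulr0 addr0.
  have mu_neq0 : mu (phi q) != 0 by rewrite muq; case: Op => _ D0; rewrite lt_eqF.
  have cpq := cphi q Qq.
  have cpair : {for q, continuous (fun q' => (q', phi q'))}.
    by apply: cont_pair => //; exact: cvg_id.
  have ca i : {for q, continuous (fun q' => - (m i (q', phi q') * (mu (phi q'))^-1))}.
    apply: cvgN; apply: cvgM.
      by apply: (@continuous_comp _ _ _ (fun q' => (q', phi q')) (m i)) => //; exact: cm.
    apply: cvgV => //.
    by apply: (@continuous_comp _ _ _ phi mu) => //; exact: cmu.
  have nearE : \forall q' \near q, phi q' = phi q +
      \sum_i c i (q' - q) *: - (m i (q', phi q') * (mu (phi q'))^-1).
    have N1 : \forall q' \near q, Q q' by exact: open_nbhs_nbhs.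
    have N2 : \forall q' \near q, V (q', phi q').
      apply: (@near_cont _ _ (fun q' => (q', phi q')) q V) => //.
      exact: open_nbhs_nbhs.
    have N3 : \forall q' \near q, V' (phi q').
      by apply: (@near_cont _ _ phi q V') => //; exact: open_nbhs_nbhs.
    have N4 : \forall q' \near q, mu (phi q') != 0.
      rewrite neq_lt in mu_neq0.
      have cmp : {for q, continuous (fun q' => mu (phi q'))}.
        by apply: (@continuous_comp _ _ _ phi mu) => //; exact: cmu.
      have [H|H] := orP mu_neq0.
        by apply: filterS (near_lt0 cmp H) => q' ?; rewrite lt_eqF.
      by apply: filterS (near_gt0 cmp H) => q' ?; rewrite gt_eqF.
    apply: filterS (filterI (filterI N1 N2) (filterI N3 N4)) => q'.
    move=> [[Qq' Vq'] [V'q' mu0]].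
    have [_ p0'] := phiP q' Qq'.
    have h1 := hadamard_slice co C1 (x := q) (y := q') (t := phi q') Vq'.
    have h2 := hadamard_slice2 (q := q) (s := phi q) (t := phi q') C1 V'q'.
    rewrite p0' h2 p0 add0r in h1.
    have h3 : (phi q' - phi q) * mu (phi q') = - \sum_i c i (q' - q) * m i (q', phi q').
      by apply/eqP; rewrite -addr_eq0; apply/eqP; exact: esym h1.
    rewrite -[LHS](subrK (phi q)) addrC; congr (_ + _).
    rewrite -[LHS](mulfK mu0) h3 mulNr mulr_suml -sumrN; apply: eq_bigr => i _.
    by rewrite -[RHS]/(_ * - _) mulrN mulrA.
  have [d D] := caratheodory co ca nearE.
  split=> // v; rewrite D.
  rewrite (derive_slice_coord v co); last by case: Op => /smooth_diff.
  rewrite mulr_suml -sumrN; apply: eq_bigr => i _.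
  by rewrite mq muq -[LHS]/(_ * - _) mulrN mulrA.
split=> [q /main[]//|v].
have Cp : Ck_on k Q (fun q => (q, phi q)).
  by apply: Ck_on_pair => //; apply: Ck_on_lin => // q; exact: cvg_id.
have fE : findim (E * R)%type.
  by apply: findim_prod; [exists n, e, c|exact: findim_real].
have CD w : Ck_on k Q (fun q => 'D_w f (q, phi q)).
  exact: (Ck_on_comp fE oQ Cp (Ck_on_derive w (CO k.+1)) OP).
apply: (@Ck_on_congr _ _ _ k Q _ _ oQ _
  (Ck_onN oQ (Ck_onM oQ (CD ((v, 0) : E * R)) (Ck_onV oQ _ (CD ((0, 1) : E * R)))))).
  by move=> q /main[_ ->].
by move=> q /OP[_ D0]; rewrite lt_eqF.
Qed.
End Implicit.

(** * Differential equations with parameters *)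

Lemma open_cont_on (S T : topologicalType) (A : set S) (g : S -> T) (B : set T) :
  open A -> open B -> (forall x, A x -> {for x, continuous g}) ->
  open [set x | A x /\ B (g x)].
Proof.
move=> oA oB cg; rewrite openE => x [Ax Bx].
apply: filterS2 (open_nbhs_nbhs (conj oA Ax)) (@near_cont _ _ g x B (cg x Ax) _) => //.
exact: open_nbhs_nbhs.
Qed.

Lemma geometric_le0 (R : realType) (a c : R) :
  (forall n, a <= c / 2 ^+ n) -> a <= 0.
Proof.
move=> H; rewrite leNgt; apply/negP => a0.
have c0 : 0 < c by have := H 0%N; rewrite expr0 divr1; apply: lt_le_trans.
have := H (Num.bound (c / a)).
have h2n n : n%:R < (2 : R) ^+ n by rewrite -natrX ltr_nat ltn_expl.
rewrite ler_pdivlMr ?exprn_gt0// leNgt => /negP; apply.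
rewrite mulrC -ltr_pdivrMr//; apply: lt_trans (h2n _).
apply: archi_boundP; exact: divr_ge0 (ltW _) (ltW _).
Qed.

Lemma geometric_limit (R : realType) (u : nat -> R) (C : R) :
  (forall n, `|u n.+1 - u n| <= C / 2 ^+ n) ->
  exists l, forall n, `|u n - l| <= (2 * C) / 2 ^+ n.
Proof.
move=> H.
pose a n := u n - (2 * C) / 2 ^+ n; pose b n := u n + (2 * C) / 2 ^+ n.
have E n : (2 * C) / 2 ^+ n = (2 * C) / 2 ^+ n.+1 + C / 2 ^+ n.
  have : (2 : R) ^+ n != 0 by rewrite expf_neq0// pnatr_eq0.
  by rewrite exprS => ?; field.
have C0 : 0 <= C by have := H 0%N; rewrite expr0 divr1; exact: le_trans.
have aS n : a n <= a n.+1.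
  by have := H n; rewrite ler_norml /a (E n) => /andP[]; lra.
have bS n : b n.+1 <= b n.
  by have := H n; rewrite ler_norml /b (E n) => /andP[]; lra.
have ab n : a n <= b n.
  by have : 0 <= (2 * C) / 2 ^+ n; [rewrite divr_ge0 ?exprn_ge0// mulr_ge0|rewrite /a /b; lra].
have amon n m : (n <= m)%N -> a n <= a m.
  by move=> /subnK <-; elim: (m - n)%N => // k IH; rewrite addSn (le_trans IH).
have bmon n m : (n <= m)%N -> b m <= b n.
  by move=> /subnK <-; elim: (m - n)%N => // k IH; rewrite addSn (le_trans _ IH).
have anbm n m : a n <= b m.
  have [nm|/ltnW mn] := leqP n m; first by rewrite (le_trans (amon _ _ nm)).
  by rewrite (le_trans (ab n))// bmon.
have hs : has_sup (range a).
  by split; [exists (a 0%N), 0%N|exists (b 0%N) => _ [n _ <-]].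
exists (sup (range a)) => n.
have h1 : a n <= sup (range a) by apply: sup_upper_bound hs _ _; exists n.
have h2 : sup (range a) <= b n by apply: ge_sup; [exists (a 0%N), 0%N|move=> _ [m _ <-]].
by rewrite ler_norml; apply/andP; split; move: h1 h2; rewrite /a /b; lra.
Qed.

Section Prim.
Variables (R : realType) (E : normedModType R).

(** The primitive in the last variable that vanishes at 0, in the form suited
    to averages. *)
Definition prim (f : E * R -> R) (x : E * R) : R :=
  x.2 * mean01 (fun t => f (x.1, t * x.2)).

Variables (Q : set E) (M : R).
Hypotheses (oQ : open Q) (M0 : 0 < M).

Definition cyl : set (E * R) := [set x | Q x.1 /\ `|x.2| < M].

Lemma cyl_open : open cyl.
Proof.
apply: (@open_cont_on _ _ (fst @^-1` Q) (fun x : E * R => `|x.2|) [set r : R | r < M]).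
- by apply: open_cont_preimage => // x; exact: cvg_fst.
- exact: open_lt.
- by move=> x _; apply: cvg_norm; exact: cvg_snd.
Qed.

Lemma cyl_star x (t : R) : cyl x -> 0 <= t <= 1 -> cyl (x.1, t * x.2).
Proof.
move=> [Qx xM] /andP[t0 t1]; split=> //=; apply: le_lt_trans xM.
by rewrite normrM ger0_norm// ler_piMl.
Qed.

Let stretch (z : (E * R) * R) : E * R := (z.1.1, z.2 * z.1.2).

Let stretch_smooth z : findim E -> smooth_near z stretch.
Proof.
move=> fE; apply: smooth_pair.
  by apply: smooth_lin => // u; apply: (@continuous_comp _ _ _ fst fst); exact: cvg_fst.
apply: smoothM; first exact: smooth_snd.
by apply: smooth_lin => // u; apply: (@continuous_comp _ _ _ fst snd); [exact: cvg_fst|exact: cvg_snd].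
Qed.

Lemma Ck_on_prim k (f : E * R -> R) : findim E ->
  Ck_on k cyl f -> Ck_on k cyl (prim f).
Proof.
move=> fE Cf; have ocyl := cyl_open.
have fER : findim (E * R)%type by apply: findim_prod => //; exact: findim_real.
have cs : continuous stretch by move=> z; exact/smooth_near_cont/stretch_smooth.
have oS : open (stretch @^-1` cyl) by exact: open_cont_preimage.
apply: Ck_onM => //.
  by apply: Ck_on_lin => // x; exact: cvg_snd.
apply: (@Ck_on_mean01 _ _ k cyl (stretch @^-1` cyl) (fun z => f (stretch z))) => //.
  by move=> x t Dx t01; exact: cyl_star.
have [_ Cs] : smooth_on (stretch @^-1` cyl) stretch.
  by apply: smooth_onP => // z _; exact: stretch_smooth.
by apply: (Ck_on_comp fER oS (Cs k) Cf).
Qed.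

Lemma prim_cont (f : E * R -> R) : findim E ->
  (forall x, cyl x -> {for x, continuous f}) ->
  forall x, cyl x -> {for x, continuous (prim f)}.
Proof. by move=> fE cf; exact: (@Ck_on_prim 0 f fE cf). Qed.

Lemma cyl_cont01 (f : E * R -> R) x :
  (forall x, cyl x -> {for x, continuous f}) -> cyl x ->
  cont01 (fun t => f (x.1, t * x.2)).
Proof.
move=> cf Dx t t01.
apply: (@continuous_comp _ _ _ (fun t : R => (x.1, t * x.2)) f).
  apply: cont_pair; first exact: cvg_cst.
  by apply: cvgM; [exact: cvg_id|exact: cvg_cst].
by apply: cf; exact: cyl_star.
Qed.

Lemma is_derive_primitive (f : E * R -> R) q v :
  (forall x, cyl x -> {for x, continuous f}) -> cyl (q, v) ->
  is_derive v 1 (fun u => prim f (q, u)) (f (q, v)).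
Proof.
move=> cf [Qq vM]; pose b := (`|v| + M) / 2.
have vb : `|v| < b by rewrite /b /=; move: vM => /=; lra.
have bM : b < M by rewrite /b; move: vM => /=; lra.
have b0 : 0 < b by apply: le_lt_trans vb.
apply: (@is_derive_prim R (fun u => f (q, u)) (- b) b v) => //.
- by rewrite oppr_lt0.
- by rewrite -ltr_norml.
- move=> t tb; apply: (continuous_slice R); apply: cf; split=> //=.
  by rewrite (le_lt_trans _ bM)// ler_norml.
Qed.

Lemma cyl_unique (g h df : R -> R) q :
  Q q -> g 0 = h 0 ->
  (forall v : R, `|v| < M -> is_derive v 1 g (df v)) ->
  (forall v : R, `|v| < M -> is_derive v 1 h (df v)) ->
  forall v : R, `|v| < M -> g v = h v.
Proof.
move=> Qq gh0 dg dh v vM.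
have d0 (t : R) : `|t| < M -> is_derive t 1 (fun u => g u - h u) 0.
  by move=> tM; have d1 := dg t tM; have d2 := dh t tM; apply: is_derive_eq; rewrite subrr.
pose b := (`|v| + M) / 2.
have vb : `|v| < b by rewrite /b /=; move: vM => /=; lra.
have bM : b < M by rewrite /b; move: vM => /=; lra.
have b0 : 0 < b by apply: le_lt_trans vb.
have tM t : - b <= t <= b -> `|t| < M.
  by move=> tb; rewrite (le_lt_trans _ bM)// ler_norml.
have H t : - b <= t <= b -> g t - h t = g (- b) - h (- b).
  apply: (@is_derive0_cst R (fun u => g u - h u)) => [s /andP[s1 s2]|].
    by apply: d0; apply: tM; rewrite !ltW.
  by apply: within_cont => s /tM/d0/is_derive_cont.
apply/eqP; rewrite -subr_eq0 H; last by rewrite -ler_norml ltW.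
by rewrite -(H 0) ?gh0 ?subrr// oppr_le0 !ltW.
Qed.

Lemma prim0 f q : prim f (q, 0) = 0.
Proof. by rewrite /prim /= mul0r. Qed.

Lemma prim_le (f : E * R -> R) (C : R) x :
  (forall x, cyl x -> {for x, continuous f}) ->
  (forall x, cyl x -> `|f x| <= C) -> cyl x -> `|prim f x| <= `|x.2| * C.
Proof.
move=> cf fC Dx; rewrite normrM ler_wpM2l//.
by apply: mean01_le => [|t t01]; [exact: cyl_cont01|apply/fC/cyl_star].
Qed.

Lemma primB (f g : E * R -> R) x :
  (forall x, cyl x -> {for x, continuous f}) ->
  (forall x, cyl x -> {for x, continuous g}) -> cyl x ->
  prim f x - prim g x = prim (fun y => f y - g y) x.
Proof.
by move=> cf cg Dx; rewrite /prim -mulrBr -mean01B//; exact: cyl_cont01.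
Qed.

End Prim.

Section Picard.
Variables (R : realType) (E : normedModType R).
Variables (Q : set E) (M Y C L : R) (O : set ((E * R) * R)) (F : (E * R) * R -> R).
Hypotheses (fE : findim E) (oQ : open Q) (M0 : 0 < M) (Y0 : 0 <= Y).
Hypotheses (sF : smooth_on O F).
Hypothesis OQ : forall x y, cyl Q M x -> `|y| <= Y -> O (x, y).
Hypothesis FC : forall x y, cyl Q M x -> `|y| <= Y -> `|F (x, y)| <= C.
Hypothesis FL : forall x y, cyl Q M x -> `|y| <= Y -> `|'D_(0, 1) F (x, y)| <= L.
Hypotheses (CMY : C * M <= Y) (LM : L * M <= 2^-1).

Let D := cyl Q M.

Definition admissible (y : E * R -> R) : Prop :=
  (forall x, D x -> {for x, continuous y}) /\ (forall x, D x -> `|y x| <= Y).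

Let T (y : E * R -> R) : E * R -> R := prim (fun x => F (x, y x)).

Lemma subst_cont y : admissible y ->
  forall x, D x -> {for x, continuous (fun x => F (x, y x))}.
Proof.
move=> [cy yY] x Dx; have [_ CF] := sF.
apply: (@continuous_comp _ _ _ (fun x => (x, y x)) F).
  by apply: cont_pair; [exact: cvg_id|exact: cy].
by apply: (CF 0%N); apply: OQ => //; exact: yY.
Qed.

Lemma picard_admissible y : admissible y -> admissible (T y).
Proof.
move=> ay; have cF := subst_cont ay; have [_ yY] := ay; split=> [x Dx|x Dx].
  exact: (prim_cont oQ fE cF).
apply: le_trans (prim_le (C := C) cF _ Dx) _ => [z Dz|].
  by apply: FC => //; exact: yY.
have [_ /= xM] := Dx; apply: le_trans CMY; rewrite mulrC ler_wpM2l ?(ltW xM)//.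
have H := FC (y := y x) Dx (yY x Dx); exact: le_trans H.
Qed.

Lemma F_lipschitz x y1 y2 : D x -> `|y1| <= Y -> `|y2| <= Y ->
  `|F (x, y1) - F (x, y2)| <= L * `|y1 - y2|.
Proof.
move=> Dx y1Y y2Y; have [oO CF] := sF.
have sY (u : R) : 0 <= u <= 1 -> `|y2 + u * (y1 - y2)| <= Y.
  move: y1Y y2Y; rewrite !ler_norml => /andP[a1 a2] /andP[b1 b2] /andP[u0 u1].
  by apply/andP; split; nra.
have Ou u : 0 <= u <= 1 -> O (x, y2 + u * (y1 - y2)) by move=> /sY; exact: OQ.
rewrite (hadamard_slice2 (CF 1%N) Ou) [F _ + _]addrC addrK normrM mulrC ler_wpM2r//.
apply: mean01_le => [u u01|u u01]; last by apply: FL => //; exact: sY.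
apply: (@continuous_comp _ _ _ (fun u : R => (x, y2 + u * (y1 - y2))) ('D_(0, 1) F)).
  apply: cont_pair; first exact: cvg_cst.
  apply: cvgD; first exact: cvg_cst.
  by apply: cvgM; [exact: cvg_id|exact: cvg_cst].
exact: (Ck_on_cont (Ck_on_derive ((0, 1) : (E * R) * R) (CF 1%N)) (Ou u u01)).
Qed.

(** L * M <= 1/2 makes one iteration a contraction of ratio 1/2 over the whole
    time interval. *)
Lemma picard_contraction y z (d : R) : admissible y -> admissible z ->
  (forall x, D x -> `|y x - z x| <= d) ->
  forall x, D x -> `|T y x - T z x| <= d / 2.
Proof.
move=> ay az yz x Dx; have cy := subst_cont ay; have cz := subst_cont az.
have [_ yY] := ay; have [_ zY] := az.
have L0 : 0 <= L by have := FL (y := y x) Dx (yY x Dx); exact: le_trans.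
have d0 : 0 <= d by have := yz x Dx; exact: le_trans.
rewrite (primB cy cz Dx); apply: le_trans (prim_le (C := L * d) _ _ Dx) _.
- by move=> w Dw; apply: cvgB; [exact: cy|exact: cz].
- move=> w Dw; apply: le_trans (F_lipschitz Dw (yY w Dw) (zY w Dw)) _.
  by rewrite ler_wpM2l// yz.
- have [_ /= xM] := Dx; rewrite mulrA [d / 2]mulrC ler_wpM2r//.
  by apply: le_trans LM; rewrite mulrC ler_wpM2l// ltW.
Qed.

(** The iterates starting from 0 form a geometric Cauchy sequence; the limit
    is continuous because the convergence is uniform. *)
Lemma picard : exists y, admissible y /\
  forall x, D x -> y x = prim (fun x => F (x, y x)) x.
Proof.
pose ys n := iter n T (fun=> 0).
have ays n : admissible (ys n).
  elim: n => [|n IH]; last exact: picard_admissible.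
  by split=> [x _|x _]; [exact: cvg_cst|rewrite normr0].
have step n x : D x -> `|ys n.+1 x - ys n x| <= Y / 2 ^+ n.
  elim: n x => [|n IH] x Dx.
    by rewrite expr0 divr1 subr0; have [_] := ays 1%N; exact.
  rewrite exprSr invfM mulrA.
  by apply: (@picard_contraction (ys n.+1) (ys n)).
have lim x : exists l, D x -> forall n, `|ys n x - l| <= (2 * Y) / 2 ^+ n.
  have [Dx|nD] := pselect (D x); last by exists 0.
  by have [l Hl] := geometric_limit (u := fun n => ys n x) (fun n => step n x Dx); exists l.
have [y Hy] := choice lim.
have yY x : D x -> `|y x| <= Y.
  move=> Dx; rewrite -subr_le0; apply: (@geometric_le0 R _ (2 * Y)) => n.
  have h1 := Hy x Dx n; have h2 := (ays n).2 x Dx.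
  rewrite lerBlDl; apply: le_trans (lerD h2 h1).
  by rewrite -[y x in leLHS](subKr (ys n x)); exact: ler_normB.
have cy x : D x -> {for x, continuous y}.
  move=> Dx; apply: continuous_at_eps => eps eps0.
  have [n Hn] : exists n, (2 * Y) / 2 ^+ n <= eps / 3.
    apply/not_existsP => H.
    have : eps / 3 <= 0.
      by apply: (@geometric_le0 R _ (2 * Y)) => n; have /negP := H n; rewrite -ltNge => /ltW.
    by rewrite leNgt divr_gt0.
  have e3 : 0 < eps / 3 by rewrite divr_gt0.
  have N1 := near_dist ((ays n).1 x Dx) e3.
  have N2 : \forall z \near x, D z.
    by apply: open_nbhs_nbhs; split=> //; exact: cyl_open.
  apply: filterS2 N1 N2 => z zx Dz.
  have h1 := Hy x Dx n; have h2 := Hy z Dz n.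
  have -> : y z - y x = (ys n z - ys n x) - (ys n z - y z) + (ys n x - y x) by ring.
  apply: le_trans (ler_normD _ _) _.
  have -> : eps = eps / 3 + eps / 3 + eps / 3 by field.
  apply: lerD; last exact: le_trans h1 Hn.
  apply: le_trans (ler_normB _ _) _.
  by apply: lerD; [exact: ltW|exact: le_trans h2 Hn].
have ay : admissible y by [].
exists y; split=> // x Dx; apply/eqP; rewrite -subr_eq0 -normr_le0.
apply: (@geometric_le0 R _ (2 * Y)) => n.
have h1 := Hy x Dx n.+1.
have h2 := picard_contraction ay (ays n) (d := (2 * Y) / 2 ^+ n) _ Dx.
have {}h2 : `|T y x - T (ys n) x| <= (2 * Y) / 2 ^+ n / 2.
  by apply: h2 => z Dz; rewrite distrC; exact: Hy.
have -> : (2 * Y) / 2 ^+ n = (2 * Y) / 2 ^+ n.+1 + (2 * Y) / 2 ^+ n / 2.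
  have : (2 : R) ^+ n != 0 by rewrite expf_neq0// pnatr_eq0.
  by rewrite exprS => ?; field.
have -> : y x - prim (fun x => F (x, y x)) x =
  - (T (ys n) x - y x) - (T y x - T (ys n) x) by rewrite /T; ring.
by apply: le_trans (ler_normB _ _) _; rewrite normrN lerD.
Qed.

End Picard.

Lemma is_derive_expR_comp (R : realType) (f : R -> R) (s d : R) :
  is_derive s 1 f d -> is_derive s 1 (fun u => expR (f u)) (d * expR (f s)).
Proof.
move=> df; have dexp := is_derive_expR (f s).
by apply: (@is_derive_eq _ _ _ _ _ _ _ _ (is_derive1_comp dexp df)); rewrite mulrC.
Qed.

Lemma is_derive_sum_scal (R : realType) n (C : 'I_n -> R) (f : 'I_n -> R -> R)
    (d : 'I_n -> R) (t : R) : (forall i, is_derive t 1 (f i) (d i)) ->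
  is_derive t 1 (fun u => \sum_i C i * f i u) (\sum_i C i * d i).
Proof.
move=> df.
have -> : (fun u => \sum_i C i * f i u) = \sum_i (fun u => C i * f i u).
  by apply/funext => u; rewrite fct_sumE.
exact: is_derive_sum.
Qed.

(** [caratheodory] on a product with R, the direction of R being singled out. *)
Lemma caratheodory_prod (R : realType) (E : normedModType R) n
    (e : 'I_n -> E * R) (c : 'I_n -> E * R -> R)
    (f : E * R -> R) (x : E * R) (a : 'I_n -> E * R -> R) (b : E * R -> R) :
  coordinates e c -> (forall i, {for x, continuous (a i)}) ->
  {for x, continuous b} ->
  (\forall z \near x, f z = f x + \sum_i c i (z.1 - x.1, 0) * a i z
     + (z.2 - x.2) * b z) ->
  differentiable f x /\
  forall w, 'D_w f x = \sum_i c i (w.1, 0) * a i x + w.2 * b x.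
Proof.
move=> co ca cb nf; have [cl cc cs] := co.
have clin i u v : c i (u + v) = c i u + c i v.
  by have := cl i 1 u v; rewrite scale1r mul1r.
pose a' i z := a i z + (e i).2 * (b z - \sum_j c j (0, 1) * a j z).
have key (w : E * R) z : \sum_i c i w * a' i z =
    \sum_i c i (w.1, 0) * a i z + w.2 * b z.
  have w2 : w.2 = \sum_i c i w * (e i).2.
    rewrite [in LHS](cs w); elim/big_rec2 : _ => // i u v _ <-.
    by [].
  have wE : w = (w.1, 0) + w.2 *: (0, 1).
    case: w {w2} => w1 w2; congr pair; rewrite /= ?scaler0 ?addr0 ?add0r//.
    by rewrite [_ *: _]mulr1.
  have cwE i : c i w = c i (w.1, 0) + w.2 * c i (0, 1).
    rewrite [in LHS]wE clin; congr (_ + _).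
    have := cl i w.2 (0, 1) 0; rewrite addr0 => ->.
    have : c i 0 = 0 by have := clin i 0 0; rewrite addr0 => /eqP; rewrite -subr_eq subrr => /eqP.
    by move=> ->; rewrite addr0.
  under eq_bigr do rewrite /a' mulrDr mulrA.
  rewrite big_split /= -mulr_suml -w2.
  under eq_bigr do rewrite cwE mulrDl.
  rewrite big_split /= mulrBr -addrA; congr (_ + _).
  under eq_bigr do rewrite -mulrA.
  by rewrite -mulr_sumr addrC subrK.
have ca' i : {for x, continuous (a' i)}.
  apply: cvgD; first exact: ca.
  apply: cvgM; first exact: cvg_cst.
  apply: cvgB; first exact: cb.
  apply: (@cvg_bigsum R R) => j.
  by apply: cvgM; [exact: cvg_cst|exact: ca].
have nf' : \forall z \near x, f z = f x + \sum_i c i (z - x) *: a' i z.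
  by apply: filterS nf => z ->; rewrite -addrA; congr (_ + _); exact: (esym (key (z - x) z)).
have [d D] := caratheodory co ca' nf'.
by split=> // w; rewrite D; exact: key.
Qed.

Section SolutionSmooth.
Variables (R : realType) (E : normedModType R).
Variables (Q : set E) (M Y : R) (O : set ((E * R) * R)) (F : (E * R) * R -> R).
Hypotheses (fE : findim E) (oQ : open Q) (M0 : 0 < M).
Hypotheses (sF : smooth_on O F).
Hypothesis OQ : forall x y, cyl Q M x -> `|y| <= Y -> O (x, y).
Variable y : E * R -> R.
Let D := cyl Q M.
Hypothesis cy : forall x, D x -> {for x, continuous y}.
Hypothesis yY : forall x, D x -> `|y x| <= Y.
Hypothesis yP : forall x, D x -> y x = prim (fun x => F (x, y x)) x.

Lemma sol_subst_cont k (G : (E * R) * R -> R) : Ck_on k O G -> Ck_on k D y ->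
  Ck_on k D (fun x => G (x, y x)).
Proof.
move=> CG Cy; have oD : open D by exact: cyl_open.
have fER : findim ((E * R) * R)%type.
  by do ?[exact: fE | exact: findim_real | apply: findim_prod].
apply: (Ck_on_comp fER oD _ CG); last by move=> x Dx; apply: OQ => //; exact: yY.
by apply: Ck_on_pair => //; apply: Ck_on_lin => // x; exact: cvg_id.
Qed.

Lemma sol_derive q s : D (q, s) ->
  is_derive s 1 (fun u => y (q, u)) (F ((q, s), y (q, s))).
Proof.
move=> Dqs; have [_ CF] := sF.
have H := is_derive_primitive (sol_subst_cont (CF 0%N) cy) Dqs.
apply: near_eq_is_derive H.
have oD : open D by exact: cyl_open.
have N : \forall u \near s, D (q, u).
  apply: (@near_cont _ _ (fun u : R => (q, u)) s D).
    by apply: cont_pair; [exact: cvg_cst|exact: cvg_id].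
  exact: open_nbhs_nbhs.
by apply: filterS N => u /yP ->.
Qed.

Let oD : open D := cyl_open oQ.

Section BasePoint.
Variables (n : nat) (e : 'I_n -> E * R) (c : 'I_n -> E * R -> R).
Hypothesis co : coordinates e c.
Variable q : E.
Hypothesis Qq : Q q.

Let base (z : E * R) : E * R := (q, z.2).
(** The parameters that see q inside Q, as Hadamard's formula needs the whole
    segment. *)
Definition visible : set E :=
  [set q' | forall u : R, 0 <= u <= 1 -> Q (q + u *: (q' - q))].

Lemma visible_open : open visible.
Proof.
apply: (@fiber_open R E [set w : E * R | Q (q + w.2 *: (w.1 - q))]).
apply: (@open_cont_preimage _ _ (fun w : E * R => q + w.2 *: (w.1 - q))) => // w.
apply: cvgD; first exact: cvg_cst.
apply: cvgZ; first exact: cvg_snd.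
by apply: cvgB; [exact: cvg_fst|exact: cvg_cst].
Qed.

Lemma visible_refl : visible q.
Proof. by move=> u _; rewrite subrr scaler0 addr0. Qed.

Let Dq := cyl visible M.

Let oDq : open Dq := cyl_open visible_open.

Lemma visible_sub z : Dq z -> D z.
Proof.
move=> [/(_ 1)]; rewrite lexx ler01 => /(_ isT); rewrite scale1r addrC subrK.
by split.
Qed.

Lemma base_sub z : Dq z -> D (base z).
Proof. by move=> [_ zM]; split. Qed.

Let seg1 (w : (E * R) * R) : (E * R) * R :=
  (base w.1 + w.2 *: (w.1 - base w.1), y w.1).
Let seg2 (w : (E * R) * R) : (E * R) * R :=
  (base w.1, y (base w.1) + w.2 * (y w.1 - y (base w.1))).

Let A : set ((E * R) * R) := fst @^-1` Dq.
Let oA : open A.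
Proof. by apply: open_cont_preimage => // w; exact: cvg_fst. Qed.

Let base_cont z : {for z, continuous base}.
Proof. by apply: cont_pair; [exact: cvg_cst|exact: cvg_snd]. Qed.

Let base1_cont (w : (E * R) * R) : {for w, continuous (fun w => base w.1)}.
Proof.
apply: (@continuous_comp _ _ _ fst base); first exact: cvg_fst.
exact: base_cont.
Qed.

Let y1_cont (w : (E * R) * R) : A w -> {for w, continuous (fun w => y w.1)}.
Proof.
move=> Aw; apply: (@continuous_comp _ _ _ fst y); first exact: cvg_fst.
by apply: cy; exact: visible_sub.
Qed.

Let seg1_cont w : A w -> {for w, continuous seg1}.
Proof.
move=> Aw; apply: cont_pair; last exact: y1_cont.
apply: cvgD; first exact: base1_cont.
apply: cvgZ; first exact: cvg_snd.
by apply: cvgB; [exact: cvg_fst|exact: base1_cont].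
Qed.

Let seg2_cont w : A w -> {for w, continuous seg2}.
Proof.
move=> Aw; apply: cont_pair; first exact: base1_cont.
have H : {for w, continuous (fun w => y (base w.1))}.
  apply: (@continuous_comp _ _ _ (fun w => base w.1) y); first exact: base1_cont.
  by apply: cy; exact: base_sub.
apply: cvgD; first exact: H.
apply: cvgM; first exact: cvg_snd.
by apply: cvgB; [exact: y1_cont|exact: H].
Qed.

Let oO : open O := sF.1.

Let seg1_in z (u : R) : Dq z -> 0 <= u <= 1 -> A (z, u) /\ O (seg1 (z, u)).
Proof.
move=> Dz u01; split=> //; apply: OQ; last exact/yY/visible_sub.
have [Vz zM] := Dz; split=> /=; first exact: Vz.
by rewrite subrr scaler0 addr0.
Qed.

Let seg2_in z (u : R) : Dq z -> 0 <= u <= 1 -> A (z, u) /\ O (seg2 (z, u)).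
Proof.
move=> Dz u01; split=> //; apply: OQ; first exact: base_sub.
have := yY (visible_sub Dz); have := yY (base_sub Dz).
rewrite /= !ler_norml => /andP[a1 a2] /andP[b1 b2]; have /andP[u0 u1] := u01.
by apply/andP; split; nra.
Qed.

Definition lin_coef i (z : E * R) : R :=
  mean01 (fun u => 'D_(e i, 0) F (seg1 (z, u))).
Definition lin_rate (z : E * R) : R :=
  mean01 (fun u => 'D_(0, 1) F (seg2 (z, u))).

Let DF_cont w p : O p -> {for p, continuous ('D_w F)}.
Proof. by have [_ CF] := sF; exact: Ck_on_cont (Ck_on_derive w (CF 1%N)). Qed.

Lemma lin_coef_cont i z : Dq z -> {for z, continuous (lin_coef i)}.
Proof.
move=> Dz; have oO1 := open_cont_on oA oO seg1_cont.
apply: (mean01_cont oO1 (f := fun w => 'D_(e i, 0) F (seg1 w))).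
  move=> w [Aw Ow]; apply: (@continuous_comp _ _ _ seg1 ('D_(e i, 0) F)).
    exact: seg1_cont.
  exact: DF_cont.
by move=> t t01; exact: seg1_in.
Qed.

Lemma lin_rate_cont z : Dq z -> {for z, continuous lin_rate}.
Proof.
move=> Dz; have oO2 := open_cont_on oA oO seg2_cont.
apply: (mean01_cont oO2 (f := fun w => 'D_(0, 1) F (seg2 w))).
  move=> w [Aw Ow]; apply: (@continuous_comp _ _ _ seg2 ('D_(0, 1) F)).
    exact: seg2_cont.
  exact: DF_cont.
by move=> t t01; exact: seg2_in.
Qed.

Definition int_factor : E * R -> R := prim lin_rate.

Lemma int_factor_cont z : Dq z -> {for z, continuous int_factor}.
Proof. by apply: (prim_cont visible_open fE) => w; exact: lin_rate_cont. Qed.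

Let source i (z : E * R) : R := expR (- int_factor z) * lin_coef i z.

Let exp_cont (f : E * R -> R) z : {for z, continuous f} ->
  {for z, continuous (fun z => expR (f z))}.
Proof.
move=> cf; apply: (@continuous_comp _ _ _ f (@expR R)) => //.
exact: continuous_expR.
Qed.

Let source_cont i z : Dq z -> {for z, continuous (source i)}.
Proof.
move=> Dz; apply: cvgM; last exact: lin_coef_cont.
by apply: exp_cont; apply: cvgN; exact: int_factor_cont.
Qed.

Definition var_coef i (z : E * R) : R := expR (int_factor z) * prim (source i) z.

Lemma var_coef_cont i z : Dq z -> {for z, continuous (var_coef i)}.
Proof.
move=> Dz; apply: cvgM; first exact/exp_cont/int_factor_cont.
by apply: (prim_cont visible_open fE) Dz => w; exact: source_cont.
Qed.

Let F_increment z : Dq z -> F (z, y z) - F (base z, y (base z)) =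
  \sum_i c i (z.1 - q, 0) * lin_coef i z + (y z - y (base z)) * lin_rate z.
Proof.
move=> Dz; have [_ CF] := sF.
have h1 : F (z, y z) = F (base z, y z) + \sum_i c i (z - base z) * lin_coef i z.
  apply: (@hadamard_slice R _ _ n e c O F (base z) z (y z) co (CF 1%N)) => u u01.
  by have [] := seg1_in Dz u01.
have h2 : F (base z, y z) = F (base z, y (base z)) +
    (y z - y (base z)) * lin_rate z.
  apply: (@hadamard_slice2 R _ O F (base z) (y (base z)) (y z) (CF 1%N)) => u u01.
  by have [] := seg2_in Dz u01.
have bz : z - base z = (z.1 - q, 0) by congr pair; rewrite /= subrr.
by rewrite h1 h2 bz; ring.
Qed.

(** The difference of the solutions at z.1 and at q solves a linear equation in
    time whose coefficients are averages of the derivatives of F between the two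
    solutions, hence continuous. Solving it with the integrating factor gives an
    increment of the form used in [caratheodory]. *)
Lemma sol_increment z : Dq z ->
  y z = y (base z) + \sum_i c i (z.1 - q, 0) * var_coef i z.
Proof.
case: z => q' s Dz; have [Vq' sM] := Dz.
have Dqt (t : R) : `|t| < M -> Dq (q', t) by [].
have D1 (t : R) : `|t| < M -> D (q', t) by move=> /Dqt/visible_sub.
have D2 (t : R) : `|t| < M -> D (q, t) by [].
have y0 p : y (p, 0) = 0 \/ ~ Q p.
  have [Qp|nQ] := pselect (Q p); last by right.
  by left; rewrite yP ?prim0//; split=> //=; rewrite normr0.
pose C i := c i (q' - q, 0).
have [_ Qq'] : True /\ Q q' by split=> //; have [] := D1 s sM.
have E1 := @cyl_unique R E Q M
  (fun t => (y (q', t) - y (q, t)) * expR (- int_factor (q', t)))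
  (fun t => \sum_i C i * prim (source i) (q', t))
  (fun t => \sum_i C i * source i (q', t)) q Qq.
have -> : y (q', s) = y (q, s) + (y (q', s) - y (q, s)) by ring.
congr (_ + _).
have {E1} H : (y (q', s) - y (q, s)) * expR (- int_factor (q', s)) =
   \sum_i C i * prim (source i) (q', s).
  apply: (E1 _ _ _ s) => //=.
  - case: (y0 q') => // ->; case: (y0 q) => // ->; rewrite subrr mul0r.
    by rewrite big1// => i _; rewrite prim0 mulr0.
  - move=> t tM.
    have d1 := sol_derive (D1 t tM); have d2 := sol_derive (D2 t tM).
    have d3 := is_derive_primitive lin_rate_cont (Dqt t tM).
    have d4 := is_derive_expR_comp (is_deriveN d3).
    apply: (@is_derive_eq _ _ _ _ _ _ _ _ (is_deriveM (is_deriveB d1 d2) d4)).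
    rewrite /GRing.scale /=.
    have := F_increment (Dqt t tM); rewrite /base /= => ->.
    rewrite /source -/int_factor.
    under [RHS]eq_bigr do rewrite mulrCA.
    rewrite -mulr_sumr /C.
    rewrite -[((fun u => y (q', u)) - _) t]/(y (q', t) - y (q, t)).
    rewrite -[(- (fun u => int_factor (q', u))) t]/(- int_factor (q', t)).
    by ring.
  - move=> t tM; apply: is_derive_sum_scal => i.
    by apply: (is_derive_primitive (f := source i) _ (Dqt t tM)) => w; exact: source_cont.
have -> : y (q', s) - y (q, s) = expR (int_factor (q', s)) *
    ((y (q', s) - y (q, s)) * expR (- int_factor (q', s))).
  by rewrite mulrCA expRxMexpNx_1 mulr1.
by rewrite H mulr_sumr; apply: eq_bigr => i _; rewrite mulrCA.
Qed.

End BasePoint.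

Lemma sol_differentiable n (e : 'I_n -> E * R) (c : 'I_n -> E * R -> R) q s :
  coordinates e c -> D (q, s) ->
  differentiable y (q, s) /\ forall w, 'D_w y (q, s) =
    \sum_i c i (w.1, 0) * var_coef e q i (q, s) + w.2 * F ((q, s), y (q, s)).
Proof.
move=> co Dqs; have [Qq sM] := Dqs; have [_ CF] := sF.
pose G u := F ((q, u), y (q, u)).
have cG (u : R) : `|u| < M -> {for u, continuous G}.
  move=> uM; apply: (continuous_slice R (f := fun x => F (x, y x))).
  by apply: (sol_subst_cont (CF 0%N) cy).
pose b (z : E * R) := mean01 (fun t => G (s + t * (z.2 - s))).
pose V : set ((E * R) * R) := [set w | `|s + w.2 * (w.1.2 - s)| < M].
have cl (w0 : (E * R) * R) : {for w0, continuous (fun w : (E * R) * R => s + w.2 * (w.1.2 - s))}.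
  apply: cvgD; first exact: cvg_cst.
  apply: cvgM; first exact: cvg_snd.
  apply: cvgB; last exact: cvg_cst.
  by apply: (@continuous_comp _ _ _ fst snd); [exact: cvg_fst|exact: cvg_snd].
have oV : open V.
  apply: (@open_cont_preimage _ _ (fun w : (E * R) * R => `|s + w.2 * (w.1.2 - s)|)
    [set r : R | r < M]); last exact: open_lt.
  by move=> w; apply: cvg_norm; exact: cl.
have convV (z : E * R) (t : R) : `|z.2| < M -> 0 <= t <= 1 -> V (z, t).
  move: sM; rewrite /V /= !ltr_norml => /andP[a1 a2] /andP[b1 b2] /andP[t0 t1].
  have [h|h] := lerP s z.2; apply/andP; split; nra.
have cb : {for (q, s), continuous b}.
  apply: (mean01_cont oV (f := fun w => G (s + w.2 * (w.1.2 - s)))).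
    move=> w Vw; apply: (@continuous_comp _ _ _ (fun w : (E * R) * R => s + w.2 * (w.1.2 - s)) G).
      exact: cl.
    exact: cG.
  by move=> t; exact: convV.
have bE z : D z -> y (q, z.2) = y (q, s) + (z.2 - s) * b z.
  move=> [_ zM].
  have cg : cont01 (fun t => G (s + t * (z.2 - s))).
    move=> t t01; apply: (@continuous_comp _ _ _ (fun t : R => s + t * (z.2 - s)) G).
      apply: cvgD; first exact: cvg_cst.
      by apply: cvgM; [exact: cvg_id|exact: cvg_cst].
    by apply: cG; exact: (convV z).
  rewrite -mean01Z//.
  have -> : mean01 (fun t => (z.2 - s) * G (s + t * (z.2 - s))) =
      y (q, s + 1 *: (z.2 - s)) - y (q, s + 0 *: (z.2 - s)).
    apply: (@mean01_FTC _ (fun t => y (q, s + t *: (z.2 - s)))) => t t01.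
      by apply: cvgM; [exact: cvg_cst|exact: cg].
    have tM : D (q, s + t * (z.2 - s)) by split=> //; exact: (convV z).
    have [d1 d2] := sol_derive tM.
    have dy : differentiable (fun u : R => y (q, u)) (s + t *: (z.2 - s)).
      exact/derivable1_diffP.
    apply: (@is_derive_eq _ _ _ _ _ _ _ _ (derive_line dy)).
    by rewrite derive_scale1//; congr (_ * _).
  by rewrite scale1r scale0r addr0 addrC (addrC s) !subrK.
have DD : cyl (visible q) M (q, s) by split=> //; exact: visible_refl.
have cvar i : {for (q, s), continuous (var_coef e q i)} by exact: var_coef_cont.
have N : \forall z \near (q, s), y z = y (q, s) +
    \sum_i c i (z.1 - (q, s).1, 0) * var_coef e q i z + (z.2 - (q, s).2) * b z.
  have N : \forall z \near (q, s), cyl (visible q) M z.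
    by apply: open_nbhs_nbhs; split=> //; apply: cyl_open; exact: visible_open.
  apply: filterS N => z Dz; rewrite (sol_increment co Qq Dz) /=.
  by rewrite (bE _ (visible_sub Dz)); ring.
have [d Dd] := caratheodory_prod co cvar cb N.
have bq : b (q, s) = F ((q, s), y (q, s)).
  by rewrite -[RHS]mean01_cst; apply: mean01_ext => t _; rewrite subrr mulr0 addr0.
by split=> // w; rewrite Dd bq.
Qed.

(** In the derivative of y given by [sol_differentiable] only y itself appears,
    under primitives and smooth functions: if y is C^k, so is its derivative. *)
Lemma sol_smooth : findim (E * R)%type -> smooth_on D y.
Proof.
move=> [n [e [c co]]]; split=> // k; have [_ CF] := sF.
elim: k => [|k Cy]; first exact: cy.
split=> [[q s] Dqs|w]; first by have [] := sol_differentiable co Dqs.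
pose rate := prim (fun x => 'D_(0, 1) F (x, y x)).
pose src i x := expR (- rate x) * 'D_(e i, 0) F (x, y x).
have CDF w' : Ck_on k D (fun x => 'D_w' F (x, y x)).
  exact: sol_subst_cont (Ck_on_derive w' (CF k.+1)) Cy.
have Cexp (f : E * R -> R) : Ck_on k D f -> Ck_on k D (fun x => expR (f x)).
  have [U _ [_ Cexp]] := smooth_expR (0 : R).
  move=> Cf; apply: (@Ck_on_comp R _ _ _ k D setT f (@expR R)) => //.
    exact: findim_real.
  by apply: Ck_on_bigcup => t _; have [V Vt [_ /(_ k)]] := smooth_expR t; apply: Ck_on_sub => _ ->.
have Crate : Ck_on k D rate by apply: Ck_on_prim.
have Csrc i : Ck_on k D (src i).
  by apply: Ck_onM => //; apply: Cexp; exact: Ck_onN.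
have Cvar i : Ck_on k D (fun x => expR (rate x) * prim (src i) x).
  by apply: Ck_onM => //; [exact: Cexp|exact: Ck_on_prim].
have rateE x t : D x -> 0 <= t <= 1 ->
    int_factor x.1 (x.1, t * x.2) = rate (x.1, t * x.2).
  move=> Dx t01; rewrite /int_factor /rate /prim /=; congr (_ * _).
  apply: mean01_ext => u u01; rewrite -[RHS]mean01_cst.
  by apply: mean01_ext => r _ /=; rewrite subrr mulr0 addr0.
have varE i q s : D (q, s) ->
    var_coef e q i (q, s) = expR (rate (q, s)) * prim (src i) (q, s).
  move=> Dx; have := rateE (q, s) 1 Dx; rewrite lexx ler01 /= mul1r => /(_ isT) r1.
  rewrite /var_coef r1.
  congr (_ * _); rewrite /prim; congr (_ * _); apply: mean01_ext => t t01.
  have -> := rateE (q, s) t Dx t01.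
  apply: (congr1 (fun r => expR (- rate (q, t * s)) * r)).
  rewrite -[RHS]mean01_cst; apply: mean01_ext => u _ /=.
  by rewrite subrr scaler0 addr0.
have CS : Ck_on k D (fun x => \sum_i c i (w.1, 0) * (expR (rate x) * prim (src i) x)
    + w.2 * F (x, y x)).
  apply: Ck_onD => //.
    by apply: Ck_on_sum => // i; apply: Ck_onM => //; exact: Ck_on_cst.
  apply: Ck_onM => //; first exact: Ck_on_cst.
  exact: sol_subst_cont (CF k) Cy.
apply: Ck_on_congr oD _ CS => -[q s] Dqs.
have [_ ->] := sol_differentiable co Dqs; congr (_ + _).
by apply: eq_bigr => i _; rewrite -varE.
Qed.

End SolutionSmooth.

(** Since F does not depend on y at the base parameter, its derivative in y is
    small nearby. Hence on a time interval of any given length the Picard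
    operator contracts for parameters close to q0. *)
Lemma ode_param (R : realType) (E : normedModType R) (q0 : E)
    (F : (E * R) * R -> R) (M C : R) : findim E -> 0 < M ->
  (forall v y : R, `|v| <= M -> smooth_near ((q0, v), y) F) ->
  (forall v y : R, `|v| <= M -> 'D_(0, 1) F ((q0, v), y) = 0) ->
  (forall v y : R, `|v| <= M -> `|F ((q0, v), y)| < C) ->
  exists y : E * R -> R, \forall q \near q0, forall v : R, `|v| < M ->
    [/\ smooth_near (q, v) y,
        is_derive v 1 (fun u => y (q, u)) (F ((q, v), y (q, v))),
        y (q, 0) = 0 & `|y (q, v)| <= C * M].
Proof.
move=> fE M0 sF dF FC.
pose Y := C * M; pose L := (2 * M)^-1.
have C0 : 0 < C.
  by apply: le_lt_trans (FC 0 0 _) => //; rewrite normr0 ltW.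
have Y0 : 0 <= Y by rewrite mulr_ge0// ltW.
have L0 : 0 < L by rewrite invr_gt0 mulr_gt0.
pose good (z : (E * R) * R) := [/\ smooth_near z F, `|F z| < C & `|'D_(0, 1) F z| < L].
have ng v : `|v| <= M -> forall y : R, - Y <= y <= Y ->
    \forall z \near ((q0, v), y), good z.
  move=> vM y _; have s := sF v y vM.
  have cF : {for ((q0, v), y), continuous (fun z => `|F z|)}.
    by apply: cvg_norm; exact: smooth_near_cont.
  have cD : {for ((q0, v), y), continuous (fun z => `|'D_(0, 1) F z|)}.
    by apply: cvg_norm; exact: (smooth_near_cont (smooth_derive ((0, 1) : (E * R) * R) s)).
  have n1 := smooth_near_near s.
  have n2 := near_lt0 cF (FC v y vM).
  have n3 : \forall z \near ((q0, v), y), `|'D_(0, 1) F z| < L.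
    by apply: near_lt0 cD _; rewrite dF// normr0.
  by apply: filterS2 n1 (filterI n2 n3) => z ? [].
have near1 v : - M <= v <= M -> \forall x \near (q0, v), forall y : R, - Y <= y <= Y ->
    good (x, y).
  rewrite -ler_norml => vM.
  apply: (@tube_seg R _ (- Y) Y (q0, v) (fun x y => good (x, y))) => y yY.
  by apply: filterS (ng v vM y yY) => -[].
have near2 : \forall q \near q0, forall v : R, - M <= v <= M ->
    forall y : R, - Y <= y <= Y -> good ((q, v), y).
  apply: (@tube_seg R _ (- M) M q0 (fun q v => forall y : R, - Y <= y <= Y -> good ((q, v), y))).
  by move=> v vM; apply: filterS (near1 v vM) => -[].
have [Q [oQ Qq0 HQ]] := near_ex_open near2.
pose O := [set z : (E * R) * R | smooth_near z F].
have oO : open O by rewrite openE => z /smooth_near_near.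
have sO : smooth_on O F by exact: smooth_onP.
have gQ x y : cyl Q M x -> `|y| <= Y -> good (x, y).
  case: x => q v [/= Qq vM] yY; apply: HQ => //; last by rewrite -ler_norml.
  by rewrite -ler_norml ltW.
have OQ x y : cyl Q M x -> `|y| <= Y -> O (x, y) by move=> Dx /(gQ x y Dx)[].
have [y [[cy yY] yP]] : exists y, admissible Q M Y y /\
    forall x, cyl Q M x -> y x = prim (fun x => F (x, y x)) x.
  apply: (@picard R E Q M Y C L O F) => //.
  - by move=> x y Dx /(gQ x y Dx)[_ /ltW].
  - by move=> x y Dx /(gQ x y Dx)[_ _ /ltW].
  - by rewrite /L invfM -mulrA mulVf ?mulr1 ?gt_eqF.
exists y; apply: filterS (open_nbhs_nbhs (conj oQ Qq0)) => q Qq v vM.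
have Dx : cyl Q M (q, v) by [].
split; last exact: yY.
- have fER : findim (E * R)%type by apply: findim_prod => //; exact: findim_real.
  exact: smooth_on_near Dx (sol_smooth fE oQ M0 sO OQ cy yY yP fER).
- exact: (sol_derive fE oQ sO OQ cy yY yP Dx).
- by rewrite yP ?prim0//; split=> //=; rewrite normr0.
Qed.

(** * Charts of the plane with parameters *)

Section ImplicitNear.
Variables (R : realType) (E : normedModType R).

Lemma near_radius (x : R) (P : R -> Prop) : (\forall u \near x, P u) ->
  exists2 e : R, 0 < e & forall u, x - e <= u <= x + e -> P u.
Proof.
move=> /nbhs_ballP[e /= e0 He]; exists (e / 2); first by rewrite divr_gt0.
move=> u /andP[u1 u2]; apply: He; rewrite /ball /= ltr_norml.
by apply/andP; split; lra.
Qed.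

(** The sign of the derivative persists on a small interval around u0, to which
    [implicit_function] applies. *)
Lemma implicit_near (q0 : E) (u0 : R) (f : E * R -> R) : findim E ->
  smooth_near (q0, u0) f -> f (q0, u0) = 0 -> 'D_(0, 1) f (q0, u0) < 0 ->
  exists phi : E -> R, [/\ smooth_near q0 phi, phi q0 = u0,
    \forall q \near q0, f (q, phi q) = 0 &
    \forall z \near (q0, u0), f z = 0 -> z.2 = phi z.1].
Proof.
move=> fE sf f0 df.
have nf : \forall u \near u0, smooth_near (q0, u) f /\ 'D_(0, 1) f (q0, u) < 0.
  apply: (@near_cont _ _ (fun u : R => (q0, u)) u0
    (fun z => smooth_near z f /\ 'D_(0, 1) f z < 0)).
    by apply: cont_pair; [exact: cvg_cst|exact: cvg_id].
  have cd := smooth_near_cont (smooth_derive ((0, 1) : E * R) sf).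
  exact: filterS2 (smooth_near_near sf) (near_lt0 cd df).
have [e e0 He] := near_radius nf.
pose a := u0 - e; pose b := u0 + e.
have ab : a < b by rewrite /a /b; lra.
have decr := @derive_neg_decr R (fun u => f (q0, u)) (fun u => 'D_(0, 1) f (q0, u)) a b.
have decr' s t : a <= s -> s < t -> t <= b -> f (q0, t) < f (q0, s).
  apply: decr => u /He[su du] //; apply: derive_slice2; exact: smooth_diff.
have fa : 0 < f (q0, a) by rewrite -f0; apply: decr'; rewrite /a /b; lra.
have fb : f (q0, b) < 0 by rewrite -f0; apply: decr'; rewrite /a /b; lra.
have [phi [sphi nphi]] := @implicit_function R E q0 f a b fE ab
  (fun u uI => (He u uI).1) (fun u uI => (He u uI).2) fa fb.
exists phi; split=> //.
- have [/andP[h1 h2] p0 h3 h4] := nbhs_singleton nphi.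
  have [h|h|//] := ltgtP (phi q0) u0.
    by have := h4 u0 h; rewrite f0 ltxx => /(_ _)/negP-/(_ _)[]; rewrite /b; lra.
  by have := h3 u0 _ h; rewrite f0 ltxx => /(_ _)/negP-/(_ _)[]; rewrite /a; lra.
- by apply: filterS nphi => q [].
- have n1 : \forall z \near (q0, u0), [/\ a < phi z.1 < b, f (z.1, phi z.1) = 0,
      (forall u, a <= u -> u < phi z.1 -> 0 < f (z.1, u)) &
      (forall u, phi z.1 < u -> u <= b -> f (z.1, u) < 0)].
    exact: (@near_cont _ _ fst (q0, u0) _ cvg_fst nphi).
  have n2 : \forall z \near (q0, u0), a < z.2.
    by apply: near_gt0; [exact: cvg_snd|rewrite /a /=; lra].
  have n3 : \forall z \near (q0, u0), z.2 < b.
    by apply: near_lt0; [exact: cvg_snd|rewrite /b /=; lra].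
  apply: filterS (filterI n1 (filterI n2 n3)) => -[q u] /= [[_ p0 h3 h4] [au ub]] fqu.
  have [h|h|//] := ltgtP u (phi q).
    by have := h3 u (ltW au) h; rewrite fqu ltxx.
  by have := h4 u h (ltW ub); rewrite fqu ltxx.
Qed.

End ImplicitNear.

Lemma derive_fst (R : realType) (E F : normedModType R) (w v : E * F) :
  'D_v (fun y : E * F => y.1) w = v.1.
Proof.
have l : linear (fun y : E * F => y.1) by [].
have c : continuous (fun y : E * F => y.1) by move=> y; exact: cvg_fst.
by have [] := derive_lin v w l c.
Qed.

Lemma derive_fst_fst (R : realType) (E F G : normedModType R) (w v : (E * F) * G) :
  'D_v (fun y : (E * F) * G => y.1.1) w = v.1.1.
Proof.
have l : linear (fun y : (E * F) * G => y.1.1) by [].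
have c : continuous (fun y : (E * F) * G => y.1.1).
  by move=> y; apply: (@continuous_comp _ _ _ fst fst); exact: cvg_fst.
by have [] := derive_lin v w l c.
Qed.

Lemma derive_snd (R : realType) (E F : normedModType R) (w v : E * F) :
  'D_v (fun y : E * F => y.2) w = v.2.
Proof.
have l : linear (fun y : E * F => y.2) by [].
have c : continuous (fun y : E * F => y.2) by move=> y; exact: cvg_snd.
by have [] := derive_lin v w l c.
Qed.

Section Partial.
Variables (R : realType) (E F G : normedModType R).

Lemma derive_comp_pair (A : normedModType R) (f : E * F -> G) (u : A -> E) (w : A -> F)
    (x v : A) :
  differentiable u x -> differentiable w x -> differentiable f (u x, w x) ->
  differentiable (fun y => f (u y, w y)) x /\
  'D_v (fun y => f (u y, w y)) x = 'D_('D_v u x, 'D_v w x) f (u x, w x).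
Proof.
move=> du dw df.
have dp := differentiable_pair du dw.
have dc : differentiable (f \o (fun y => (u y, w y))) x by exact: differentiable_comp.
split=> //; rewrite deriveE// [in RHS]deriveE//.
have -> : 'd (fun y => f (u y, w y)) x v =
    'd f (u x, w x) ('d (fun y => (u y, w y)) x v).
  exact: (congr1 (fun h => h v) (diff_comp dp df)).
by rewrite diff_pair// !deriveE.
Qed.

Lemma derive_comp1 (A : normedModType R) (f : E -> G) (u : A -> E) (x v : A) :
  differentiable u x -> differentiable f (u x) ->
  differentiable (fun y => f (u y)) x /\
  'D_v (fun y => f (u y)) x = 'D_('D_v u x) f (u x).
Proof.
move=> du df.
have dc : differentiable (f \o u) x by exact: differentiable_comp.
split=> //; rewrite deriveE// [in RHS]deriveE//.
have -> : 'd (fun y => f (u y)) x v = 'd f (u x) ('d u x v).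
  exact: (congr1 (fun h => h v) (diff_comp du df)).
by rewrite !deriveE.
Qed.

Lemma diff_partial (f : E -> F -> G) (p : E) (x : F) :
  differentiable (joint f) (p, x) ->
  differentiable (f p) x /\ forall v, 'd (f p) x v = 'D_(0, v) (joint f) (p, x).
Proof.
move=> df.
have H v := @derive_comp_pair F (joint f) (fun=> p) (fun y => y) x v
  (differentiable_cst p x) (smooth_diff (smooth_id x)) df.
have d : differentiable (f p) x by have [] := H 0.
split=> [|v]; first exact: d.
rewrite -(deriveE v d); have [_] := H v.
by rewrite derive_cst derive_id.
Qed.

End Partial.

Lemma coord_rV2 (R : realType) (l1 l2 : 'rV[R]_2 -> R) (v1 v2 : 'rV[R]_2) :
  linear l1 -> linear l2 ->
  l1 v1 = 1 -> l1 v2 = 0 -> l2 v1 = 0 -> l2 v2 = 1 ->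
  forall x, x = l1 x *: v1 + l2 x *: v2.
Proof.
move=> lin1 lin2 h11 h12 h21 h22.
pose L1 : {linear 'rV[R]_2 -> R} := HB.pack l1 (GRing.isLinear.Build R _ R _ l1 lin1).
pose L2 : {linear 'rV[R]_2 -> R} := HB.pack l2 (GRing.isLinear.Build R _ R _ l2 lin2).
pose A : 'M[R]_(1 + 1, 2) := col_mx v1 v2.
pose B : 'M[R]_(2, 1 + 1) := row_mx (\col_i l1 (delta_mx 0 i)) (\col_i l2 (delta_mx 0 i)).
have mulB (x : 'rV[R]_2) : x *m B = row_mx (l1 x)%:M (l2 x)%:M.
  rewrite mul_mx_row; congr row_mx; apply/matrixP => i j; rewrite !ord1 !mxE /= mulr1n.
    rewrite [in RHS](row_sum_delta x) -[l1]/(L1 : _ -> _) linear_sum.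
    by apply: eq_bigr => k _; rewrite linearZ mxE.
  rewrite [in RHS](row_sum_delta x) -[l2]/(L2 : _ -> _) linear_sum.
  by apply: eq_bigr => k _; rewrite linearZ mxE.
have AB : A *m B = 1%:M.
  rewrite mul_col_mx !mulB h11 h12 h21 h22 scalar_mx_block.
  have -> : (0 : R)%:M = (0 : 'M[R]_1).
    by apply/matrixP => i j; rewrite !mxE mul0rn.
  by [].
have BA : B *m A = 1%:M by exact: mulmx1C.
move=> x; rewrite -[LHS]mulmx1 -BA mulmxA mulB mul_row_col !mul_scalar_mx.
by [].
Qed.

Lemma derive_lincomb (R : realType) (E F : normedModType R) (f : E -> F) (x u v : E)
    (a : R) : differentiable f x -> 'D_(a *: u + v) f x = a *: 'D_u f x + 'D_v f x.
Proof. by move=> df; rewrite !deriveE// linearP. Qed.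

Lemma derive_lincomb2 (R : realType) (E F : normedModType R) (f : E -> F)
    (x u v : E) (a b : R) : differentiable f x ->
  'D_(a *: u + b *: v) f x = a *: 'D_u f x + b *: 'D_v f x.
Proof. by move=> df; rewrite !deriveE// linearP linearZ_LR. Qed.

Lemma is_derive_unique (R : realType) (F : normedModType R) (f : R -> F) (t : R) (a b : F) :
  is_derive t 1 f a -> is_derive t 1 f b -> a = b.
Proof. by move=> [_ <-] [_ <-]. Qed.

Lemma smooth_is_derive (R : realType) (F : normedModType R) (f : R -> F) (t : R) :
  smooth_near t f -> is_derive t 1 f ('D_1 f t).
Proof. by move=> /smooth_diff df; apply: DeriveDef => //; exact/derivable1_diffP. Qed.

Section Chart.
Variables (R : realType) (E : normedModType R) (fE : findim E).
Variables (p0 : E) (x0 : 'rV[R]_2) (f1 f2 : E * 'rV[R]_2 -> R) (v1 v2 : 'rV[R]_2).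
Hypotheses (sf1 : smooth_near (p0, x0) f1) (sf2 : smooth_near (p0, x0) f2).
Hypotheses (d11 : 'D_(0, v1) f1 (p0, x0) = 1) (d12 : 'D_(0, v2) f1 (p0, x0) = 0).
Hypotheses (d21 : 'D_(0, v1) f2 (p0, x0) = 0) (d22 : 'D_(0, v2) f2 (p0, x0) = 1).
Let t0 := f1 (p0, x0).
Let r0 := f2 (p0, x0).
Let fER : findim (E * R)%type := findim_prod fE (@findim_real R).
Let fERR : findim ((E * R) * R)%type := findim_prod fER (@findim_real R).

Let fEV : findim (E * 'rV[R]_2)%type := findim_prod fE (@findim_row R 2).

Let pt (a b : R) : 'rV[R]_2 := x0 + a *: v1 + b *: v2.

Let pt00 : pt 0 0 = x0.
Proof. by rewrite /pt !scale0r !addr0. Qed.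

(** Two successive scalar implicit functions give the inverse of (f1, f2). *)
Lemma chart2 : exists X : (E * R) * R -> 'rV[R]_2,
  [/\ smooth_near ((p0, t0), r0) X, X ((p0, t0), r0) = x0,
      \forall q \near ((p0, t0), r0), f1 (q.1.1, X q) = q.1.2 /\ f2 (q.1.1, X q) = q.2 &
      \forall z \near (p0, x0), X ((z.1, f1 z), f2 z) = z.2].
Proof.
(* solve f1 = t for the coordinate along v1 *)
pose arg1 (z : ((E * R) * R) * R) : E * 'rV[R]_2 := (z.1.1.1, pt z.2 z.1.2).
pose g1 (z : ((E * R) * R) * R) := z.1.1.2 - f1 (arg1 z).
have sarg1 z : smooth_near z arg1 by rewrite /arg1 /pt; smooth_tac.
have sg1 : smooth_near (((p0, t0), 0), 0) g1.
  rewrite /g1; apply: smoothD; first by smooth_tac.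
  by apply: smoothN; apply: smooth_comp => //; rewrite /arg1 /= pt00.
have g10 : g1 (((p0, t0), 0), 0) = 0 by rewrite /g1 /arg1 /= pt00 subrr.
have dg1 : 'D_(0, 1) g1 (((p0, t0), 0), 0) < 0.
  have h1 := derive_slice2 (smooth_diff sg1).
  have h2 : is_derive (0 : R) 1 (fun u => g1 (((p0, t0), 0), u)) (0 - 1).
    have lE (u : R) : arg1 (((p0, t0), 0), u) = (p0, x0) + u *: (0, v1).
      by congr pair; rewrite /= /pt ?scale0r ?scaler0 !addr0.
    have df : differentiable f1 ((p0, x0) + (0 : R) *: (0, v1)).
      by rewrite scale0r addr0; exact: smooth_diff.
    have h := is_deriveB (is_derive_cst t0 (0 : R) 1) (derive_line df).
    rewrite scale0r addr0 d11 in h.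
    rewrite (_ : (fun u => g1 _) = cst t0 - (fun u => f1 ((p0, x0) + u *: (0, v1))))//.
    by apply/funext => u; rewrite /g1 lE.
  by rewrite (is_derive_unique h1 h2) sub0r ltrN10.
have [phi [sphi phi0 nphi uphi]] := implicit_near fERR sg1 g10 dg1.
(* solve f2 = r for the coordinate along v2 *)
pose arg0 (z : ((E * R) * R) * R) : (E * R) * R := (z.1.1, z.2).
pose arg2 (z : ((E * R) * R) * R) : E * 'rV[R]_2 := (z.1.1.1, pt (phi (arg0 z)) z.2).
pose g2 (z : ((E * R) * R) * R) := z.1.2 - f2 (arg2 z).
have sphi0 : smooth_near (((p0, t0), r0), 0) (fun z => phi (arg0 z)).
  by apply: smooth_comp => //; rewrite /arg0; smooth_tac.
have sarg2 : smooth_near (((p0, t0), r0), 0) arg2.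
  by rewrite /arg2 /pt; repeat (exact: sphi0 || smooth_tac).
have arg20 : arg2 (((p0, t0), r0), 0) = (p0, x0) by rewrite /arg2 /arg0 /= phi0 pt00.
have sg2 : smooth_near (((p0, t0), r0), 0) g2.
  rewrite /g2; apply: smoothD; first by smooth_tac.
  by apply: smoothN; apply: smooth_comp => //; rewrite arg20.
have g20 : g2 (((p0, t0), r0), 0) = 0 by rewrite /g2 arg20 subrr.
have dg2 : 'D_(0, 1) g2 (((p0, t0), r0), 0) < 0.
  have h1 := derive_slice2 (smooth_diff sg2).
  have h2 : is_derive (0 : R) 1 (fun u => g2 (((p0, t0), r0), u)) (0 - 1).
    pose ph (u : R) := phi ((p0, t0), u).
    have sph : smooth_near 0 ph.
      by apply: (@smooth_comp _ _ _ _ (fun u : R => ((p0, t0), u)) phi) => //; smooth_tac.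
    pose w (u : R) := pt (ph u) u.
    have sw : smooth_near 0 w by rewrite /w /pt; repeat (exact: sph || smooth_tac).
    have w0 : w 0 = x0 by rewrite /w /ph phi0 pt00.
    have dw : 'D_1 w 0 = 'D_1 ph 0 *: v1 + v2.
      have D1 v (a : R -> R) : smooth_near 0 a ->
          is_derive (0 : R) 1 (fun u => a u *: (v : 'rV[R]_2)) ('D_1 a 0 *: v).
        move=> sa; have [d dE] := differentiable_scale (smooth_diff sa)
          (@differentiable_cst R _ _ v (0 : R)).
        apply: DeriveDef; first exact/derivable1_diffP.
        by rewrite dE derive_cst scaler0 addr0.
      have h := is_deriveD (is_deriveD (is_derive_cst x0 (0 : R) 1) (D1 v1 _ sph))
        (D1 v2 _ (smooth_id (0 : R))).
      rewrite add0r derive_id scale1r in h.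
      by rewrite -[LHS](is_derive_unique h (smooth_is_derive sw)).
    have df2 : differentiable f2 (p0, w 0) by rewrite w0; exact: smooth_diff.
    have [dc Dc] := derive_comp_pair (1 : R) (differentiable_cst p0 (0 : R)) (smooth_diff sw) df2.
    have h : is_derive (0 : R) 1 (fun u => f2 (p0, w u)) 1.
      apply: DeriveDef; first exact/derivable1_diffP.
      rewrite Dc derive_cst dw w0.
      have -> : ((0, 'D_1 ph 0 *: v1 + v2) : E * 'rV[R]_2) =
          'D_1 ph 0 *: (0, v1) + (0, v2).
        by congr pair; rewrite /= scaler0 addr0.
      by rewrite derive_lincomb ?d21 ?d22 ?scaler0 ?add0r//; exact: smooth_diff.
    exact: (is_deriveB (is_derive_cst r0 (0 : R) 1) h).
  by rewrite (is_derive_unique h1 h2) sub0r ltrN10.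
have [psi [spsi psi0 npsi upsi]] := implicit_near fERR sg2 g20 dg2.
pose arg3 (q : (E * R) * R) : (E * R) * R := (q.1, psi q).
have sarg3 : smooth_near ((p0, t0), r0) arg3.
  by rewrite /arg3; repeat (exact: spsi || smooth_tac).
have arg30 : arg3 ((p0, t0), r0) = ((p0, t0), 0) by rewrite /arg3 psi0.
have sphi3 : smooth_near ((p0, t0), r0) (fun q => phi (arg3 q)).
  by apply: smooth_comp => //; rewrite arg30.
pose X (q : (E * R) * R) := pt (phi (arg3 q)) (psi q).
have sX : smooth_near ((p0, t0), r0) X.
  by rewrite /X /pt; repeat (exact: sphi3 || exact: spsi || smooth_tac).
exists X; split=> //.
- by rewrite /X arg30 phi0 psi0 pt00.
- have n1 : \forall q \near ((p0, t0), r0), g1 (arg3 q, phi (arg3 q)) = 0.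
    apply: (@near_cont _ _ arg3 _ (fun y => g1 (y, phi y) = 0)).
      exact: smooth_near_cont.
    by rewrite arg30.
  apply: filterS2 n1 npsi => -[[p t] r]; rewrite /g1 /g2 /arg1 /arg2 /= /X /arg3 /=.
  by move=> /eqP; rewrite subr_eq0 => /eqP <- /eqP; rewrite subr_eq0 => /eqP <-.
- pose l1 v := 'D_(0, v) f1 (p0, x0); pose l2 v := 'D_(0, v) f2 (p0, x0).
  have lin (f : E * 'rV[R]_2 -> R) : smooth_near (p0, x0) f ->
      linear (fun v => 'D_(0, v) f (p0, x0)).
    move=> sf a u v; rewrite -derive_lincomb; last exact: smooth_diff.
    by congr ('D_ _ f _); congr pair; rewrite /= ?scaler0 ?addr0.
  have cl (f : E * 'rV[R]_2 -> R) : smooth_near (p0, x0) f ->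
      continuous (fun v => 'D_(0, v) f (p0, x0)).
    move=> sf v; have df := smooth_diff sf.
    rewrite (_ : (fun v => _) = (fun v => 'd f (p0, x0) (0, v))); last first.
      by apply/funext => u; rewrite deriveE.
    apply: (@continuous_comp _ _ _ (fun v : 'rV[R]_2 => ((0 : E), v)) ('d f (p0, x0))).
      by apply: cont_pair; [exact: cst_continuous|exact: cvg_id].
    exact: diff_continuous.
  have xE := coord_rV2 (lin _ sf1) (lin _ sf2) d11 d12 d21 d22.
  have ptE x : pt (l1 (x - x0)) (l2 (x - x0)) = x.
    by rewrite /pt -addrA -xE addrC subrK.
  have c1 : {for (p0, x0), continuous (fun z : E * 'rV[R]_2 => l1 (z.2 - x0))}.
    apply: (@continuous_comp _ _ _ (fun z : E * 'rV[R]_2 => z.2 - x0) l1); last exact: cl.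
    by apply: cvgB; [exact: cvg_snd|exact: cvg_cst].
  have c2 : {for (p0, x0), continuous (fun z : E * 'rV[R]_2 => l2 (z.2 - x0))}.
    apply: (@continuous_comp _ _ _ (fun z : E * 'rV[R]_2 => z.2 - x0) l2); last exact: cl.
    by apply: cvgB; [exact: cvg_snd|exact: cvg_cst].
  have l10 : l1 0 = 0.
    by have := lin _ sf1 (-1) 0 0; rewrite scaler0 addr0 scaleN1r addNr.
  have l20 : l2 0 = 0.
    by have := lin _ sf2 (-1) 0 0; rewrite scaler0 addr0 scaleN1r addNr.
  have cf1 := smooth_near_cont sf1; have cf2 := smooth_near_cont sf2.
  have n1 : \forall z \near (p0, x0),
      g1 (((z.1, f1 z), l2 (z.2 - x0)), l1 (z.2 - x0)) = 0 ->
      l1 (z.2 - x0) = phi ((z.1, f1 z), l2 (z.2 - x0)).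
    apply: (@near_cont _ _ (fun z => (((z.1, f1 z), l2 (z.2 - x0)), l1 (z.2 - x0)))
      (p0, x0) (fun y => g1 y = 0 -> y.2 = phi y.1)).
      apply: cont_pair; last exact: c1.
      apply: cont_pair; last exact: c2.
      apply: cont_pair; last exact: cf1.
      exact: cvg_fst.
    by rewrite /= subrr l10 l20.
  have n2 : \forall z \near (p0, x0),
      g2 (((z.1, f1 z), f2 z), l2 (z.2 - x0)) = 0 ->
      l2 (z.2 - x0) = psi ((z.1, f1 z), f2 z).
    apply: (@near_cont _ _ (fun z => (((z.1, f1 z), f2 z), l2 (z.2 - x0)))
      (p0, x0) (fun y => g2 y = 0 -> y.2 = psi y.1)).
      apply: cont_pair; last exact: c2.
      apply: cont_pair; last exact: cf2.
      apply: cont_pair; last exact: cf1.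
      exact: cvg_fst.
    by rewrite /= subrr l20.
  apply: filterS2 n1 n2 => -[p x] /=.
  rewrite /g1 /arg1 /= ptE subrr => /(_ erefl) h1.
  rewrite /g2 /arg2 /= /arg0 /= -h1 ptE subrr => /(_ erefl) h2.
  by rewrite /X /arg3 /= -h2 -h1 ptE.
Qed.

End Chart.

(** * Formulas of Hadamard and Taylor *)

Section Taylor.
Variables (R : realType) (E : normedModType R) (fE : findim E).

Lemma near_scale (p0 : E) (P : E * R -> Prop) : (\forall z \near (p0, 0 : R), P z) ->
  \forall z \near (p0, 0 : R), forall u : R, 0 <= u <= 1 -> P (z.1, u * z.2).
Proof.
move=> nP; apply: (@tube_seg R _ 0 1 (p0, 0 : R) (fun z u => P (z.1, u * z.2))).
move=> u u01; apply: (@near_cont _ _ (fun w : (E * R) * R => (w.1.1, w.2 * w.1.2))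
  ((p0, 0), u) P); last by rewrite /= mulr0.
by apply: smooth_near_cont; smooth_tac.
Qed.

Lemma scaled_mean_smooth (p0 : E) (k : nat) (g : E * R -> R) : smooth_near (p0, 0 : R) g ->
  smooth_near (p0, 0 : R) (fun z => mean01 (fun u => u ^+ k * g (z.1, u * z.2))).
Proof.
move=> sg; have fER : findim (E * R)%type := findim_prod fE (@findim_real R).
apply: (@smooth_mean01 R _ (fun w : (E * R) * R => w.2 ^+ k * g (w.1.1, w.2 * w.1.2))) => //.
move=> t t01; apply: smoothM; first by smooth_tac.
by apply: smooth_comp => //=; [smooth_tac|rewrite mulr0].
Qed.

Lemma mean01_exp k : mean01 (fun u : R => u ^+ k) = k.+1%:R^-1.
Proof.
pose f (u : R) := k.+1%:R^-1 * u ^+ k.+1.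
have -> : (k.+1%:R^-1 : R) = f 1 - f 0.
  by rewrite /f expr1n expr0n mulr1 mulr0 subr0.
apply: mean01_FTC => t t01; first by apply: smooth_near_cont; smooth_tac.
have -> : f = k.+1%:R^-1 *: (@idfun R ^+ k.+1).
  by apply/funext => u; rewrite /f [RHS]/(_ * _) exprfctE.
have d := is_deriveZ (k.+1%:R^-1 : R) (is_deriveX k.+1 (is_derive_id t (1 : R))).
apply: (is_derive_eq d); rewrite /GRing.scale /= mulr1.
by rewrite mulrA mulVf ?mul1r// pnatr_eq0.
Qed.

Lemma primitive_in_last (p0 : E) (f df : E * R -> R) :
  smooth_near (p0, 0 : R) f -> smooth_near (p0, 0 : R) df ->
  (\forall z \near (p0, 0 : R), 'D_(0, 1) f z = df z) ->
  \forall z \near (p0, 0 : R),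
    f z = f (z.1, 0) + z.2 * mean01 (fun u => df (z.1, u * z.2)).
Proof.
move=> sf sdf dfE.
have n0 : \forall z \near (p0, 0 : R), smooth_near z f /\ 'D_(0, 1) f z = df z.
  exact: filterI (smooth_near_near sf) dfE.
apply: filterS (near_scale n0) => -[p t] /= H.
have sD (u : R) : 0 <= u <= 1 -> smooth_near (p, u * t) f by move=> /H[].
have [_ C1] : smooth_on [set w | smooth_near w f] f.
  by apply: smooth_onP => //; rewrite openE => w /smooth_near_near.
have h := hadamard_slice2 (q := p) (s := 0) (t := t) (C1 1%N).
rewrite h => [|u u01]; last by rewrite /= add0r subr0; exact: sD.
rewrite subr0; congr (_ + _ * _); apply: mean01_ext => u /H[_ <-].
by rewrite add0r.
Qed.

(** The quotient is the average of the derivative between 0 and z.2. *)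
Lemma hadamard_near (p0 : E) (f : E * R -> R) : smooth_near (p0, 0 : R) f ->
  exists g : E * R -> R, [/\ smooth_near (p0, 0 : R) g,
    \forall z \near (p0, 0 : R), f z = f (z.1, 0) + z.2 * g z &
    forall p, g (p, 0) = 'D_(0, 1) f (p, 0)].
Proof.
move=> sf; have sdf := smooth_derive ((0, 1) : E * R) sf.
exists (fun z => mean01 (fun u => 'D_(0, 1) f (z.1, u * z.2))); split.
- have := scaled_mean_smooth 0 sdf.
  by under eq_fun do under eq_fun do rewrite expr0 mul1r.
- apply: (primitive_in_last sf sdf); exact: near_all.
- move=> p; rewrite -[RHS]mean01_cst; apply: mean01_ext => u _.
  by rewrite /= mulr0.
Qed.

(** As long as the derivative f j vanishes at 0, integrating f j.+1 gains a
    factor z.2, and the iterated averages of f n remain smooth. *)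
Lemma taylor_near (p0 : E) (n : nat) (f : nat -> E * R -> R) :
  (forall j, smooth_near (p0, 0 : R) (f j)) ->
  (forall j, \forall z \near (p0, 0 : R), 'D_(0, 1) (f j) z = f j.+1 z) ->
  (forall j, (j < n)%N -> \forall p \near p0, f j (p, 0) = 0) ->
  exists g : E * R -> R, [/\ smooth_near (p0, 0 : R) g,
    \forall z \near (p0, 0 : R), f 0%N z = z.2 ^+ n * g z &
    \forall p \near p0, g (p, 0) = f n (p, 0) / n`!%:R].
Proof.
elim: n f => [|n IH] f sf df f0.
  exists (f 0%N); split=> //; first by apply: near_all => z; rewrite expr0 mul1r.
  by apply: near_all => p; rewrite fact0 divr1.
have [g [sg gE g0]] := IH (fun j => f j.+1) (fun j => sf j.+1) (fun j => df j.+1)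
  (fun j jn => f0 j.+1 jn).
exists (fun z => mean01 (fun u => u ^+ n * g (z.1, u * z.2))); split.
- exact: scaled_mean_smooth.
- have n1 := primitive_in_last (sf 0%N) (sf 1%N) (df 0%N).
  have n2' : \forall z \near (p0, 0 : R), f 1%N z = z.2 ^+ n * g z /\ smooth_near z g.
    exact: filterI gE (smooth_near_near sg).
  have n2 := near_scale n2'.
  have n3 : \forall z \near (p0, 0 : R), f 0%N (z.1, 0) = 0.
    exact: (@near_cont _ _ fst (p0, 0) _ cvg_fst (f0 0%N isT)).
  apply: filterS (filterI n1 (filterI n2 n3)) => -[p t] /= [-> [H ->]].
  rewrite add0r exprSr -mulrA mulrCA; congr (_ * _).
  rewrite -mean01Z => [|u u01].
    by apply: mean01_ext => u /H[/= -> _]; rewrite exprMn mulrCA mulrA.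
  apply: cvgM; first by apply: (smooth_near_cont (x := u)); smooth_tac.
  apply: (@continuous_comp _ _ _ (fun u : R => (p, u * t)) g).
    by apply: smooth_near_cont; smooth_tac.
  by apply: smooth_near_cont; have [] := H u u01.
- apply: filterS g0 => p gp /=.
  have -> : mean01 (fun u => u ^+ n * g (p, u * 0)) = g (p, 0) * mean01 (fun u : R => u ^+ n).
    rewrite -mean01Z => [|u u01]; first by apply: mean01_ext => u _; rewrite mulr0 mulrC.
    by apply: smooth_near_cont; smooth_tac.
  by rewrite mean01_exp gp factS natrM invfM -!mulrA [_^-1 / _]mulrC.
Qed.

End Taylor.

(** * The contact in flow-box coordinates *)

Definition diff2 (R : realType) (E F G : normedModType R) (f : E -> F -> G)
    (p : E) (x v : F) : G := 'd (f p) x v.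

Section LieSmooth.
Variables (R : realType) (m : nat).
Local Notation Pm := 'rV[R]_m.
Local Notation V := 'rV[R]_2.
Implicit Types (Y : Pm -> V -> V) (f : Pm -> V -> R).

Lemma Lie_partial Y f (q : Pm * V) : smooth_near q (joint f) ->
  Lie (Y q.1) (f q.1) q.2 = 'D_(0, Y q.1 q.2) (joint f) q.
Proof.
case: q => p x /smooth_diff df.
by have [_ E] := diff_partial df; rewrite /Lie E.
Qed.

Lemma derive_entries f (q : Pm * V) (v : V) : differentiable (joint f) q ->
  'D_(0, v) (joint f) q = \sum_i v 0 i * 'D_(0, delta_mx 0 i) (joint f) q.
Proof.
move=> df; rewrite deriveE//.
have -> : ((0, v) : Pm * V) = \sum_i v 0 i *: ((0, delta_mx 0 i) : Pm * V).
  rewrite {1}(row_sum_delta v); elim/big_rec2 : _ => // i a b _ <-.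
  by congr pair; rewrite /= ?scaler0 ?addr0.
rewrite linear_sum; apply: eq_bigr => i _.
by rewrite linearZ (deriveE _ df).
Qed.

(** A Lie derivative is a combination, with the entries of Y as coefficients,
    of partial derivatives of the joint map. *)
Lemma lie_smooth Y f (q : Pm * V) : smooth_near q (joint Y) ->
  smooth_near q (joint f) -> smooth_near q (joint (fun p => Lie (Y p) (f p))).
Proof.
move=> sY sf.
have s : smooth_near q (fun w => \sum_i joint Y w 0 i * 'D_(0, delta_mx 0 i) (joint f) w).
  apply: smooth_sum => i; apply: smoothM; first exact: smooth_entry.
  exact: smooth_derive.
apply: smooth_near_congr s _.
apply: filterS (smooth_near_near sf) => w sfw.
by rewrite /joint (Lie_partial _ sfw) derive_entries//; exact: smooth_diff.
Qed.

Lemma iter_lie_smooth Y f (q : Pm * V) j : smooth_near q (joint Y) ->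
  smooth_near q (joint f) ->
  smooth_near q (joint (fun p => iter j (Lie (Y p)) (f p))).
Proof. by move=> sY sf; elim: j => [//|j IH]; exact: lie_smooth. Qed.

End LieSmooth.

Section Contact.
Variables (R : realType) (m nu : nat)
    (U : set ('rV[R]_m * 'rV[R]_2))
    (h : 'rV[R]_m -> 'rV[R]_2 -> R)
    (Xm Xp W : 'rV[R]_m -> 'rV[R]_2 -> 'rV[R]_2)
    (z : 'rV[R]_m -> 'rV[R]_2)
    (I tau : 'rV[R]_m -> 'rV[R]_2 -> R).
Hypotheses (setting : contact_setting nu U h Xm Xp W z)
    (first_int : first_integral h Xm z I)
    (fb_time : flow_box_time Xm z tau).
Local Notation Pm := 'rV[R]_m.
Local Notation V := 'rV[R]_2.
Local Notation q0 := ((0 : Pm), z 0).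
Local Notation o3 := ((0 : Pm, 0 : R), 0 : R).

Let sh : smooth_near q0 (joint h).
Proof. exact: smooth_on_near (contact_dom setting) (smooth_h setting). Qed.
Let sXm : smooth_near q0 (joint Xm).
Proof. exact: smooth_on_near (contact_dom setting) (smooth_Xm setting). Qed.
Let sW : smooth_near q0 (joint W).
Proof. exact: smooth_on_near (contact_dom setting) (smooth_W setting). Qed.
Let sI : smooth_near q0 (joint I) := smooth_I first_int.
Let stau : smooth_near q0 (joint tau) := smooth_tau fb_time.

Let fP : findim Pm := @findim_row R m.

(** Identities assumed at the contact points alone are combined with those
    valid near the contact by restricting the latter to the curve of contacts. *)
Lemma near_contact (P : Pm * V -> Prop) : (\forall q \near q0, P q) ->
  \forall p \near (0 : Pm), P (p, z p).
Proof.
move=> nP; apply: (@near_cont _ _ (fun p => (p, z p)) 0 P); last exact: nP.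
by apply: cont_pair; [exact: cvg_id|exact: smooth_near_cont (smooth_z setting)].
Qed.

(** tau and I form a chart at the contact: along Xm their derivatives are 1 and
    0, and dI = dh does not vanish. *)
Lemma chart_exists : exists X : (Pm * R) * R -> V,
  [/\ smooth_near o3 X, X o3 = z 0,
      \forall q \near o3, tau q.1.1 (X q) = q.1.2 /\ I q.1.1 (X q) = q.2 &
      \forall w \near q0, X ((w.1, tau w.1 w.2), I w.1 w.2) = w.2].
Proof.
have tau0 : joint tau q0 = 0 by exact: nbhs_singleton (tau_contact fb_time).
have I0 : joint I q0 = 0 by exact: nbhs_singleton (I_contact first_int).
pose v1 := Xm 0 (z 0).
have d11 : 'D_(0, v1) (joint tau) q0 = 1.
  by rewrite -(Lie_partial Xm stau); exact: nbhs_singleton (Lie_tau fb_time).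
have d21 : 'D_(0, v1) (joint I) q0 = 0.
  by rewrite -(Lie_partial Xm sI); exact: nbhs_singleton (Lie_I first_int).
have [v0 v00] : exists v, 'd (h 0) (z 0) v != 0.
  apply: contrapT => /forallNP H; apply: (nbhs_singleton (contact_dh setting)).
  by apply/funext => v; have /negP := H v; rewrite negbK => /eqP.
have dI v : 'D_(0, v) (joint I) q0 = 'd (h 0) (z 0) v.
  have [_ <-] := diff_partial (smooth_diff sI).
  by rewrite (nbhs_singleton (dI_contact first_int)).
pose v0' := ('d (h 0) (z 0) v0)^-1 *: v0.
have dIv0 : 'D_(0, v0') (joint I) q0 = 1.
  by rewrite dI /v0' linearZ /= [_ *: _]mulVf.
pose v2 := v0' - 'D_(0, v0') (joint tau) q0 *: v1.
have D2 f : smooth_near q0 (joint f) -> 'D_(0, v2) (joint f) q0 =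
    'D_(0, v0') (joint f) q0 - 'D_(0, v0') (joint tau) q0 * 'D_(0, v1) (joint f) q0.
  move=> sf; have df := smooth_diff sf.
  have -> : ((0, v2) : Pm * V) = (- 'D_(0, v0') (joint tau) q0) *: (0, v1) + (0, v0').
    by congr pair; rewrite /= ?scaler0 ?addr0// /v2 scaleNr addrC.
  by rewrite derive_lincomb// addrC [_ *: _]mulNr.
have := @chart2 R _ fP 0 (z 0) (joint tau) (joint I) v1 v2 stau sI d11 _ d21 _.
rewrite tau0 I0 => H; apply: H.
  by rewrite (D2 _ stau) d11 mulr1 subrr.
by rewrite (D2 _ sI) d21 mulr0 subr0.
Qed.

Variable X : (Pm * R) * R -> V.
Hypotheses (sX : smooth_near o3 X) (X0 : X o3 = z 0)
  (tauIX : \forall q \near o3, tau q.1.1 (X q) = q.1.2 /\ I q.1.1 (X q) = q.2)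
  (XtauI : \forall w \near q0, X ((w.1, tau w.1 w.2), I w.1 w.2) = w.2).

Definition to_phase (q : (Pm * R) * R) : Pm * V := (q.1.1, X q).
Definition to_chart (w : Pm * V) : (Pm * R) * R := ((w.1, tau w.1 w.2), I w.1 w.2).

Lemma to_phase_smooth : smooth_near o3 to_phase.
Proof. by rewrite /to_phase; repeat (exact: sX || smooth_tac). Qed.

Lemma to_chart_smooth : smooth_near q0 to_chart.
Proof. by rewrite /to_chart; repeat (exact: stau || exact: sI || smooth_tac). Qed.

Lemma to_phase0 : to_phase o3 = q0.
Proof. by rewrite /to_phase X0. Qed.

Lemma to_chart0 : to_chart q0 = o3.
Proof.
rewrite /to_chart /= (nbhs_singleton (tau_contact fb_time)).
by rewrite (nbhs_singleton (I_contact first_int)).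
Qed.

Lemma near_phase (P : Pm * V -> Prop) : (\forall w \near q0, P w) ->
  \forall q \near o3, P (to_phase q).
Proof.
move=> nP; apply: (@near_cont _ _ to_phase o3 P).
  exact: smooth_near_cont to_phase_smooth.
by rewrite to_phase0.
Qed.

Lemma near_chart (P : (Pm * R) * R -> Prop) : (\forall q \near o3, P q) ->
  \forall w \near q0, P (to_chart w).
Proof.
move=> nP; apply: (@near_cont _ _ to_chart q0 P).
  exact: smooth_near_cont to_chart_smooth.
by rewrite to_chart0.
Qed.

(** Differentiate the identity X (p, tau, I) = x in x. *)
Lemma chart_frame : \forall w \near q0, forall v : V,
  v = diff2 tau w.1 w.2 v *: 'D_((0, 1), 0) X (to_chart w) +
      diff2 I w.1 w.2 v *: 'D_((0, 0), 1) X (to_chart w).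
Proof.
have [N0 [oO Oq0 HO]] := near_ex_open XtauI.
have nO : \forall w \near q0, N0 w by exact: open_nbhs_nbhs.
apply: filterS (filterI nO (filterI (near_chart (smooth_near_near sX))
  (filterI (smooth_near_near stau) (smooth_near_near sI)))) => w [Ow [sXw [st si]]] v.
have sc : smooth_near w to_chart by rewrite /to_chart; repeat (exact: st || exact: si || smooth_tac).
have Dv : 'D_(0, v) (fun y => X (to_chart y)) w = v.
  rewrite (@near_eq_derive _ _ _ _ (fun y => y.2)); last first.
    by apply: filterS (open_nbhs_nbhs (conj oO Ow)) => y /HO.
  exact: derive_snd.
rewrite -[LHS]Dv.
have [_ ->] := derive_comp1 (0, v) (smooth_diff sc) (smooth_diff sXw).
have dX := smooth_diff sXw.
have -> : 'D_(0, v) to_chart w = diff2 tau w.1 w.2 v *: ((0, 1), 0) +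
    diff2 I w.1 w.2 v *: ((0, 0), 1).
  have s1 : smooth_near w (fun y => (y.1, tau y.1 y.2)) by repeat (exact: st || smooth_tac).
  rewrite [LHS]deriveE; last exact: smooth_diff.
  rewrite /to_chart (diff_pair (smooth_diff s1) (smooth_diff si)) /=.
  rewrite (diff_pair (smooth_diff (smooth_fst w)) (smooth_diff st)) /=.
  have -> : 'd (fun y : Pm * V => y.1) w (0, v) = 0.
    rewrite -deriveE; last exact: (smooth_diff (smooth_fst w)).
    exact: derive_fst.
  rewrite -(deriveE _ (smooth_diff st)) -(deriveE _ (smooth_diff si)).
  rewrite /diff2; case: w st si {Ow sXw sc Dv dX s1} => p x st si.
  have [_ ->] := diff_partial (smooth_diff st); have [_ ->] := diff_partial (smooth_diff si).
  by congr pair; [congr pair|]; rewrite /= ?scaler0 ?addr0 ?add0r // [_%:A]mulr1.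
exact: (@derive_lincomb2 _ _ _ _ _ (((0, 1), 0) : (Pm * R) * R) (((0, 0), 1) : (Pm * R) * R) _ _ dX).
Qed.

(** [chart_frame] for the vector Xm, whose two components are 1 and 0. *)
Lemma chart_flow : \forall w \near q0, 'D_((0, 1), 0) X (to_chart w) = Xm w.1 w.2.
Proof.
apply: filterS (filterI chart_frame (filterI (Lie_tau fb_time) (Lie_I first_int))).
move=> w [fr [lt li]]; rewrite [RHS]fr.
have -> : diff2 tau w.1 w.2 (Xm w.1 w.2) = 1 by exact: lt.
have -> : diff2 I w.1 w.2 (Xm w.1 w.2) = 0 by exact: li.
by rewrite scale1r scale0r addr0.
Qed.

Lemma chart_phase : \forall q \near o3, to_chart (to_phase q) = q.
Proof. by apply: filterS tauIX => -[[p t] r] /= [h1 h2]; rewrite /to_chart /= h1 h2. Qed.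

Lemma chart_flow' : \forall q \near o3, 'D_((0, 1), 0) X q = Xm q.1.1 (X q).
Proof.
by apply: filterS2 chart_phase (near_phase chart_flow) => q qE; rewrite qE.
Qed.

Lemma chart_contact : \forall p \near (0 : Pm), X ((p, 0), 0) = z p.
Proof.
apply: filterS (filterI (near_contact XtauI) (filterI (tau_contact fb_time) (I_contact first_int))).
by move=> p /= [E [t0 i0]]; rewrite t0 i0 in E.
Qed.

Let comp_phase (F : Pm * V -> R) : smooth_near q0 F ->
  smooth_near o3 (fun q => F (to_phase q)).
Proof.
move=> sF; apply: smooth_comp; last by rewrite to_phase0.
  exact: findim_prod fP (@findim_row R 2).
exact: to_phase_smooth.
Qed.

Let derive_phase (F : Pm * V -> R) q v : smooth_near q X -> smooth_near (to_phase q) F ->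
  'D_v (fun q => F (to_phase q)) q = 'D_(v.1.1, 'D_v X q) F (to_phase q).
Proof.
move=> sXq sF.
have s1 : smooth_near q (fun y : (Pm * R) * R => y.1.1) by smooth_tac.
have [_ ->] := derive_comp_pair v (smooth_diff s1) (smooth_diff sXq) (smooth_diff sF).
by rewrite derive_fst_fst.
Qed.

Lemma smooth_along (Y : Pm -> V -> V) (f : Pm -> V -> R) : smooth_near q0 (joint Y) ->
  smooth_near q0 (joint f) ->
  smooth_near o3 (fun q => Lie (Y q.1.1) (f q.1.1) (X q)).
Proof. by move=> sY sf; exact: comp_phase (lie_smooth sY sf). Qed.

(** beta is defined by dh, which is dI at the contact. *)
Lemma beta_along : \forall p \near (0 : Pm),
  Lie (W p) (I p) (X ((p, 0), 0)) = beta h W z p.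
Proof.
apply: filterS2 chart_contact (dI_contact first_int) => p -> dI.
by rewrite /Lie /beta dI.
Qed.

(** Hadamard's formula in r, then Taylor's formula in t at r = 0: there the
    derivatives in t of the height are the iterated Lie derivatives of h along
    Xm, of which the first nu - 1 vanish at the contact. *)
Lemma normal_form : exists (E1 : (Pm * R) * R -> R) (c : Pm * R -> R),
  [/\ smooth_near o3 E1, smooth_near (0 : Pm, 0 : R) c,
      \forall q \near o3, h q.1.1 (X q) = q.2 * E1 q - q.1.2 ^+ nu * c q.1,
      \forall p \near (0 : Pm), E1 ((p, 0), 0) = 1 &
      \forall p \near (0 : Pm), c (p, 0) = kappa nu h Xm z p / nu`!%:R].
Proof.
have fPR : findim (Pm * R)%type := findim_prod fP (@findim_real R).
pose F j := joint (fun p => iter j (Lie (Xm p)) (h p)).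
have sF j : smooth_near q0 (F j) by exact: iter_lie_smooth.
have sH : smooth_near o3 (fun q => joint h (to_phase q)) by exact: comp_phase.
have [E1 [sE1 HE1 E1d]] := hadamard_near fPR sH.
pose lift (w : Pm * R) : (Pm * R) * R := (w, 0).
have slift w : smooth_near w lift by rewrite /lift; smooth_tac.
have near_lift (P : (Pm * R) * R -> Prop) : (\forall q \near o3, P q) ->
    \forall w \near (0 : Pm, 0 : R), P (lift w).
  move=> nP; apply: (@near_cont _ _ lift (0, 0) P); last exact: nP.
  exact: smooth_near_cont.
pose f j w := F j (to_phase (lift w)).
have sf j : smooth_near (0 : Pm, 0 : R) (f j).
  apply: (@smooth_comp _ _ _ _ lift (fun q => F j (to_phase q))) => //.
    exact: findim_prod fPR (@findim_real R).
  exact: comp_phase.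
have df j : \forall w \near (0 : Pm, 0 : R), 'D_(0, 1) (f j) w = f j.+1 w.
  apply: filterS (near_lift _ (filterI chart_flow' (filterI (smooth_near_near sX)
    (filterI (near_phase (smooth_near_near (sF j))) (smooth_near_near (comp_phase (sF j))))))).
  move=> w [fl [sXw [sFw sGw]]].
  have [_ ->] := derive_comp1 ((0, 1) : Pm * R) (smooth_diff (slift w)) (smooth_diff sGw).
  have llift : linear lift.
    by move=> a u v; rewrite /lift; congr pair; rewrite /= scaler0 addr0.
  have clift : continuous lift by move=> u; exact: smooth_near_cont.
  have [_ ->] := derive_lin ((0, 1) : Pm * R) w llift clift.
  rewrite derive_phase// [lift (0, 1)]/lift fl /f /F /joint /=.
  by rewrite -(@Lie_partial _ _ Xm (fun p => iter j (Lie (Xm p)) (h p)) (to_phase (lift w)) sFw).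
have f0 j : (j < nu)%N -> \forall p \near (0 : Pm), f j (p, 0) = 0.
  move=> jn; apply: filterS (filterI chart_contact (filterI (contact_h setting) (contact_Lie setting))).
  move=> p [c1 [c2 c3]]; rewrite /f /F /joint /to_phase /= c1.
  by case: j jn => [//|j jn]; exact: c3.
have [g [sg gE g0]] := taylor_near fP sf df f0.
exists E1, (fun w => - g w); split=> //.
- exact: smoothN.
- have n2 : \forall q \near o3, f 0%N q.1 = q.1.2 ^+ nu * g q.1.
    exact: (@near_cont _ _ fst o3 _ cvg_fst gE).
  apply: filterS2 HE1 n2 => -[w r] /= H1 H2.
  by rewrite mulrN opprK addrC -H2; exact: H1.
- have n1 : \forall p \near (0 : Pm), [/\ smooth_near ((p, 0), 0) X,
      smooth_near (p, z p) (joint h), smooth_near (p, z p) (joint I) &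
      \forall q \near ((p, 0 : R), 0 : R), tau q.1.1 (X q) = q.1.2 /\ I q.1.1 (X q) = q.2].
    have np (P : (Pm * R) * R -> Prop) : (\forall q \near o3, P q) ->
        \forall p \near (0 : Pm), P ((p, 0), 0).
      move=> nP; apply: (@near_cont _ _ (fun p => ((p, 0), 0)) (0 : Pm) P); last exact: nP.
      by apply: smooth_near_cont; smooth_tac.
    have a1 := np _ (smooth_near_near sX).
    have a2 := near_contact (smooth_near_near sh).
    have a3 := near_contact (smooth_near_near sI).
    have a4 := np _ (near_join tauIX).
    by apply: filterS (filterI (filterI a1 a2) (filterI a3 a4)) => p [[? ?] [? ?]].
  apply: filterS (filterI n1 (filterI chart_contact (dI_contact first_int))).
  move=> p [[sXp shp sIp nI] [XpE dIp]]; rewrite E1d.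
  have tp : to_phase ((p, 0), 0) = (p, z p) by rewrite /to_phase /= XpE.
  rewrite derive_phase ?tp//=.
  have [_ <-] := diff_partial (smooth_diff shp); rewrite -dIp.
  have [_ ->] := diff_partial (smooth_diff sIp).
  rewrite -tp -[LHS](@derive_phase (joint I) ((p, 0), 0) (0, 1)) ?tp//.
  rewrite (@near_eq_derive _ _ _ _ (fun q => q.2)); first exact: derive_snd.
  by apply: filterS nI => q [].
- apply: filterS2 g0 chart_contact => p -> XpE.
  by rewrite /f /F /joint /to_phase /= XpE /kappa mulNr.
Qed.

End Contact.

(** * Blow-up of the contact *)

Section BlowUp.
Variables (R : realType) (E : normedModType R) (fE : findim E) (nu : nat).
Hypotheses (nu_ge2 : (2 <= nu)%N) (nu_even : ~~ odd nu).
Variable p0 : E.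
Local Notation o2 := (p0, 0 : R).
Local Notation o3 := ((p0, 0 : R), 0 : R).
Variables (E1 a b : (E * R) * R -> R) (c : E * R -> R).
Hypotheses (sE1 : smooth_near o3 E1) (sa : smooth_near o3 a) (sb : smooth_near o3 b)
  (sc : smooth_near o2 c).
Hypothesis E1_1 : \forall p \near p0, E1 ((p, 0), 0) = 1.
Hypothesis c0 : 0 < c o2.

Let fER : findim (E * R)%type := findim_prod fE (@findim_real R).
Let fERR : findim ((E * R) * R)%type := findim_prod fER (@findim_real R).
Let fERRR : findim (((E * R) * R) * R)%type := findim_prod fERR (@findim_real R).

(** z = (p, s, u, w) stands for the point t = s u, r = s ^ nu w. *)
Definition unscale (z : ((E * R) * R) * R) : (E * R) * R :=
  ((z.1.1.1, z.1.1.2 * z.1.2), z.1.1.2 ^+ nu * z.2).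

(** The height at the unscaled point divided by s ^ nu, a quotient that extends
    smoothly to s = 0. *)
Definition height (z : ((E * R) * R) * R) : R :=
  z.2 * E1 (unscale z) - z.1.2 ^+ nu * c (unscale z).1.

(** In the scaled variables the orbit satisfies dw / du = s * drift. *)
Definition drift (z : ((E * R) * R) * R) : R :=
  height z * (b (unscale z) / (1 + z.1.1.2 ^+ nu * height z * a (unscale z))).

Let nu_gt0 : (0 < nu)%N. Proof. exact: leq_trans nu_ge2. Qed.

Lemma unscale0 p u w : unscale (((p, 0), u), w) = ((p, 0), 0).
Proof. by rewrite /unscale /= mul0r expr0n gtn_eqF// mul0r. Qed.

Lemma height_smooth u w : smooth_near ((o2, u), w) height.
Proof.
have su : smooth_near ((o2, u), w) unscale by rewrite /unscale; smooth_tac.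
have s1 : smooth_near ((o2, u), w) (fun z => E1 (unscale z)).
  by apply: (smooth_comp fERR su); rewrite unscale0.
have s2 : smooth_near ((o2, u), w) (fun z => c (unscale z).1).
  by apply: (@smooth_comp _ _ _ _ (fun z => (unscale z).1)) => //; [exact: smooth1|rewrite unscale0].
by rewrite /height; smooth_by ltac:(first [exact: s1 | exact: s2]).
Qed.

Lemma drift_smooth u w : smooth_near ((o2, u), w) drift.
Proof.
have su : smooth_near ((o2, u), w) unscale by rewrite /unscale; smooth_tac.
have s1 : smooth_near ((o2, u), w) (fun z => a (unscale z)).
  by apply: (smooth_comp fERR su); rewrite unscale0.
have s2 : smooth_near ((o2, u), w) (fun z => b (unscale z)).
  by apply: (smooth_comp fERR su); rewrite unscale0.
have s3 := height_smooth u w.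
have s4 : smooth_near ((o2, u), w) (fun z => 1 + z.1.1.2 ^+ nu * height z * a (unscale z)).
  by smooth_by ltac:(first [exact: s1 | exact: s3]).
apply: smoothM; first exact: s3.
apply: smoothM; first exact: s2.
apply: smoothV s4.
by rewrite /= expr0n gtn_eqF// !mul0r addr0 oner_neq0.
Qed.

Lemma height0 : \forall p \near p0, forall u w,
  height (((p, 0), u), w) = w - u ^+ nu * c (p, 0).
Proof.
by apply: filterS E1_1 => p e u w; rewrite /height unscale0 e mulr1.
Qed.

Lemma drift0 : \forall p \near p0, forall u w,
  drift (((p, 0), u), w) = (w - u ^+ nu * c (p, 0)) * b ((p, 0), 0).
Proof.
apply: filterS height0 => p e u w; rewrite /drift unscale0 e /=.
by rewrite expr0n gtn_eqF// !mul0r addr0 divr1.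
Qed.

Let k0 := c o2.
Let U0 : R := k0^-1 `^ (nu%:R^-1).
Let U0_gt0 : 0 < U0. Proof. by rewrite powR_gt0// invr_gt0. Qed.

Lemma root_powR (x : R) : 0 <= x -> (x `^ (nu%:R^-1)) ^+ nu = x.
Proof.
move=> x0; rewrite -powR_mulrn ?powR_ge0// -powRrM mulVf ?powRr1//.
by rewrite pnatr_eq0 gtn_eqF.
Qed.

Lemma powR_root (x : R) : 0 <= x -> (x ^+ nu) `^ (nu%:R^-1) = x.
Proof.
move=> x0; rewrite -powR_mulrn// -powRrM mulfV ?powRr1//.
by rewrite pnatr_eq0 gtn_eqF.
Qed.

Let U0nu : U0 ^+ nu * k0 = 1.
Proof. by rewrite /U0 root_powR ?invr_ge0 ?ltW// mulVf ?gt_eqF. Qed.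

Let M : R := 16 * U0.
Let eps : R := U0 / 4.
Let M0 : 0 < M. Proof. by rewrite mulr_gt0. Qed.
Let eps0 : 0 < eps. Proof. by rewrite divr_gt0. Qed.
Let epsM : eps < M. Proof. by rewrite /eps /M; have := U0_gt0; lra. Qed.

Let epsk : eps ^+ nu * k0 < 1.
Proof.
rewrite /eps exprMn mulrAC U0nu mul1r exprVn invf_lt1 ?exprn_gt0//.
by rewrite exprn_egt1 ?gtn_eqF// ltr1n.
Qed.

Let Mk : 8 < M ^+ nu * k0.
Proof.
rewrite /M exprMn -mulrA U0nu mulr1.
have : (16 : R) ^+ 2 <= 16 ^+ nu by rewrite ler_eXn2l// ltr1n.
by rewrite expr2; lra.
Qed.

(** At s = 0 the height along the orbit is the model 1 - u ^ nu k0, whose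
    positive zero U0 is simple; it persists for (p, s) near the origin. The
    interval [eps, M] = [U0 / 4, 16 U0] is wide enough for all later bounds. *)
Let model_lt (f : (E * R) * R -> R) : (forall u, f (o2, u) = 1 - u ^+ nu * k0) ->
  (forall u : R, eps <= u <= M -> smooth_near (o2, u) f) ->
  exists phi : E * R -> R, smooth_near o2 phi /\
    \forall q \near o2, [/\ eps < phi q < M, f (q, phi q) = 0,
      (forall u, eps <= u -> u < phi q -> 0 < f (q, u)) &
      (forall u, phi q < u -> u <= M -> f (q, u) < 0)].
Proof.
move=> fm sf; apply: implicit_function => //.
- move=> u uI; have d := derive_slice2 (smooth_diff (sf u uI)).
  have d' : is_derive u 1 (fun v => f (o2, v)) (0 - nu%:R * u ^+ nu.-1 * k0).
    have -> : (fun v => f (o2, v)) = cst 1 - (k0 \*: (@id R ^+ nu)).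
      by apply/funext => v; rewrite fm mulrC; congr (_ - _ * _); rewrite exprfctE.
    apply: (is_derive_eq (is_deriveB (is_derive_cst (1 : R) u (1 : R))
      (is_deriveZ k0 (is_deriveX nu (is_derive_id u (1 : R)))))).
    by rewrite /GRing.scale /= mulr1 mulrC.
  rewrite (is_derive_unique d d') sub0r oppr_lt0 !mulr_gt0 ?ltr0n ?exprn_gt0//.
  by have /andP[eu _] := uI; exact: lt_le_trans eps0 eu.
- by rewrite fm subr_gt0.
- by rewrite fm subr_lt0; have := Mk; lra.
Qed.

Let shift_bound (u v N : R) : - N <= u <= N -> 0 < v < N -> `|u + v| < 2 * N + 1.
Proof. by move=> /andP[? ?] /andP[? ?]; rewrite ltr_norml; apply/andP; split; lra. Qed.

Let near_one (x : R) : `|x| <= 2^-1 -> 2^-1 <= 1 + x <= 2.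
Proof. by rewrite ler_norml => /andP[? ?]; apply/andP; split; lra. Qed.

(** ue and ux are the scaled times of entry and exit, wf q is the scaled first
    integral between them, and beyond B the term u ^ nu c dominates. Since
    w = 1 + s y, where y solves an equation that is regular at s = 0, the change
    of the first integral is s times a smooth function A, the value of y at exit.
    For s = 0 the equation is dy / du = (1 - u ^ nu c) b, with explicit solution. *)
Lemma blow_up : exists (B : R) (ue ux A : E * R -> R) (wf : E * R -> R -> R),
  [/\ 0 < B /\ 8 < B ^+ nu * c o2, smooth_near o2 A,
    \forall p \near p0, A (p, 0) =
      2 * nu%:R / (nu%:R + 1) * (c (p, 0))^-1 `^ (nu%:R^-1) * b ((p, 0), 0) &
    \forall q \near o2, [/\ - B < ue q < 0 /\ 0 < ux q < B,
      (forall u, - B <= u -> u < ue q -> height ((q, u), 1) < 0) /\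
        height ((q, ue q), 1) = 0,
      (forall u, ue q < u -> u < ux q -> 0 < height ((q, u), wf q u)) /\
        height ((q, ux q), wf q (ux q)) = 0,
      (forall u, ux q < u -> u <= B -> height ((q, u), wf q (ux q)) < 0) /\
        (wf q (ue q) = 1 /\ wf q (ux q) = 1 + q.2 * A q) &
      forall u, ue q <= u <= ux q ->
        is_derive u 1 (wf q) (q.2 * drift ((q, u), wf q u)) /\ 2^-1 <= wf q u <= 2]].
Proof.
have hm0 u w : height ((o2, u), w) = w - u ^+ nu * k0.
  exact: (nbhs_singleton height0).
have ev (u : R) : (- u) ^+ nu = u ^+ nu.
  by rewrite exprNn -signr_odd (negbTE nu_even) mul1r.
(* before entry w = 1; the sign of u is changed to make the zero positive *)
pose fe (z : (E * R) * R) := height ((z.1, - z.2), 1).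
have [phe [sphe nphe]] : exists phi : E * R -> R, smooth_near o2 phi /\
    \forall q \near o2, [/\ eps < phi q < M, fe (q, phi q) = 0,
      (forall u, eps <= u -> u < phi q -> 0 < fe (q, u)) &
      (forall u, phi q < u -> u <= M -> fe (q, u) < 0)].
  apply: model_lt => [u|u _]; first by rewrite /fe hm0 ev.
  apply: (@smooth_comp _ _ _ _ (fun z : (E * R) * R => ((z.1, - z.2), 1 : R)) height) => //.
    by smooth_tac.
  exact: height_smooth.
pose ue q := - phe q.
have sue : smooth_near o2 ue by exact: smoothN.
have ueI : eps < phe o2 < M by have [] := nbhs_singleton nphe.
(* the orbit after entry is sought as w = 1 + s y, in the time since entry *)
pose Mv := 2 * M + 1.
have Mv0 : 0 < Mv by rewrite /Mv; have := M0; lra.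
pose F (z : ((E * R) * R) * R) := drift ((z.1.1, ue z.1.1 + z.1.2), 1 + z.1.1.2 * z.2).
have sF (v y : R) : smooth_near ((o2, v), y) F.
  apply: (@smooth_comp _ _ _ _
    (fun z : ((E * R) * R) * R => ((z.1.1, ue z.1.1 + z.1.2), 1 + z.1.1.2 * z.2)) drift) => //.
    have s1 : smooth_near ((o2, v), y) (fun z : ((E * R) * R) * R => ue z.1.1).
      by apply: (@smooth_comp _ _ _ _ (fun z : ((E * R) * R) * R => z.1.1) ue) => //; smooth_tac.
    by smooth_by ltac:(exact: s1).
  by rewrite /= mul0r addr0; exact: drift_smooth.
have F0 (v y : R) : F ((o2, v), y) = (1 - (ue o2 + v) ^+ nu * k0) * b o3.
  by rewrite /F /= mul0r addr0; exact: (nbhs_singleton drift0).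
have dF (v y : R) : 'D_(0, 1) F ((o2, v), y) = 0.
  have d := derive_slice2 (smooth_diff (sF v y)).
  apply: (is_derive_unique d).
  have -> : (fun u => F ((o2, v), u)) = cst ((1 - (ue o2 + v) ^+ nu * k0) * b o3).
    by apply/funext => u; rewrite F0.
  exact: is_derive_cst.
pose C := (1 + (M + Mv) ^+ nu * k0) * `|b o3| + 1.
have FC (v y : R) : `|v| <= Mv -> `|F ((o2, v), y)| < C.
  move=> vM; rewrite F0 normrM /C ltr_pwDr// ler_wpM2r//.
  apply: le_trans (ler_normB _ _) _; rewrite normr1 lerD2l normrM normrX.
  rewrite [`|k0|]gtr0_norm// ler_wpM2r ?(ltW c0)//.
  have le1 : `|ue o2 + v| <= M + Mv.
    apply: le_trans (ler_normD _ _) _; apply: lerD => //.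
    by rewrite /ue normrN gtr0_norm; have /andP[h1 h2] := ueI; have := eps0; lra.
  by apply: lerXn2r le1; rewrite nnegrE// addr_ge0 ?(ltW M0) ?(ltW Mv0).
have [y ny] := @ode_param R _ o2 F Mv C fER Mv0 (fun v y _ => sF v y)
  (fun v y _ => dF v y) FC.
have nys (v : R) : `|v| < Mv -> smooth_near (o2, v) y.
  by have ny0 := nbhs_singleton ny; move=> /ny0[].
pose w (z : (E * R) * R) := 1 + z.1.2 * y (z.1, z.2 - ue z.1).
have uerange : - M < ue o2 < - eps.
  by have /andP[h1 h2] := ueI; rewrite /ue !ltrN2 h1 h2.
have sw (u : R) : - M <= u <= M -> smooth_near (o2, u) w.
  move=> uM; have s1 : smooth_near (o2, u) (fun z : (E * R) * R => ue z.1).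
    by apply: (@smooth_comp _ _ _ _ (fun z : (E * R) * R => z.1) ue) => //; smooth_tac.
  have s2 : smooth_near (o2, u) (fun z : (E * R) * R => y (z.1, z.2 - ue z.1)).
    apply: (@smooth_comp _ _ _ _ (fun z : (E * R) * R => (z.1, z.2 - ue z.1)) y) => //.
      by smooth_by ltac:(exact: s1).
    apply: nys; rewrite /Mv ltr_norml; have /andP[h1 h2] := uM; have /andP[h3 h4] := uerange.
    by have e0 := eps0; have M_0 := M0; apply/andP; split => /=; lra.
  by rewrite /w; smooth_by ltac:(exact: s2).
have w0 u : w (o2, u) = 1 by rewrite /w /= mul0r addr0.
have shw (u v : R) : - M <= v <= M -> forall g : (E * R) * R -> R,
    smooth_near (o2, u) g -> g (o2, u) = v ->
    smooth_near (o2, u) (fun z => height ((z.1, g z), w (z.1, g z))).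
  move=> vM g sg gv.
  have s1 : smooth_near (o2, u) (fun z => w (z.1, g z)).
    apply: (@smooth_comp _ _ _ _ (fun z : (E * R) * R => (z.1, g z)) w) => //.
      by smooth_by ltac:(exact: sg).
    by rewrite /= gv; exact: sw.
  apply: (@smooth_comp _ _ _ _ (fun z : (E * R) * R => ((z.1, g z), w (z.1, g z))) height) => //.
    by smooth_by ltac:(first [exact: sg | exact: s1]).
  by rewrite /= gv w0; exact: height_smooth.
have epsMI (u : R) : eps <= u <= M -> - M <= u <= M.
  by move=> /andP[h1 h2]; rewrite h2 andbT; have := eps0; have := M0; lra.
pose fx (z : (E * R) * R) := height (z, w z).
have [ux [sux nux]] : exists phi : E * R -> R, smooth_near o2 phi /\
    \forall q \near o2, [/\ eps < phi q < M, fx (q, phi q) = 0,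
      (forall u, eps <= u -> u < phi q -> 0 < fx (q, u)) &
      (forall u, phi q < u -> u <= M -> fx (q, u) < 0)].
  apply: model_lt => [u|u uI]; first by rewrite /fx w0 hm0.
  have s1 := shw u u (epsMI u uI) (fun z => z.2) (smooth_snd _) erefl.
  by apply: (smooth_near_congr s1); apply: near_all => -[].
have uxI : eps < ux o2 < M by have [] := nbhs_singleton nux.
(* the same entry point as a zero of the height along the solution, for the
   sign of the height just after entry *)
pose fb (z : (E * R) * R) := height ((z.1, - z.2), w (z.1, - z.2)).
have [phb [_ nphb]] : exists phi : E * R -> R, smooth_near o2 phi /\
    \forall q \near o2, [/\ eps < phi q < M, fb (q, phi q) = 0,
      (forall u, eps <= u -> u < phi q -> 0 < fb (q, u)) &
      (forall u, phi q < u -> u <= M -> fb (q, u) < 0)].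
  apply: model_lt => [u|u uI]; first by rewrite /fb w0 hm0 ev.
  apply: (shw u (- u) _ (fun z => - z.2)) => //; last by smooth_tac.
  by have /andP[h1 h2] := epsMI u uI; apply/andP; split; lra.
(* after exit w keeps its exit value, for which the zero is again unique *)
pose wx q := w (q, ux q).
have swx : smooth_near o2 wx.
  apply: (@smooth_comp _ _ _ _ (fun q => (q, ux q)) w) => //.
    by smooth_by ltac:(exact: sux).
  by apply: sw; have /andP[h1 h2] := uxI; rewrite (ltW h2) andbT; have := eps0; have := M0; lra.
pose fr (z : (E * R) * R) := height (z, wx z.1).
have [phr [_ nphr]] : exists phi : E * R -> R, smooth_near o2 phi /\
    \forall q \near o2, [/\ eps < phi q < M, fr (q, phi q) = 0,
      (forall u, eps <= u -> u < phi q -> 0 < fr (q, u)) &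
      (forall u, phi q < u -> u <= M -> fr (q, u) < 0)].
  apply: model_lt => [u|u uI]; first by rewrite /fr /wx w0 hm0.
  have s1 : smooth_near (o2, u) (fun z : (E * R) * R => wx z.1).
    by apply: (@smooth_comp _ _ _ _ (fun z : (E * R) * R => z.1) wx) => //; smooth_tac.
  apply: (@smooth_comp _ _ _ _ (fun z : (E * R) * R => (z, wx z.1)) height) => //.
    by smooth_by ltac:(exact: s1).
  by rewrite /= /wx w0; exact: height_smooth.
(* between -eps and eps the term u ^ nu c is too small to change the sign *)
have nmid : \forall q \near o2, forall u : R, - eps <= u <= eps -> 0 < fx (q, u).
  apply: (@tube_seg R _ (- eps) eps o2 (fun q u => is_true (0 < fx (q, u)))) => u uI.
  have uM : - M <= u <= M.
    by have /andP[h1 h2] := uI; have eM := epsM; have M_0 := M0; have e_0 := eps0; apply/andP; split; lra.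
  have sfx : smooth_near (o2, u) fx.
    have s1 := shw u u uM (fun z => z.2) (smooth_snd _) erefl.
    by apply: (smooth_near_congr s1); apply: near_all => -[].
  have : \forall z \near (o2, u), 0 < fx z.
    apply: near_gt0; first exact: smooth_near_cont.
    rewrite /fx w0 hm0 subr_gt0; apply: le_lt_trans epsk.
    apply: le_trans (ler_norm _) _; rewrite normrM normrX (gtr0_norm c0).
    rewrite ler_wpM2r ?(ltW c0)// lerXn2r ?nnegrE ?(ltW eps0)//.
    by rewrite ler_norml.
  by apply: filterS => -[].
pose A q := y (q, ux q - ue q).
have sA : smooth_near o2 A.
  apply: (@smooth_comp _ _ _ _ (fun q => (q, ux q - ue q)) y) => //.
    by smooth_by ltac:(first [exact: sux | exact: sue]).
  apply: nys; rewrite ltr_norml /Mv; have /andP[h1 h2] := uxI; have /andP[h3 h4] := uerange.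
  by have e0 := eps0; have M_0 := M0; apply/andP; split => /=; lra.
exists M, ue, ux, A, (fun q u => w (q, u)); split=> //.
  have nearp (P : E * R -> Prop) : (\forall q \near o2, P q) -> \forall p \near p0, P (p, 0).
    move=> nP; apply: (@near_cont _ _ (fun p => (p, 0 : R)) p0 P); last exact: nP.
    by apply: smooth_near_cont; smooth_tac.
  have nc : \forall q \near o2, 0 < c q by apply: near_gt0 c0; exact: smooth_near_cont.
  apply: filterS (filterI (nearp _ (filterI (filterI nphe nux) (filterI ny nc)))
    (filterI height0 drift0)) => p.
  move=> [[[[pheI phe0 _ _] [uxpI ux0 _ _]] [yp cp]] [hp dp]].
  have phe_gt0 : 0 < phe (p, 0) by have /andP[h _] := pheI; exact: lt_trans h.
  have ux_gt0 : 0 < ux (p, 0) by have /andP[h _] := uxpI; exact: lt_trans h.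
  have root_eq x : 0 < x -> 1 - x ^+ nu * c (p, 0) = 0 ->
      x = (c (p, 0))^-1 `^ (nu%:R^-1).
    move=> x0 /eqP; rewrite subr_eq0 => /eqP xc; rewrite -[LHS]powR_root ?ltW//.
    by congr (_ `^ _); apply: (mulIf (lt0r_neq0 cp)); rewrite -xc mulVf ?gt_eqF.
  set X := _ `^ _.
  have pheX : phe (p, 0) = X.
    by apply: root_eq => //; move: phe0; rewrite /fe /= hp ev.
  have uxX : ux (p, 0) = X.
    by apply: root_eq => //; move: ux0; rewrite /fx hp /w /= mul0r addr0.
  have Xc : X ^+ nu * c (p, 0) = 1.
    by rewrite /X root_powR ?invr_ge0 ?ltW// mulVf ?gt_eqF.
  have X0 : 0 < X by rewrite -uxX.
  have XM : X < M by rewrite -uxX; have /andP[] := uxpI.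
  pose g (v : R) := b ((p, 0), 0) *
    ((v - X) - (nu.+1%:R^-1 * c (p, 0)) * (v - X) ^+ nu.+1).
  have dg (v : R) : is_derive v 1 (fun v => g v - g 0) ((1 - (v - X) ^+ nu * c (p, 0)) * b ((p, 0), 0)).
    have d1 : is_derive v 1 (fun v : R => v - X) (1 : R).
      apply: (is_derive_eq (is_deriveB (is_derive_id v (1 : R)) (is_derive_cst X v (1 : R)))).
      by rewrite subr0.
    have d2 := is_deriveZ (nu.+1%:R^-1 * c (p, 0)) (is_deriveX nu.+1 d1).
    have d3 := is_deriveZ (b ((p, 0), 0)) (is_deriveB d1 d2).
    have -> : (fun v => g v - g 0) = (b ((p, 0), 0) \*: ((fun v : R => v - X) -
        ((nu.+1%:R^-1 * c (p, 0)) \*: ((fun v : R => v - X) ^+ nu.+1)))) - cst (g 0).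
      by apply/funext => r; rewrite [RHS]/(_ - _) exprfctE.
    apply: (is_derive_eq (is_deriveB d3 (is_derive_cst (g 0) v (1 : R)))).
    have n0 : nu.+1%:R != 0 :> R by rewrite pnatr_eq0.
    by rewrite /GRing.scale /=; field.
  have yg : y (p, 0, X + X) = g (X + X) - g 0.
    apply: (@cyl_unique R E setT Mv (fun v => y ((p, 0), v)) (fun v => g v - g 0)
      (fun v => (1 - (v - X) ^+ nu * c (p, 0)) * b ((p, 0), 0)) p) => //.
    - by have [|_ _ -> _] := yp 0; rewrite ?normr0// subrr.
    - move=> v vM; have [_ dy _ _] := yp v vM.
      apply: (is_derive_eq dy); rewrite /F /= dp mul0r addr0 /ue pheX.
      by rewrite [- X + v]addrC.
    - rewrite ger0_norm ?addr_ge0 ?(ltW X0)// /Mv; lra.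
  rewrite /A uxX /ue pheX opprK yg /g addrK sub0r exprS.
  have -> : (- X) ^+ nu.+1 = - (X * X ^+ nu) by rewrite exprS ev mulNr.
  have n1 : nu.+1%:R != 0 :> R by rewrite pnatr_eq0.
  have e1 : nu.+1%:R^-1 * c (p, 0) * (X * X ^+ nu) = nu.+1%:R^-1 * X.
    by rewrite -[RHS]mulr1 -Xc; ring.
  have e2 : nu.+1%:R^-1 * c (p, 0) * - (X * X ^+ nu) = - (nu.+1%:R^-1 * X).
    by rewrite mulrN e1.
  rewrite e1 e2; have -> : 2 * nu%:R / (nu%:R + 1) = 2 * (1 - nu.+1%:R^-1) :> R.
    have n2 : nu%:R + 1 != 0 :> R by rewrite natr1 pnatr_eq0.
    by rewrite -natr1; field; rewrite ?[1 + nu%:R]addrC ?n2.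
  by ring.
have nsmall : \forall q \near o2, `|q.2| * (C * Mv) < 2^-1.
  apply: near_lt0; last by rewrite /= normr0 mul0r invr_gt0.
  apply: cvgM; last exact: cvg_cst.
  by apply: cvg_norm; exact: cvg_snd.
apply: filterS (filterI (filterI nphe nux) (filterI (filterI nphb nphr)
  (filterI nmid (filterI ny nsmall)))) => q.
move=> [[[pheI phe0 phe1 phe2] [uxqI ux0 ux1 ux2]]
  [[[phbI phb0 phb1 phb2] [phrI phr0 phr1 phr2]] [mid [yq small]]]].
have [h1 h2] := andP pheI; have [h3 h4] := andP uxqI.
have [h5 h6] := andP phbI; have [h7 h8] := andP phrI.
have e0 := eps0; have M_0 := M0; have eM := epsM.
have vrange u : - M <= u <= M -> `|u - ue q| < Mv.
  by move=> uM; rewrite /ue opprK /Mv; apply: shift_bound uM _; rewrite (lt_trans e0 h1).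
have w_ue : w (q, ue q) = 1.
  have [|_ _ y0 _] := yq 0; first by rewrite normr0.
  by rewrite /w /= subrr y0 mulr0 addr0.
have phbE : phb q = phe q.
  have fb0 : fb (q, phe q) = 0.
    by rewrite /fb /= -/(ue q) w_ue; exact: phe0.
  have [h|h|//] := ltgtP (phb q) (phe q).
    by have := phb2 (phe q) h (ltW h2); rewrite fb0 ltxx.
  by have := phb1 (phe q) (ltW h1) h; rewrite fb0 ltxx.
have phrE : phr q = ux q.
  have fr0 : fr (q, ux q) = 0 by exact: ux0.
  have [h|h|//] := ltgtP (phr q) (ux q).
    by have := phr2 (ux q) h (ltW h4); rewrite fr0 ltxx.
  by have := phr1 (ux q) (ltW h3) h; rewrite fr0 ltxx.
split.
- by rewrite /ue ltrN2 h2 oppr_lt0 (lt_trans e0 h1) h4 (lt_trans e0 h3).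
- split; last exact: phe0.
  move=> u u1 u2; have := phe2 (- u); rewrite /fe /= opprK; apply.
    by rewrite ltrNr.
  by rewrite lerNl.
- split; last exact: ux0.
  move=> u u1 u2; have [ueps|ueps] := ltrP u (- eps).
    have := phb1 (- u); rewrite /fb /= opprK; apply; first by rewrite lerNr ltW.
    by rewrite phbE ltrNl.
  have [ueps'|ueps'] := ltrP u eps; last exact: ux1.
  by apply: mid; rewrite ueps ltW.
- split.
    by move=> u u1 u2; apply: phr2 => //; rewrite phrE.
  by split.
- move=> u /andP[u1 u2].
  have uM : - M <= u <= M.
    by rewrite (le_trans _ u1) ?(le_trans u2) ?ltW// /ue ltrN2.
  have [_ dy _ yC] := yq _ (vrange u uM).
  have dsh : is_derive u 1 (fun v => y (q, v - ue q)) (F ((q, u - ue q), y (q, u - ue q))).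
    have dsub : is_derive u 1 (fun v : R => v - ue q) (1 : R).
      apply: (is_derive_eq (is_deriveB (is_derive_id u (1 : R)) (is_derive_cst (ue q) u (1 : R)))).
      by rewrite subr0.
    have := @is_derive1_comp R (fun v => y (q, v)) (fun v => v - ue q) u _ _ dy dsub.
    by rewrite mulr1.
  split.
    have d := is_deriveD (is_derive_cst (1 : R) u (1 : R)) (is_deriveZ q.2 dsh).
    apply: (is_derive_eq d); rewrite add0r [LHS]/(_ * _); congr (_ * _).
    by rewrite /F /w /= addrC subrK.
  have : `|q.2 * y (q, u - ue q)| <= 2^-1.
    rewrite normrM; apply: le_trans (ltW small); exact: ler_wpM2l.
  exact: near_one.
Qed.

End BlowUp.

(** * Clocks and uniqueness of orbits *)

Section OneVariable.
Variable R : realType.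

(** The form of the derivative that makes gluing two functions immediate. *)
Lemma is_derive_epsP (f : R -> R) (c l : R) : is_derive c 1 f l <->
  forall e : R, 0 < e -> \forall t \near c, `|f t - f c - (t - c) * l| <= e * `|t - c|.
Proof.
split=> [[df dl] e e0|H].
  have dff : differentiable f c by exact/derivable1_diffP.
  have /eqaddoP/(_ e e0) N := diff_locally dff.
  have sx : (y - c) @[y --> c] --> (0 : R).
    by rewrite -(subrr c); apply: cvgB; [exact: cvg_id|exact: cvg_cst].
  have N' : \forall y \near c, `|(f \o shift c - (cst (f c) + 'd f c)) (y - c)| <= e * `|y - c|.
    exact: (sx _ N).
  apply: filterS N' => y.
  rewrite /= !fctE /= addrNK opprD addrA.
  by rewrite -(deriveE _ dff) derive_scale1// dl.
pose L0 (v : R) := v * l.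
have L0lin : linear L0 by move=> k u v; rewrite /L0 mulrDl -mulrA.
pose L : {linear R -> R} := HB.pack L0 (GRing.isLinear.Build R R R _ L0 L0lin).
have cL : continuous L.
  by move=> v; apply: cvgM; [exact: cvg_id|exact: cvg_cst].
have [d D] := differentiable_eps cL H.
apply: DeriveDef; first exact/derivable1_diffP.
by rewrite deriveE// D /L /= /L0 mul1r.
Qed.

Lemma is_derive_glue (f g : R -> R) (c l : R) :
  is_derive c 1 f l -> is_derive c 1 g l -> f c = g c ->
  is_derive c 1 (fun t => if t <= c then f t else g t) l.
Proof.
move=> /is_derive_epsP df /is_derive_epsP dg fg; apply/is_derive_epsP => e e0.
apply: filterS2 (df e e0) (dg e e0) => t ft gt; rewrite lexx.
by case: ifP => // _; rewrite fg.
Qed.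

Lemma nonincr (f df : R -> R) (a b : R) :
  {within `[a, b], continuous f} ->
  (forall t : R, a < t < b -> is_derive t 1 f (df t)) ->
  (forall t : R, a < t < b -> df t <= 0) ->
  forall s t : R, a <= s -> s <= t -> t <= b -> f t <= f s.
Proof.
move=> cf d1 d2 s t as_ st tb; move: st; rewrite le_eqVlt => /predU1P[->//|st].
have [||c] := @MVT R f df s t st.
- move=> x; rewrite in_itv /= => /andP[sx xt]; apply: d1.
  by rewrite (le_lt_trans as_ sx) (lt_le_trans xt).
- apply: continuous_subspaceW cf => x /=; rewrite !in_itv /= => /andP[sx xt].
  by rewrite (le_trans as_ sx) (le_trans xt).
rewrite in_itv /= => /andP[sc ct] E1; rewrite -subr_le0 E1.
rewrite mulr_le0_ge0 ?subr_ge0 ?(ltW st)//.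
by apply: d2; rewrite (le_lt_trans as_ sc) (lt_le_trans ct).
Qed.

(** theta is a primitive of w, and Tf its inverse, which exists because w is
    bounded below. *)
Lemma time_change (w : R -> R) (T T0 t1 : R) : 0 < T0 -> T0 < T -> - T < t1 < T ->
  (forall t : R, `|t| < T -> {for t, continuous w}) ->
  (forall t : R, `|t| < T -> 2^-1 <= w t <= 2) ->
  exists theta Tf : R -> R, [/\ theta t1 = t1,
    (forall t : R, `|t| < T -> is_derive t 1 theta (w t)),
    (forall s t : R, - T < s -> s <= t -> t < T ->
       2^-1 * (t - s) <= theta t - theta s <= 2 * (t - s)),
    (forall s, theta (- T0) <= s <= theta T0 ->
       - T0 <= Tf s <= T0 /\ theta (Tf s) = s) &
    (forall s : R, theta (- T0) < s < theta T0 -> is_derive s 1 Tf (w (Tf s))^-1)].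
Proof.
move=> T00 T0T /andP[t1T Tt1] cw wb.
pose f (x : R) := w (t1 + x).
pose theta (t : R) := t1 + (t - t1) * mean01 (fun u => f (u * (t - t1))).
have dth (t : R) : `|t| < T -> is_derive t 1 theta (w t).
  move=> tT.
  pose T' := (Num.max `|t| `|t1| + T) / 2.
  have t1T' : `|t1| < T by rewrite ltr_norml t1T.
  have m1 : Num.max `|t| `|t1| < T by rewrite gt_max tT.
  have [tm t1m] : `|t| <= Num.max `|t| `|t1| /\ `|t1| <= Num.max `|t| `|t1|.
    by rewrite !le_max !lexx orbT.
  have tT' : `|t| < T' by rewrite /T'; lra.
  have t1T'' : `|t1| < T' by rewrite /T'; lra.
  have T'T : T' < T by rewrite /T'; lra.
  have [a1 a2] : - T' < t /\ t < T' by apply/andP; rewrite -ltr_norml.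
  have [b1 b2] : - T' < t1 /\ t1 < T' by apply/andP; rewrite -ltr_norml.
  have d := @is_derive_prim R f (- T' - t1) (T' - t1) (t - t1).
  have {}d : is_derive (t - t1) 1 (fun u => u * mean01 (fun t0 => f (t0 * u))) (f (t - t1)).
    apply: d; [lra|lra|by apply/andP; split; lra|].
    move=> v /andP[v1 v2]; apply: (@continuous_comp _ _ _ (fun x : R => t1 + x) w).
      by apply: cvgD; [exact: cvg_cst|exact: cvg_id].
    by apply: cw; rewrite ltr_norml; apply/andP; split; lra.
  have dsub : is_derive t 1 (fun v : R => v - t1) (1 : R).
    apply: (is_derive_eq (is_deriveB (is_derive_id t (1 : R)) (is_derive_cst t1 t (1 : R)))).
    by rewrite subr0.
  have dc := @is_derive1_comp R _ (fun v => v - t1) t _ _ d dsub.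
  apply: (is_derive_eq (is_deriveD (is_derive_cst t1 t (1 : R)) dc)).
  by rewrite add0r mulr1 /f addrC subrK.
have inT s t x : - T < s -> t < T -> s <= x <= t -> `|x| < T.
  by move=> h1 h2 /andP[h3 h4]; rewrite ltr_norml; apply/andP; split; lra.
have mono (s t : R) : - T < s -> s <= t -> t < T ->
    2^-1 * (t - s) <= theta t - theta s <= 2 * (t - s).
  move=> Ts st tT; move: st; rewrite le_eqVlt => /predU1P[->|st].
    by rewrite !subrr !mulr0 lexx.
  have [||x] := @MVT R theta w s t st.
  - by move=> x; rewrite in_itv /= => /andP[h1 h2]; apply/dth/(inT s t) => //; rewrite !ltW.
  - by apply: within_cont => x xI; exact/is_derive_cont/dth/(inT s t).
  rewrite in_itv /= => /andP[h1 h2] ->.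
  have /andP[w1 w2] : 2^-1 <= w x <= 2 by apply/wb/(inT s t) => //; rewrite !ltW.
  by rewrite !ler_wpM2r ?subr_ge0 ?(ltW st)//.
have inv s : exists t, theta (- T0) <= s <= theta T0 -> - T0 <= t <= T0 /\ theta t = s.
  have [sI|nI] := pselect (theta (- T0) <= s <= theta T0); last by exists 0.
  have [|||t] := @IVT R theta (- T0) T0 s.
  - by lra.
  - apply: within_cont => x /andP[h1 h2]; apply/is_derive_cont/dth.
    by rewrite ltr_norml; apply/andP; split; lra.
  - by have /andP[h1 h2] := sI; rewrite ge_min le_max h1 h2 orbT.
  by rewrite in_itv /= => tI ts; exists t.
have [Tf TfP] := choice inv.
have Tfth t : - T0 <= t <= T0 -> Tf (theta t) = t.
  move=> /andP[t1' t2'].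
  have thI : theta (- T0) <= theta t <= theta T0.
    have /andP[h _] := mono (- T0) t ltac:(lra) t1' ltac:(lra).
    have /andP[h' _] := mono t T0 ltac:(lra) t2' ltac:(lra).
    by apply/andP; split; lra.
  have [/andP[u1 u2] e] := TfP _ thI; set u := Tf _ in u1 u2 e *.
  have [h|h|//] := ltgtP u t.
    by have /andP[h' _] := mono u t ltac:(lra) (ltW h) ltac:(lra); lra.
  by have /andP[h' _] := mono t u ltac:(lra) (ltW h) ltac:(lra); lra.
exists theta, Tf; split=> //; first by rewrite /theta subrr mul0r addr0.
move=> s /andP[s1 s2].
have [/andP[u1 u2] e] := TfP s ltac:(by rewrite !ltW).
set u := Tf s in u1 u2 e *.
have u1' : - T0 < u.
  by rewrite lt_neqAle u1 andbT; apply: contraTneq s1 => h; rewrite h e ltxx.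
have u2' : u < T0.
  by rewrite lt_neqAle u2 andbT; apply: contraTneq s2 => h; rewrite -h e ltxx.
have uT : `|u| < T by rewrite ltr_norml; apply/andP; split; lra.
have near_u : \forall v \near u, v \in `]- T0, T0[.
  by apply: near_in_itvoo; rewrite in_itv /= u1' u2'.
rewrite -e; apply: (@is_derive_inverse R theta).
- by apply: filterS near_u => v; rewrite in_itv /= => /andP[v1 v2]; rewrite Tfth// !ltW.
- apply: filterS near_u => v; rewrite in_itv /= => /andP[v1 v2].
  by apply/is_derive_cont/dth; rewrite ltr_norml; apply/andP; split; lra.
- exact: dth.
- by have /andP[h _] := wb u uT; rewrite gt_eqF//; lra.
Qed.

End OneVariable.

Section Uniqueness.
Variable R : realType.
Local Notation V := 'rV[R]_2.

Lemma is_derive_entry (phi : R -> V) (t : R) (v : V) i :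
  is_derive t 1 phi v -> is_derive t 1 (fun s => phi s 0 i) (v 0 i).
Proof.
move=> [dp <-].
have dphi : differentiable phi t by exact/derivable1_diffP.
have lc : linear (fun x : V => x 0 i) by move=> a x y; rewrite !mxE.
have cc : continuous (fun x : V => x 0 i) by move=> x; exact: coord_continuous.
have [d1 D1] := derive_lin ('D_1 phi t) (phi t) lc cc.
have [d2 D2] := derive_comp1 (1 : R) dphi d1.
by apply: DeriveDef; [exact/derivable1_diffP|rewrite D2 D1].
Qed.

Lemma within_entry (phi : R -> V) (A : set R) i : {within A, continuous phi} ->
  {within A, continuous (fun s => phi s 0 i)}.
Proof.
move=> cphi x.
have cc : {for phi x, continuous (fun y : V => y 0 i)} by exact: coord_continuous.
exact: (cvg_comp _ _ (cphi x) cc).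
Qed.

Definition dist1 (x y : V) : R := \sum_i `|x 0 i - y 0 i|.

(** Gronwall: with N the squared distance of the two orbits, |N'| <= 4 L N, so
    that exp (4 L t) N is monotone before t0 and exp (- 4 L t) N after t0. The
    field only has to be Lipschitz, as the physical field is. *)
Lemma orbit_unique (F : V -> V) (S : set V) (L a b t0 : R) (phi psi : R -> V) :
  0 <= L ->
  (forall x y, S x -> S y -> forall i, `|F x 0 i - F y 0 i| <= L * dist1 x y) ->
  orbit S F a b phi -> orbit S F a b psi -> a <= t0 <= b -> phi t0 = psi t0 ->
  forall t, a <= t <= b -> phi t = psi t.
Proof.
move=> L0 Flip [ab cphi dphi Sphi] [_ cpsi dpsi Spsi] /andP[at0 t0b] e0.
pose D (i : 'I_2) (t : R) := phi t 0 i - psi t 0 i.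
pose G (i : 'I_2) (t : R) := F (phi t) 0 i - F (psi t) 0 i.
pose i1 : 'I_2 := lift ord0 ord0.
pose N t := D ord0 t * D ord0 t + D i1 t * D i1 t.
pose dN t := 2 * (D ord0 t * G ord0 t + D i1 t * G i1 t).
have cD i : {within `[a, b], continuous (D i)}.
  by move=> x; apply: cvgB; [exact: within_entry|exact: within_entry].
have cN : {within `[a, b], continuous N}.
  by move=> x; apply: cvgD; apply: cvgM; exact: cD.
have dD i (t : R) : a < t < b -> is_derive t 1 (D i) (G i t).
  move=> tI; exact: (is_deriveB (is_derive_entry i (dphi t tI)) (is_derive_entry i (dpsi t tI))).
have dNt (t : R) : a < t < b -> is_derive t 1 N (dN t).
  move=> tI; have d0 := dD ord0 t tI; have d1 := dD i1 t tI.
  apply: (is_derive_eq (is_deriveD (is_deriveM d0 d0) (is_deriveM d1 d1))).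
  by rewrite /dN /GRing.scale /=; ring.
have dNb (t : R) : a < t < b -> `|dN t| <= 4 * L * N t.
  move=> /andP[t1 t2]; have tI : a <= t <= b by rewrite !ltW.
  have gb i : `|G i t| <= L * (`|D ord0 t| + `|D i1 t|).
    have := Flip _ _ (Sphi t tI) (Spsi t tI) i.
    by rewrite /dist1 !big_ord_recl big_ord0 addr0.
  have g0 := gb ord0; have g1 := gb i1.
  set x := D ord0 t in g0 g1 *; set y := D i1 t in g0 g1 *.
  rewrite /dN /N -/x -/y normrM normr_nat.
  apply: (@le_trans _ _ (2 * (`|x| * (L * (`|x| + `|y|)) + `|y| * (L * (`|x| + `|y|))))).
    rewrite ler_wpM2l//; apply: le_trans (ler_normD _ _) _; rewrite !normrM.
    by apply: lerD; apply: ler_wpM2l.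
  rewrite -!expr2 -(real_normK (num_real x)) -(real_normK (num_real y)).
  have : 0 <= L * (`|x| - `|y|) ^+ 2 by rewrite mulr_ge0 ?sqr_ge0.
  by rewrite !expr2; lra.
have Nt0 : N t0 = 0 by rewrite /N /D e0 !subrr mul0r addr0.
have N0 t : 0 <= N t by rewrite /N -!expr2 addr_ge0 ?sqr_ge0.
pose K := 4 * L.
have dexp (k t : R) : is_derive t 1 (fun s => expR (k * s)) (k * expR (k * t)).
  apply: is_derive_expR_comp.
  apply: (is_derive_eq (is_deriveZ k (is_derive_id t (1 : R)))).
  by rewrite /GRing.scale /= mulr1.
have cexp (k : R) : {within `[a, b], continuous (fun s : R => expR (k * s))}.
  by apply: within_cont => t _; exact: is_derive_cont (dexp k t).
have dH (k t : R) : a < t < b ->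
    is_derive t 1 (fun s => expR (k * s) * N s) (expR (k * t) * (dN t + k * N t)).
  move=> tI; apply: (is_derive_eq (is_deriveM (dexp k t) (dNt t tI))).
  by rewrite /GRing.scale /=; ring.
have cH (k : R) : {within `[a, b], continuous (fun s => expR (k * s) * N s)}.
  by move=> x; apply: cvgM; [exact: cexp|exact: cN].
have zero t : a <= t <= b -> N t <= 0.
  move=> /andP[at_ tb]; have [t0t|/ltW tt0] := lerP t0 t.
    have H := @nonincr R (fun s => expR (- K * s) * N s) _ a b (cH (- K)) (dH (- K)) _ t0 t at0 t0t tb.
    have {}H : expR (- K * t) * N t <= expR (- K * t0) * N t0.
      apply: H => s sI; rewrite pmulr_rle0 ?expR_gt0// mulNr subr_le0.
      exact: le_trans (ler_norm _) (dNb s sI).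
    by move: H; rewrite Nt0 mulr0 pmulr_rle0 ?expR_gt0.
  have cH' : {within `[a, b], continuous (fun s => - (expR (K * s) * N s))}.
    by move=> x; apply: cvgN; exact: cH.
  have H := @nonincr R (fun s => - (expR (K * s) * N s)) _ a b cH'
    (fun s sI => is_deriveN (dH K s sI)) _ t t0 at_ tt0 t0b.
  have {}H : - (expR (K * t0) * N t0) <= - (expR (K * t) * N t).
    apply: H => s sI; rewrite oppr_le0 pmulr_rge0 ?expR_gt0// -lerBlDr sub0r.
    by have := dNb s sI; rewrite ler_norml => /andP[].
  by move: H; rewrite Nt0 mulr0 oppr0 oppr_ge0 pmulr_rle0 ?expR_gt0.
move=> t tI; apply/rowP => i.
have Nt : N t = 0 by apply/eqP; rewrite eq_le N0 zero.
have D0 j : D j t = 0.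
  have : D ord0 t = 0 /\ D i1 t = 0.
    move: Nt => /eqP; rewrite /N -!expr2 paddr_eq0 ?sqr_ge0// !expf_eq0 /=.
    by move=> /andP[/eqP ? /eqP ?].
  move=> [z0 z1]; case: (unliftP ord0 j) => [k ->|->//].
  by rewrite (ord1 k).
by apply/eqP; rewrite -subr_eq0; apply/eqP; exact: D0.
Qed.

End Uniqueness.

Section Lipschitz.
Variables (R : realType) (E : normedModType R).
Local Notation V := 'rV[R]_2.

(** Uniform in p. The bound on f is included to make products stable. *)
Definition lip_at (p0 : E) (x0 : V) (f : E -> V -> R) : Prop :=
  exists2 L : R, 0 <= L & \forall r \near (0 : R), forall p x y,
    `|p - p0| < r -> `|x - x0| < r -> `|y - x0| < r ->
    `|f p x - f p y| <= L * dist1 x y /\ `|f p x| <= L.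

Lemma near_ball_prod (F G : normedModType R) (x : F) (y : G) (P : F * G -> Prop) :
  (\forall z \near (x, y), P z) ->
  \forall r \near (0 : R), forall u v, `|u - x| < r -> `|v - y| < r -> P (u, v).
Proof.
move=> [[A B] /= [/nbhs_ballP[d d0 dA] /nbhs_ballP[e e0 eB]] AB].
have H : \forall r \near (0 : R), r < Num.min d e.
  by apply: lt_nbhsl; rewrite lt_min; apply/andP.
apply: filterS H => r; rewrite lt_min => /andP[rd re] u v ux vy.
apply: (AB (u, v)); split=> /=.
  by apply: dA; rewrite -ball_normE /= distrC (lt_trans ux).
by apply: eB; rewrite -ball_normE /= distrC (lt_trans vy).
Qed.

(** Hadamard's formula, whose coefficients are bounded near the base point by
    continuity. *)
Lemma smooth_lip (p0 : E) (x0 : V) (f : E -> V -> R) : findim E ->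
  smooth_near (p0, x0) (joint f) -> lip_at p0 x0 f.
Proof.
move=> fE sf.
pose g (z : V * E) := joint f (z.2, z.1).
have sg : smooth_near (x0, p0) g.
  apply: (@smooth_comp _ _ _ _ (fun z : V * E => (z.2, z.1)) (joint f)) => //.
    exact: findim_prod fE (@findim_row R 2).
  by smooth_tac.
pose e (i : 'I_2) : V := delta_mx 0 i.
pose c (i : 'I_2) (x : V) := x 0 i.
have co : coordinates e c.
  split.
  - by move=> i a x y; rewrite /c !mxE.
  - by move=> i x; exact: coord_continuous.
  - by move=> x; rewrite {1}(row_sum_delta x).
pose b (z : V * E) := `|g z| + \sum_i `|'D_(e i, 0) g z|.
pose L := b (x0, p0) + 1.
have cb : {for (x0, p0), continuous b}.
  apply: cvgD; first by apply: cvg_norm; exact: smooth_near_cont.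
  apply: (@cvg_bigsum R R) => i; apply: cvg_norm.
  exact: (smooth_near_cont (smooth_derive ((e i, 0) : V * E) sg)).
have nb : \forall z \near (x0, p0), b z < L /\ smooth_near z g.
  apply: filterI (smooth_near_near sg); apply: near_lt0 cb _.
  by rewrite /L ltrDl.
have b_ge (z : V * E) : `|g z| <= b z /\ forall i, `|'D_(e i, 0) g z| <= b z.
  split; first by rewrite /b lerDl sumr_ge0.
  move=> i; rewrite /b (bigD1 i)//= addrCA lerDl addr_ge0//.
  exact: sumr_ge0.
have L0 : 0 <= L.
  by rewrite /L addr_ge0//; apply: le_trans (b_ge (x0, p0)).1.
exists L => //; apply: filterS (near_ball_prod nb) => r H p x y pr xr yr.
split; last by have [/ltW h _] := H x p xr pr; exact: le_trans (b_ge (x, p)).1 h.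
have seg (u : R) : 0 <= u <= 1 -> `|y + u *: (x - y) - x0| < r.
  move=> /andP[u0 u1].
  have -> : y + u *: (x - y) - x0 = u *: (x - x0) + (1 - u) *: (y - x0).
    by apply/rowP => j; rewrite !mxE; ring.
  apply: le_lt_trans (ler_normD _ _) _; rewrite !normrZ ger0_norm// ger0_norm ?subr_ge0//.
  have [->|u_gt0] := eqVneq u 0; first by rewrite mul0r add0r subr0 mul1r.
  have : u * `|x - x0| < u * r by rewrite ltr_pM2l// lt_neqAle eq_sym u_gt0.
  have : (1 - u) * `|y - x0| <= (1 - u) * r by rewrite ler_wpM2l ?subr_ge0// ltW.
  by lra.
have [_ C1] : smooth_on [set z | smooth_near z g] g.
  by apply: smooth_onP => //; rewrite openE => z /smooth_near_near.
have Oseg (u : R) : 0 <= u <= 1 -> smooth_near (y + u *: (x - y), p) g.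
  by move=> /seg h; have [] := H _ p h pr.
have hd := hadamard_slice co (C1 1%N) (x := y) (y := x) (t := p) Oseg.
have -> : f p x - f p y = \sum_i c i (x - y) *
    mean01 (fun u => 'D_(e i, 0) g (y + u *: (x - y), p)).
  by rewrite -[f p x]/(g (x, p)) hd [g (y, p) + _]addrC -[f p y]/(g (y, p)) addrK.
apply: le_trans (ler_norm_sum _ _ _) _; rewrite /dist1 mulr_sumr.
apply: ler_sum => i _; rewrite normrM mulrC.
have -> : `|c i (x - y)| = `|x 0 i - y 0 i| by rewrite /c !mxE.
apply: ler_wpM2r => //; apply: mean01_le => [u u01|u u01].
  apply: (@continuous_comp _ _ _ (fun u : R => (y + u *: (x - y), p)) ('D_(e i, 0) g)).
    by apply: smooth_near_cont; smooth_tac.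
  exact: (smooth_near_cont (smooth_derive ((e i, 0) : V * E) (Oseg u u01))).
have [/ltW h _] := H _ p (seg u u01) pr.
exact: le_trans ((b_ge _).2 i) h.
Qed.

Lemma lip_add p0 x0 f g : lip_at p0 x0 f -> lip_at p0 x0 g ->
  lip_at p0 x0 (fun p x => f p x + g p x).
Proof.
move=> [L L0 HL] [K K0 HK]; exists (L + K); first exact: addr_ge0.
apply: filterS2 HL HK => r hL hK p x y pr xr yr.
have [l1 l2] := hL p x y pr xr yr; have [k1 k2] := hK p x y pr xr yr.
split; last by apply: le_trans (ler_normD _ _) _; exact: lerD.
have -> : f p x + g p x - (f p y + g p y) = (f p x - f p y) + (g p x - g p y) by ring.
by rewrite mulrDl; apply: le_trans (ler_normD _ _) _; exact: lerD.
Qed.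

Lemma lip_mul p0 x0 f g : lip_at p0 x0 f -> lip_at p0 x0 g ->
  lip_at p0 x0 (fun p x => f p x * g p x).
Proof.
move=> [L L0 HL] [K K0 HK]; exists (L * K + L * K); first by rewrite addr_ge0 ?mulr_ge0.
apply: filterS2 HL HK => r hL hK p x y pr xr yr.
have [l1 l2] := hL p x y pr xr yr; have [k1 k2] := hK p x y pr xr yr.
have [_ k3] := hK p y x pr yr xr.
have d0 : 0 <= dist1 x y by apply: sumr_ge0.
split; last first.
  by rewrite normrM; apply: ler_wpDr; [exact: mulr_ge0|exact: ler_pM].
have -> : f p x * g p x - f p y * g p y =
  f p x * (g p x - g p y) + (f p x - f p y) * g p y by ring.
apply: le_trans (ler_normD _ _) _; rewrite !normrM mulrDl; apply: lerD.
  by rewrite -mulrA; apply: ler_pM.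
by rewrite mulrAC; apply: ler_pM.
Qed.

Lemma lip_pos p0 x0 f : lip_at p0 x0 f -> lip_at p0 x0 (fun p x => Num.max (f p x) 0).
Proof.
move=> [L L0 HL]; exists L => //.
apply: filterS HL => r hL p x y pr xr yr.
have [l1 l2] := hL p x y pr xr yr; split.
  apply: le_trans l1; set a := f p x; set b := f p y.
  rewrite ler_norml; have := ler_norm (a - b); have := ler_norm (- (a - b)).
  rewrite normrN => h1 h2.
  by rewrite /Num.max; case: ifP => ?; case: ifP => ?; apply/andP; split; lra.
apply: le_trans l2; rewrite /Num.max; case: ifP => // _.
by rewrite normr0.
Qed.

End Lipschitz.

(** * Physical orbits in the chart *)

Lemma orbit_sub (R : realType) (E : normedModType R) (S : set E) (F : E -> E)
    (a b a' b' : R) (phi : R -> E) :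
  orbit S F a b phi -> a <= a' -> a' <= b' -> b' <= b -> orbit S F a' b' phi.
Proof.
move=> [ab cphi dphi Sphi] aa' a'b' b'b; split=> //.
- apply: continuous_subspaceW cphi => t /=; rewrite !in_itv /= => /andP[t1 t2].
  by rewrite (le_trans aa' t1) (le_trans t2 b'b).
- by move=> t /andP[t1 t2]; apply: dphi; rewrite (le_lt_trans aa' t1) (lt_le_trans t2 b'b).
- by move=> t /andP[t1 t2]; apply: Sphi; rewrite (le_trans aa' t1) (le_trans t2 b'b).
Qed.

Lemma orbit_weaken (R : realType) (E : normedModType R) (S S' : set E) (F : E -> E)
    (a b : R) (phi : R -> E) :
  S `<=` S' -> orbit S F a b phi -> orbit S' F a b phi.
Proof. by move=> SS' [ab cphi dphi Sphi]; split=> // t /Sphi/SS'. Qed.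

Lemma derive_chart (R : realType) (F : normedModType R) (Y : R * R -> F) (q : R * R)
    (k a b : R) : differentiable Y q ->
  'D_(1 + k * a, k * b) Y q =
  'D_(1, 0) Y q + k *: (a *: 'D_(1, 0) Y q + b *: 'D_(0, 1) Y q).
Proof.
move=> dY.
have -> : ((1 + k * a, k * b) : R * R) = (1 + k * a) *: (1, 0) + (k * b) *: (0, 1).
  by congr pair; rewrite /= /GRing.scale /= ?mulr1 ?mulr0 ?addr0 ?add0r.
by rewrite derive_lincomb2// scalerDl scale1r scalerDr !scalerA addrA.
Qed.

Section FixedParam.
Variables (R : realType).
Local Notation V := 'rV[R]_2.
Variables (h : V -> R) (Xm Xp W : V -> V) (tau : V -> R).
Variables (Y : R * R -> V) (H a b : R * R -> R) (S B : set V) (T L : R).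
Let F := physical h Xm Xp.
Let box := [set q : R * R | `|q.1| < T /\ `|q.2| < T].
Hypotheses (T_gt0 : 0 < T) (L_ge0 : 0 <= L).
Hypotheses (dY : forall q, box q -> differentiable Y q)
  (cH : forall q, box q -> {for q, continuous H})
  (ca : forall q, box q -> {for q, continuous a}).
Hypotheses (hY : forall q, box q -> h (Y q) = H q)
  (tauY : forall q, box q -> tau (Y q) = q.1)
  (SY : forall q, box q -> S (Y q))
  (Ha : forall q, box q -> `|H q * a q| <= 2^-1).
Hypotheses (YXm : forall q, box q -> 'D_(1, 0) Y q = Xm (Y q))
  (YW : forall q, box q -> W (Y q) = a q *: 'D_(1, 0) Y q + b q *: 'D_(0, 1) Y q)
  (YXp : forall q, box q -> Xp (Y q) = Xm (Y q) + H q *: W (Y q)).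
Hypothesis Flip : forall x y, S x -> S y -> forall i,
  `|F x 0 i - F y 0 i| <= L * dist1 x y.
Hypotheses (BS : B `<=` S) (Btau : forall x, B x -> `|tau x| < T / 2).

Definition pos_part (q : R * R) : R := Num.max (H q) 0.

Let T0 : R := T / 2.
Let T0' : R := (3 / 4) * T.
Let T0_gt0 : 0 < T0. Proof. by rewrite divr_gt0. Qed.
Let T0T0' : T0 < T0'. Proof. by rewrite /T0 /T0'; have := T_gt0; lra. Qed.
Let T0'T : T0' < T. Proof. by rewrite /T0'; have := T_gt0; lra. Qed.

Lemma physicalE q : box q -> F (Y q) = Xm (Y q) + pos_part q *: W (Y q).
Proof.
move=> bq; rewrite /F /physical hY// /pos_part.
case: (lerP (H q) 0) => [H0|H0]; last by rewrite YXp.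
by rewrite scale0r addr0.
Qed.

Let pos_a q : box q -> `|pos_part q * a q| <= 2^-1.
Proof.
move=> bq; rewrite /pos_part; case: (lerP (H q) 0) => _; last exact: Ha.
by rewrite mul0r normr0.
Qed.

Let cpos q : box q -> {for q, continuous pos_part}.
Proof.
move=> bq; apply: continuous_at_eps => e e0.
have := near_dist (cH bq) e0; apply: filterS => y; rewrite /pos_part.
rewrite ltr_norml => /andP[h1 h2]; rewrite ler_norml.
by case: (lerP (H y) 0) => ?; case: (lerP (H q) 0) => ?; apply/andP; split; lra.
Qed.

(* rr gives the first integral along the orbit as a function of flow-box time *)
Variable rr : R -> R.
Hypotheses (rrT : forall t : R, `|t| < T -> `|rr t| < T)
  (drr : forall t : R, `|t| < T -> is_derive t 1 rr
     (pos_part (t, rr t) * b (t, rr t) / (1 + pos_part (t, rr t) * a (t, rr t)))).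
Variable t1 : R.
Hypotheses (t1T : - T0 < t1 < T0)
  (H_before : forall t : R, - T < t -> t <= t1 -> H (t, rr t) <= 0).

(** By the equation for rr, the curve t |-> Y (t, rr t) has velocity the
    physical field divided by 1 + H_+ a. The clock theta of rate
    (1 + H_+ a) ^ - 1 therefore turns it into an orbit; it agrees with t until
    t1, where H_+ vanishes. *)
Lemma phys_orbit : exists theta Tf : R -> R,
  let phi s := Y (Tf s, rr (Tf s)) in
  [/\ forall t, - T0 <= t <= t1 -> theta t = t,
      forall s t, - T0 <= s -> s <= t -> t <= T0 ->
        2^-1 * (t - s) <= theta t - theta s <= 2 * (t - s),
      forall t, - T0 <= t <= T0 -> Tf (theta t) = t,
      forall s, theta (- T0) <= s <= theta T0 -> - T0 <= Tf s <= T0 /\ theta (Tf s) = s &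
      orbit S F (theta (- T0)) (theta T0) phi].
Proof.
have boxr t : `|t| < T -> box (t, rr t) by move=> tT; split=> //; exact: rrT.
have c2 t : `|t| < T -> {for t, continuous (fun t => (t, rr t))}.
  move=> tT; apply: cont_pair; first exact: cvg_id.
  exact: is_derive_cont (drr tT).
pose g t := 1 + pos_part (t, rr t) * a (t, rr t).
have g_bd t : `|t| < T -> 2^-1 <= g t <= 3 / 2.
  move=> tT; have := pos_a (boxr t tT); rewrite ler_norml /g => /andP[h1 h2].
  by apply/andP; split; lra.
have cg t : `|t| < T -> {for t, continuous g}.
  move=> tT; apply: cvgD; first exact: cvg_cst.
  apply: cvgM.
    by apply: (@continuous_comp _ _ _ (fun t => (t, rr t)) pos_part); [exact: c2|apply/cpos/boxr].
  by apply: (@continuous_comp _ _ _ (fun t => (t, rr t)) a); [exact: c2|apply/ca/boxr].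
pose w t := (g t)^-1.
have g_gt0 t : `|t| < T -> 0 < g t.
  by move=> /g_bd/andP[h1 _]; lra.
have cw t : `|t| < T -> {for t, continuous w}.
  by move=> tT; apply: cvgV; [rewrite gt_eqF ?g_gt0|exact: cg].
have wb t : `|t| < T -> 2^-1 <= w t <= 2.
  move=> tT; have /andP[h1 h2] := g_bd t tT; have h3 := g_gt0 t tT.
  rewrite /w; apply/andP; split; first by rewrite lef_pV2 ?posrE//; lra.
  by rewrite -[2]invrK lef_pV2 ?posrE ?invr_gt0.
have [h1 h2] := andP t1T; have h3 := T0T0'; have h4 := T0'T; have h5 := T0_gt0.
have T0'0 : 0 < T0' by lra.
have t1T' : - T < t1 < T by apply/andP; split; lra.
have [theta [Tf [th1 dth mono TfP dTf]]] := time_change T0'0 T0'T t1T' cw wb.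
exists theta, Tf => phi.
have mono' s t : - T0 <= s -> s <= t -> t <= T0 ->
    2^-1 * (t - s) <= theta t - theta s <= 2 * (t - s).
  by move=> a1 a2 a3; apply: mono => //; lra.
have thmono s t : - T0' <= s -> s <= t -> t <= T0' -> theta s <= theta t.
  move=> a1 a2 a3; have /andP[k _] := mono s t ltac:(lra) a2 ltac:(lra).
  by rewrite -subr_ge0; apply: le_trans k; rewrite mulr_ge0 ?subr_ge0.
have thsmono s t : - T0' <= s -> s < t -> t <= T0' -> theta s < theta t.
  move=> a1 a2 a3; have /andP[k _] := mono s t ltac:(lra) (ltW a2) ltac:(lra).
  by rewrite -subr_gt0; apply: lt_le_trans k; rewrite mulr_gt0 ?subr_gt0.
have Tfth t : - T0' <= t <= T0' -> Tf (theta t) = t.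
  move=> /andP[a1 a2].
  have [/andP[u1 u2] e] : - T0' <= Tf (theta t) <= T0' /\ theta (Tf (theta t)) = theta t.
    by apply: TfP; rewrite !thmono.
  have [k|k|//] := ltgtP (Tf (theta t)) t.
    by have := thsmono _ _ u1 k a2; rewrite e ltxx.
  by have := thsmono _ _ a1 k u2; rewrite e ltxx.
have TfT0 s : theta (- T0) <= s <= theta T0 -> - T0 <= Tf s <= T0 /\ theta (Tf s) = s.
  move=> /andP[s1 s2].
  have [/andP[u1 u2] e] : - T0' <= Tf s <= T0' /\ theta (Tf s) = s.
    apply: TfP; rewrite (le_trans _ s1) ?(le_trans s2)//; apply: thmono; lra.
  split=> //; apply/andP; split; rewrite leNgt; apply/negP => k.
    by have := thsmono _ _ u1 k ltac:(lra); rewrite e ltNge s1.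
  by have := thsmono T0 _ ltac:(lra) k u2; rewrite e ltNge s2.
have inT0 t : - T0 <= t <= T0 -> `|t| < T.
  by move=> /andP[a1 a2]; rewrite ltr_norml; apply/andP; split; lra.
have dphi (s : R) : theta (- T0) <= s <= theta T0 -> is_derive s 1 phi (F (phi s)).
  move=> sI; have [uI e] := TfT0 s sI; have uT := inT0 _ uI.
  have [s1 s2] := andP sI.
  have sI' : theta (- T0') < s < theta T0'.
    by rewrite (lt_le_trans _ s1) ?(le_lt_trans s2)//; apply: thsmono; lra.
  have d1 := dTf s sI'; set u := Tf s in uI e uT d1 *.
  have dr := drr uT.
  have d2 := @is_derive1_comp R rr Tf s _ _ dr d1.
  have [e1 E1] := d1; have [e2 E2] := d2.
  have f1 : differentiable Tf s by apply/derivable1_diffP; exact: e1.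
  have f2 : differentiable (fun s => rr (Tf s)) s by apply/derivable1_diffP; exact: e2.
  have bu : box (u, rr u) by exact: boxr.
  have [dc Dc] := derive_comp_pair (1 : R) f1 f2 (dY bu).
  apply: DeriveDef; first exact/derivable1_diffP.
  have vel : F (Y (u, rr u)) = 'D_(g u, pos_part (u, rr u) * b (u, rr u)) Y (u, rr u).
    by rewrite (physicalE bu) -(YXm bu) (YW bu) -(derive_chart _ _ _ (dY bu)).
  have w1 : (w u)^-1 = g u by rewrite /w invrK.
  have w2 (r : R) : r / g u * (w u)^-1 = r.
    by rewrite w1; apply: mulfVK; rewrite gt_eqF// g_gt0.
  by apply: (etrans Dc); rewrite E1 E2 w2 w1 vel.
split=> //.
- move=> t /andP[a1 a2].
  have T1 : - T < - T0 by lra.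
  have tT : `|t| < T by apply: inT0; apply/andP; split; lra.
  have w1 x : - T < x -> x <= t1 -> w x = 1.
    move=> x1 x2; rewrite /w /g /pos_part max_r; last exact: H_before.
    by rewrite mul0r addr0 invr1.
  move: a2; rewrite le_eqVlt => /predU1P[->//|tt1].
  have [||c] := @MVT R theta w t t1 tt1.
  + by move=> x; rewrite in_itv /= => /andP[x1 x2]; apply: dth; rewrite ltr_norml; apply/andP; split; lra.
  + apply: within_cont => x /andP[x1 x2]; apply/is_derive_cont/dth.
    by rewrite ltr_norml; apply/andP; split; lra.
  rewrite in_itv /= th1 => /andP[c1 c2']; rewrite w1; [|lra|lra].
  by rewrite mul1r => k; lra.
- by move=> t /andP[a1 a2]; apply: Tfth; apply/andP; split; lra.
- split.
  + by apply: thmono; lra.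
  + by apply: within_cont => s /dphi[dp _]; apply: differentiable_continuous; exact/derivable1_diffP.
  + by move=> s /andP[s1 s2]; apply: dphi; rewrite !ltW.
  + by move=> s /TfT0[/inT0 uT _]; apply/SY/boxr.
Qed.

End FixedParam.

Section Comparison.
Variables (R : realType).
Local Notation V := 'rV[R]_2.
Variables (F : V -> V) (tau : V -> R) (S B : set V) (L T0 : R).
Hypothesis L_ge0 : 0 <= L.
Hypothesis Flip : forall x y, S x -> S y -> forall i,
  `|F x 0 i - F y 0 i| <= L * dist1 x y.
Hypotheses (BS : B `<=` S) (Btau : forall x, B x -> `|tau x| < T0).

(** An orbit in B cannot outlast psi: at both ends of psi the flow-box time has
    modulus T0, which it does not reach in B. *)
Lemma orbit_in_box (e0 e1 t0 a b : R) (psi phi : R -> V) :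
  orbit S F e0 e1 psi -> tau (psi e0) = - T0 -> tau (psi e1) = T0 ->
  e0 <= t0 <= e1 -> orbit B F a b phi -> a <= t0 <= b -> phi t0 = psi t0 ->
  [/\ e0 <= a, b <= e1 & forall t, a <= t <= b -> phi t = psi t].
Proof.
move=> opsi tau0 tau1 /andP[e0t0 t0e1] ophi /andP[at0 t0b] eq0.
have [_ _ _ Bphi] := ophi.
pose a' := Num.max a e0; pose b' := Num.min b e1.
have a't0 : a' <= t0 by rewrite /a' ge_max at0.
have t0b' : t0 <= b' by rewrite /b' le_min t0b.
have [aa' e0a'] : a <= a' /\ e0 <= a' by rewrite /a' !le_max !lexx orbT.
have [b'b b'e1] : b' <= b /\ b' <= e1 by rewrite /b' !ge_min !lexx orbT.
have a'b' := le_trans a't0 t0b'.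
have E := orbit_unique L_ge0 Flip
  (orbit_weaken BS (orbit_sub ophi aa' a'b' b'b)) (orbit_sub opsi e0a' a'b' b'e1)
  (introT andP (conj a't0 t0b')) eq0.
have e0a : e0 <= a.
  rewrite leNgt; apply/negP => ae0.
  have a'E : a' = e0 by rewrite /a' max_r// ltW.
  have := E e0; rewrite -{1 2}a'E lexx a'b' => /(_ isT) EE.
  have := Btau (Bphi e0 _); rewrite EE tau0 normrN ltNge ler_norm => H.
  by apply: notF; apply: H; rewrite (ltW ae0) (le_trans e0t0).
have be1 : b <= e1.
  rewrite leNgt; apply/negP => e1b.
  have b'E : b' = e1 by rewrite /b' min_r// ltW.
  have := E e1; rewrite -{1 2}b'E lexx a'b' => /(_ isT) EE.
  have := Btau (Bphi e1 _); rewrite EE tau1 ltNge ler_norm => H.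
  by apply: notF; apply: H; rewrite (ltW e1b) (le_trans at0).
split=> // t /andP[t1 t2]; apply: E.
by rewrite /a' /b' ge_max le_min t1 t2 (le_trans e0a t1) (le_trans t2 be1).
Qed.

End Comparison.

Section Profile.
Variables (R : realType) (H a b : R * R -> R) (T te tx rho rx : R) (r1 : R -> R).
Let G (q : R * R) := pos_part H q * b q / (1 + pos_part H q * a q).
Hypotheses (te_tx : te < tx) (r1te : r1 te = rho) (r1tx : r1 tx = rx).
Hypothesis dr1 : forall t : R, te <= t <= tx -> is_derive t 1 r1 (G (t, r1 t)).
Hypotheses (Hb : forall t : R, - T < t -> t < te -> H (t, rho) < 0) (He : H (te, rho) = 0)
  (Hm : forall t : R, te < t -> t < tx -> 0 < H (t, r1 t)) (Hx : H (tx, rx) = 0)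
  (Ha : forall t : R, tx < t -> t < T -> H (t, rx) < 0).

Definition profile (t : R) : R :=
  if t <= te then rho else if t <= tx then r1 t else rx.

Lemma profile_before t : t <= te -> profile t = rho.
Proof. by rewrite /profile => ->. Qed.

Lemma profile_mid t : te <= t <= tx -> profile t = r1 t.
Proof.
move=> /andP[t1 t2]; rewrite /profile; case: ifP => h; last by rewrite t2.
by rewrite -r1te; congr r1; apply/eqP; rewrite eq_le t1 h.
Qed.

Lemma profile_after t : tx <= t -> profile t = rx.
Proof.
move=> t1; rewrite /profile ifF; last by apply/negbTE; rewrite -ltNge (lt_le_trans te_tx).
case: ifP => h //; rewrite -r1tx; congr r1; apply/eqP; rewrite eq_le t1 h.
by [].
Qed.

Let G0 q : H q <= 0 -> G q = 0.
Proof. by move=> h; rewrite /G /pos_part max_r// !mul0r. Qed.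

Lemma profile_sign t : - T < t < T ->
  (0 < H (t, profile t) <-> te < t < tx) /\
  (H (t, profile t) = 0 <-> (t = te \/ t = tx)).
Proof.
move=> /andP[Tt tT].
have [h|h|->] := ltgtP t te.
- rewrite profile_before ?ltW//; have n := Hb Tt h; split.
    by rewrite ltNge (ltW n).
  split=> [e|[e|e]]; first by rewrite e ltxx in n.
    by rewrite e ltxx in h.
  by move: (lt_trans h te_tx); rewrite e ltxx.
- have [k|k|->] := ltgtP t tx.
  + rewrite profile_mid ?ltW//; have n := Hm h k; split=> //.
    by split=> [e|[e|e]]; [rewrite e ltxx in n|rewrite e ltxx in h|rewrite e ltxx in k].
  + rewrite profile_after ?ltW//; have n := Ha k tT; split.
      by rewrite ltNge (ltW n).
    by split=> [e|[e|e]]; [rewrite e ltxx in n|rewrite e ltxx in h|rewrite e ltxx in k].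
  + by rewrite profile_after// Hx ltxx; split=> //; split=> // _; right.
- by rewrite profile_before// He ltxx; split=> //; split=> // _; left.
Qed.

(** At te and tx both one-sided derivatives vanish, because the height does. *)
Lemma profile_derive (t : R) : - T < t < T -> is_derive t 1 profile (G (t, profile t)).
Proof.
move=> /andP[Tt tT].
have cst0 (c u : R) : is_derive u 1 (fun=> c) (0 : R) by exact: is_derive_cst.
pose r2 (u : R) := if u <= tx then r1 u else rx.
have [h|h|h] := ltgtP t te.
- rewrite profile_before ?ltW// G0 ?ltW//; last exact: Hb.
  apply: near_eq_is_derive (cst0 rho t).
  by apply: filterS (lt_nbhsl h) => u uh; rewrite profile_before// ltW.
- have nt : \forall u \near t, profile u = r2 u.
    by apply: filterS (lt_nbhsr h) => u uh; rewrite /profile ifF//; apply/negbTE; rewrite -ltNge.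
  suff d2 : is_derive t 1 r2 (G (t, profile t)).
    by apply: near_eq_is_derive d2; apply: filterS nt.
  have [k|k|k] := ltgtP t tx.
  + rewrite profile_mid ?ltW//; have := dr1 (t := t); rewrite !ltW// => /(_ isT) d1.
    apply: near_eq_is_derive d1.
    by apply: filterS (lt_nbhsl k) => u uh; rewrite /r2 ltW.
  + rewrite profile_after ?ltW// G0 ?ltW//; last exact: Ha.
    apply: near_eq_is_derive (cst0 rx t).
    by apply: filterS (lt_nbhsr k) => u uh; rewrite /r2 ifF//; apply/negbTE; rewrite -ltNge.
  + rewrite k profile_after// G0 ?Hx//.
    have := dr1 (t := tx); rewrite (ltW te_tx) lexx => /(_ isT) d1.
    rewrite r1tx G0 ?Hx// in d1.
    exact: (is_derive_glue d1 (cst0 rx tx) r1tx).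
- rewrite h profile_before// G0 ?He//.
  have := dr1 (t := te); rewrite (ltW te_tx) lexx => /(_ isT) d1.
  rewrite r1te G0 ?He// in d1.
  have d2 : is_derive te 1 r2 0.
    apply: near_eq_is_derive d1.
    by apply: filterS (lt_nbhsl te_tx) => u uh; rewrite /r2 ltW.
  apply: (is_derive_glue (cst0 rho te) d2).
  by rewrite /r2 (ltW te_tx).
Qed.

End Profile.

(** The physical orbit with first integral rho before contact, in the chart Y:
   at flow-box time t it is at Y (t, rr t), and it is there at time theta t. *)
Record passage (R : realType) (h : 'rV[R]_2 -> R) (F : 'rV[R]_2 -> 'rV[R]_2)
    (Y : R * R -> 'rV[R]_2) (B : set 'rV[R]_2) (T0 rho rx C : R)
    (te tx : R) (theta Tf rr : R -> R) : Prop := Passage {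
  pas_le : te <= tx;
  pas_te : `|te| <= C;
  pas_tx : `|tx| <= C;
  pas_theta : forall t, - T0 <= t <= te -> theta t = t;
  pas_mono : forall s t, - T0 <= s -> s <= t -> t <= T0 ->
    2^-1 * (t - s) <= theta t - theta s <= 2 * (t - s);
  pas_Tf : forall t, - T0 <= t <= T0 -> Tf (theta t) = t;
  pas_inv : forall s, theta (- T0) <= s <= theta T0 ->
    - T0 <= Tf s <= T0 /\ theta (Tf s) = s;
  pas_orbit : orbit setT F (theta (- T0)) (theta T0) (fun s => Y (Tf s, rr (Tf s)));
  pas_before : forall t, t <= te -> rr t = rho;
  pas_after : forall t, tx <= t -> rr t = rx;
  pas_sign : 0 < rho -> te < tx /\ forall t, - T0 <= t <= T0 ->
    (0 < h (Y (t, rr t)) <-> te < t < tx) /\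
    (h (Y (t, rr t)) = 0 <-> (t = te \/ t = tx));
  pas_unique : forall t0 a b phi, - T0 <= t0 <= te -> orbit B F a b phi ->
    a <= t0 <= b -> phi t0 = Y (t0, rho) ->
    [/\ theta (- T0) <= a, b <= theta T0 & forall t, a <= t <= b ->
       phi t = Y (Tf t, rr (Tf t))]
}.

Section PassageExists.
Variables (R : realType).
Local Notation V := 'rV[R]_2.
Variables (h : V -> R) (Xm Xp W : V -> V) (tau : V -> R).
Variables (Y : R * R -> V) (H a b : R * R -> R) (S B : set V) (T L : R).
Let F := physical h Xm Xp.
Let box := [set q : R * R | `|q.1| < T /\ `|q.2| < T].
Hypotheses (T_gt0 : 0 < T) (L_ge0 : 0 <= L).
Hypotheses (dY : forall q, box q -> differentiable Y q)
  (cH : forall q, box q -> {for q, continuous H})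
  (ca : forall q, box q -> {for q, continuous a}).
Hypotheses (hY : forall q, box q -> h (Y q) = H q)
  (tauY : forall q, box q -> tau (Y q) = q.1)
  (SY : forall q, box q -> S (Y q))
  (Ha : forall q, box q -> `|H q * a q| <= 2^-1).
Hypotheses (YXm : forall q, box q -> 'D_(1, 0) Y q = Xm (Y q))
  (YW : forall q, box q -> W (Y q) = a q *: 'D_(1, 0) Y q + b q *: 'D_(0, 1) Y q)
  (YXp : forall q, box q -> Xp (Y q) = Xm (Y q) + H q *: W (Y q)).
Hypothesis Flip : forall x y, S x -> S y -> forall i,
  `|F x 0 i - F y 0 i| <= L * dist1 x y.
Hypotheses (BS : B `<=` S) (Btau : forall x, B x -> `|tau x| < T / 2).

Lemma passage_of_profile (rr : R -> R) (te tx rho rx C : R) :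
  (forall t : R, `|t| < T -> `|rr t| < T) ->
  (forall t : R, `|t| < T -> is_derive t 1 rr
     (pos_part H (t, rr t) * b (t, rr t) / (1 + pos_part H (t, rr t) * a (t, rr t)))) ->
  - (T / 2) < te < T / 2 ->
  (forall t : R, - T < t -> t <= te -> H (t, rr t) <= 0) ->
  te <= tx -> `|te| <= C -> `|tx| <= C ->
  (forall t, t <= te -> rr t = rho) -> (forall t, tx <= t -> rr t = rx) ->
  (0 < rho -> te < tx /\ forall t, - T < t < T ->
    (0 < H (t, rr t) <-> te < t < tx) /\
    (H (t, rr t) = 0 <-> (t = te \/ t = tx))) ->
  exists theta Tf, passage h F Y B (T / 2) rho rx C te tx theta Tf rr.
Proof.
move=> rrT drr teT Hb tetx teC txC before after sign.
have [theta [Tf [th_id mono Tfth thTf orb]]] := phys_orbit T_gt0 dY cH ca hY SY Ha YXm YW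
  YXp rrT drr teT Hb.
have T00 : 0 < T / 2 by rewrite divr_gt0.
have [te1 te2] := andP teT.
have T0te : - (T / 2) <= - (T / 2) <= te by rewrite lexx ltW.
have thT0 : theta (- (T / 2)) = - (T / 2) by exact: th_id.
have inT t : - (T / 2) <= t <= T / 2 -> `|t| < T.
  by move=> /andP[t1 t2]; rewrite ltr_norml; apply/andP; split; lra.
have tauphi t : - (T / 2) <= t <= T / 2 -> tau (Y (Tf (theta t), rr (Tf (theta t)))) = t.
  move=> tI; rewrite Tfth// tauY//; split=> /=; first exact: inT.
  by apply: rrT; exact: inT.
exists theta, Tf; split=> //.
- exact: orbit_weaken orb.
- move=> /sign[lt s]; split=> // t tI; have tT := inT t tI.
  have bt : box (t, rr t) by split=> //; exact: rrT.
  rewrite !(hY bt); apply: s; by rewrite -ltr_norml.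
- move=> t0 a' b' phi t0I ophi tI phiY.
  have [t01 t02] := andP t0I.
  have t0T0 : - (T / 2) <= t0 <= T / 2 by rewrite t01 ltW// (le_lt_trans t02).
  have tht0 := th_id t0 t0I.
  have t0th : theta (- (T / 2)) <= t0 <= theta (T / 2).
    rewrite thT0 t01 /= -tht0 -subr_ge0.
    have /andP[m _] := mono t0 (T / 2) t01 (ltW (le_lt_trans t02 te2)) (lexx _).
    apply: le_trans m; rewrite mulr_ge0 ?subr_ge0//.
    by have /andP[] := t0T0.
  apply: (@orbit_in_box R F tau S B L (T / 2) L_ge0 Flip BS Btau _ _ t0 a' b'
    (fun s => Y (Tf s, rr (Tf s)))) => //.
  + by apply: tauphi; rewrite lexx /= (le_trans _ (ltW T00))// oppr_le0 ltW.
  + by apply: tauphi; rewrite lexx andbT (le_trans _ (ltW T00))// oppr_le0 ltW.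
  + by rewrite phiY -{2 3}tht0 Tfth// before.
Qed.

End PassageExists.

(** * A box common to all parameters *)

Definition slice (R : realType) (P : Type) (G : Type) (f : (P * R) * R -> G) (p : P)
  (q : R * R) : G := f ((p, q.1), q.2).

(** Passage from the joint chart to the chart at one parameter. *)
Lemma derive_slice (R : realType) (m : nat) (G : normedModType R)
    (X : ('rV[R]_m * R) * R -> G) (p : 'rV[R]_m) (q : R * R) :
  differentiable X ((p, q.1), q.2) ->
  differentiable (slice X p) q /\
  forall v : R * R, 'D_v (slice X p) q = 'D_((0, v.1), v.2) X ((p, q.1), q.2).
Proof.
move=> dX.
have d1 : differentiable (fun y : R * R => y.1) q by apply: smooth_diff; smooth_tac.
have d2 : differentiable (fun y : R * R => y.2) q by apply: smooth_diff; smooth_tac.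
have dp : differentiable (fun y : R * R => p) q by exact: differentiable_cst.
have di : differentiable (fun y : 'rV[R]_m * R => y) (p, q.1) by apply: smooth_diff; smooth_tac.
have du : differentiable (fun y : R * R => (p, y.1)) q by apply: smooth_diff; smooth_tac.
split=> [|v]; first by have [] := derive_comp_pair (0 : R * R) du d2 dX.
have [_ E] := derive_comp_pair v du d2 dX; rewrite [LHS]E.
have [_ ->] := derive_comp_pair v dp d1 di.
by rewrite derive_id derive_cst derive_fst derive_snd.
Qed.

(** What is used, at one parameter, of the chart Y, of the height H of the seam
   function in it, and of the components a and b of W. *)
Record flow_chart (R : realType) (h : 'rV[R]_2 -> R) (Xm Xp W : 'rV[R]_2 -> 'rV[R]_2)
    (tau I : 'rV[R]_2 -> R) (Y : R * R -> 'rV[R]_2) (H a b : R * R -> R)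
    (S : set 'rV[R]_2) (q : R * R) : Prop := FlowChart {
  fc_diff : differentiable Y q;
  fc_H : {for q, continuous H};
  fc_a : {for q, continuous a};
  fc_h : h (Y q) = H q;
  fc_tau : tau (Y q) = q.1;
  fc_I : I (Y q) = q.2;
  fc_S : S (Y q);
  fc_small : `|H q * a q| <= 2^-1;
  fc_Xm : 'D_(1, 0) Y q = Xm (Y q);
  fc_W : W (Y q) = a q *: 'D_(1, 0) Y q + b q *: 'D_(0, 1) Y q;
  fc_Xp : Xp (Y q) = Xm (Y q) + H q *: W (Y q)
}.

Record flow_coordinates (R : realType) (Xm : 'rV[R]_2 -> 'rV[R]_2)
    (tau I : 'rV[R]_2 -> R) (Y : R * R -> 'rV[R]_2) (S : set 'rV[R]_2) (T : R)
    (x : 'rV[R]_2) : Prop := FlowCoordinates {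
  fco_S : S x;
  fco_tau : `|tau x| < T / 2;
  fco_dtau : differentiable tau x;
  fco_dI : differentiable I x;
  fco_Lie_tau : Lie Xm tau x = 1;
  fco_Lie_I : Lie Xm I x = 0;
  fco_chart : Y (tau x, I x) = x
}.

Section LocalPicture.
Variables (R : realType) (m nu : nat).
Local Notation Pm := 'rV[R]_m.
Local Notation V := 'rV[R]_2.
Variables (U : set (Pm * V)) (h : Pm -> V -> R) (Xm Xp W : Pm -> V -> V)
  (z : Pm -> V) (I tau : Pm -> V -> R).
Hypotheses (setting : contact_setting nu U h Xm Xp W z)
  (first_int : first_integral h Xm z I) (fb_time : flow_box_time Xm z tau).
Local Notation o3 := ((0 : Pm, 0 : R), 0 : R).
Local Notation q0 := ((0 : Pm), z 0).

Let sh : smooth_near q0 (joint h).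
Proof. exact: smooth_on_near (contact_dom setting) (smooth_h setting). Qed.
Let sXm : smooth_near q0 (joint Xm).
Proof. exact: smooth_on_near (contact_dom setting) (smooth_Xm setting). Qed.
Let sW : smooth_near q0 (joint W).
Proof. exact: smooth_on_near (contact_dom setting) (smooth_W setting). Qed.

Let nearU : \forall q \near q0, U q.
Proof. by apply: near_open (proj1 (smooth_h setting)) (contact_dom setting) _. Qed.

(** The physical field is Xm + max (h, 0) W, and the positive part of a
    Lipschitz function is Lipschitz. *)
Lemma physical_lip : exists2 L : R, 0 <= L & \forall r \near (0 : R),
  forall (p : Pm) (x y : V), `|p| < r -> `|x - z 0| < r -> `|y - z 0| < r ->
  forall i : 'I_2, `|physical (h p) (Xm p) (Xp p) x 0 i -
     physical (h p) (Xm p) (Xp p) y 0 i| <= L * dist1 x y.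
Proof.
have findV := @findim_row R 2; have findP := @findim_row R m.
have ent (Y : Pm -> V -> V) (i : 'I_2) : smooth_near q0 (joint Y) ->
    lip_at 0 (z 0) (fun p x => Y p x 0 i).
  by move=> sY; apply: smooth_lip => //; exact: smooth_entry.
have lipi (i : 'I_2) : lip_at 0 (z 0) (fun p x => Xm p x 0 i + Num.max (h p x) 0 * W p x 0 i).
  apply: lip_add; first exact: ent.
  apply: lip_mul; last exact: ent.
  by apply: lip_pos; exact: smooth_lip.
have [L0 L00 H0] := lipi ord0; have [L1 L10 H1] := lipi (lift ord0 ord0).
exists (L0 + L1); first exact: addr_ge0.
apply: filterS3 H0 H1 (near_ball_prod nearU) => r H0 H1 HU p x y pr xr yr.
have physE v i : `|v - z 0| < r ->
    physical (h p) (Xm p) (Xp p) v 0 i = Xm p v 0 i + Num.max (h p v) 0 * W p v 0 i.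
  move=> vr; have /(fields_diff setting) XpE : U (p, v) by apply: HU; rewrite ?subr0.
  rewrite /physical; case: ifPn => [hv|].
    by rewrite max_r// mul0r addr0.
  rewrite -ltNge => /ltW hv; rewrite max_l//.
  by have := congr1 (fun v : V => v 0 i) XpE; rewrite !mxE => <-; rewrite subrKC.
have d0 : 0 <= dist1 x y by apply: sumr_ge0.
move=> i; rewrite !physE//.
have pr' : `|p - 0| < r by rewrite subr0.
have [l0 _] := H0 p x y pr' xr yr; have [l1 _] := H1 p x y pr' xr yr.
case: (unliftP ord0 i) => [j|] ->.
  by rewrite [j]ord1; apply: le_trans l1 _; rewrite ler_wpM2r// lerDr.
by apply: le_trans l0 _; rewrite ler_wpM2r// lerDl.
Qed.

(** Makes the identities near the contact hold on fixed sets for all p of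
    modulus less than d: a square of half-side T in the chart, a ball S on which
    the physical field is Lipschitz, and a ball B so small that flow-box times in
    it are less than T / 2, whereas the chart covers all times less than T. *)
Lemma local_picture (N : set V) : nbhs (z 0) N ->
  exists (X : (Pm * R) * R -> V) (E1 a b : (Pm * R) * R -> R) (c : Pm * R -> R)
    (d T L : R) (S B : set V),
  let H (q : (Pm * R) * R) := q.2 * E1 q - q.1.2 ^+ nu * c q.1 in
  [/\ [/\ smooth_near o3 X, X o3 = z 0, open B, B (z 0) & B `<=` N],
      [/\ smooth_near o3 E1, smooth_near o3 a, smooth_near o3 b &
          smooth_near (0 : Pm, 0 : R) c],
      [/\ \forall p \near (0 : Pm), E1 ((p, 0), 0) = 1,
          \forall p \near (0 : Pm), c (p, 0) = kappa nu h Xm z p / nu`!%:R &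
          \forall p \near (0 : Pm), b ((p, 0), 0) = beta h W z p],
      [/\ 0 < d, 0 < T & 0 <= L] &
      forall p : Pm, `|p| < d ->
      [/\ forall q : R * R, `|q.1| < T /\ `|q.2| < T ->
            flow_chart (h p) (Xm p) (Xp p) (W p) (tau p) (I p)
              (slice X p) (slice H p) (slice a p) (slice b p) S q /\
            smooth_near ((p, q.1), q.2) X,
          forall q : R * R, `|q.1| < T /\ `|q.2| < T -> 2^-1 <= slice E1 p q <= 2,
          forall t : R, `|t| < T -> c (0, 0) / 2 <= c (p, t),
          forall x, B x -> flow_coordinates (Xm p) (tau p) (I p) (slice X p) S T x /\
            (smooth_near (p, x) (joint tau) /\ smooth_near (p, x) (joint I)) &
          forall x y : V, S x -> S y -> forall i : 'I_2,
            `|physical (h p) (Xm p) (Xp p) x 0 i -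
              physical (h p) (Xm p) (Xp p) y 0 i| <= L * dist1 x y]].
Proof.
move=> nN.
have [X [sX X0 tauIX XtauI]] := chart_exists setting first_int fb_time.
have [E1 [c [sE sc HE E10 c0]]] := normal_form setting first_int fb_time sX X0 tauIX XtauI.
pose a (q : (Pm * R) * R) := Lie (W q.1.1) (tau q.1.1) (X q).
pose b (q : (Pm * R) * R) := Lie (W q.1.1) (I q.1.1) (X q).
have stau := smooth_tau fb_time; have sI := smooth_I first_int.
have sa : smooth_near o3 a by apply: (smooth_along sX X0).
have sb : smooth_near o3 b by apply: (smooth_along sX X0).
have [L L0 lipr] := physical_lip.
pose H (q : (Pm * R) * R) := q.2 * E1 q - q.1.2 ^+ nu * c q.1.
have fPR := findim_prod (@findim_row R m) (@findim_real R).
have sH : smooth_near o3 H.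
  by rewrite /H; smooth_by ltac:(first [exact: sE | apply: (@smooth_comp _ _ _ _ fst c) => //]).
have nu0 : (0 < nu)%N.
  rewrite lt0n; apply/eqP => n0.
  have := nbhs_singleton (contact_h setting); have := nbhs_singleton (contact_kappa setting).
  by rewrite n0 /kappa /= => k h0; move: k; rewrite h0 oppr0 ltxx.
have H0 : H o3 = 0 by rewrite /H /= mul0r expr0n eqn0Ngt nu0 mul0r subr0.
have k0 : 0 < c (0, 0).
  by rewrite (nbhs_singleton c0) divr_gt0 ?(nbhs_singleton (contact_kappa setting))//
    ltr0n fact_gt0.
have [r0 r00 lip0] : exists2 r0 : R, 0 < r0 & forall (p : Pm) (x y : V), `|p| < r0 ->
    `|x - z 0| < r0 -> `|y - z 0| < r0 ->
    forall i : 'I_2, `|physical (h p) (Xm p) (Xp p) x 0 i -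
     physical (h p) (Xm p) (Xp p) y 0 i| <= L * dist1 x y.
  have [e e0 He] := near_radius lipr; exists e => //; apply: He.
  by rewrite sub0r add0r lexx andbT; lra.
pose S := [set x : V | `|x - z 0| < r0].
have XE := near_phase sX X0.
pose P1 (q : (Pm * R) * R) := [/\ smooth_near q X, smooth_near q H & smooth_near q a].
have n1 : \forall q \near o3, P1 q.
  by apply: filterS3 (smooth_near_near sX) (smooth_near_near sH) (smooth_near_near sa) => q; split.
pose P2 (q : (Pm * R) * R) := [/\ h q.1.1 (X q) = H q, tau q.1.1 (X q) = q.1.2,
  I q.1.1 (X q) = q.2, S (X q) & `|H q * a q| <= 2^-1].
have n2 : \forall q \near o3, P2 q.
  have nS : \forall q \near o3, S (X q).
    have := near_dist (smooth_near_cont sX) r00; rewrite X0; apply.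
  have nHa : \forall q \near o3, `|H q * a q| <= 2^-1.
    have sHa : smooth_near o3 (fun q => H q * a q) by exact: smoothM.
    have := near_dist (smooth_near_cont sHa) (_ : 0 < 2^-1).
    rewrite H0 mul0r invr_gt0 ltr0n => /(_ isT); apply: filterS => q.
    by rewrite subr0 => /ltW.
  apply: filterS3 HE tauIX (filterI nS nHa) => q e1 [e2 e3] [e4 e5]; split=> //.
pose P3 (q : (Pm * R) * R) := [/\ 'D_((0, 1), 0) X q = Xm q.1.1 (X q),
  W q.1.1 (X q) = a q *: 'D_((0, 1), 0) X q + b q *: 'D_((0, 0), 1) X q,
  Xp q.1.1 (X q) = Xm q.1.1 (X q) + H q *: W q.1.1 (X q),
  2^-1 <= E1 q <= 2 & c (0, 0) / 2 <= c q.1].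
have n3 : \forall q \near o3, P3 q.
  have nE : \forall q \near o3, 2^-1 <= E1 q <= 2.
    have := near_dist (smooth_near_cont sE) (_ : 0 < 2^-1).
    rewrite (nbhs_singleton E10) invr_gt0 ltr0n => /(_ isT); apply: filterS => q.
    by rewrite ltr_norml => /andP[e1 e2]; apply/andP; split; lra.
  have nc : \forall q \near o3, c (0, 0) / 2 <= c q.1.
    have sc3 : smooth_near o3 (fun q => c q.1) by apply: (@smooth_comp _ _ _ _ fst c) => //; smooth_tac.
    have := near_dist (smooth_near_cont sc3) (_ : 0 < c (0, 0) / 2).
    rewrite divr_gt0// => /(_ isT); apply: filterS => q /=.
    by rewrite ltr_norml => /andP[e1 e2]; lra.
  have frame := XE _ (chart_frame first_int fb_time sX XtauI).
  have flow := chart_flow' first_int fb_time sX X0 tauIX XtauI.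
  have inU := XE _ nearU.
  apply: filterS (filterI (filterI frame flow) (filterI (filterI nE nc)
    (filterI inU (filterI HE (chart_phase tauIX))))).
  move=> q [[fr fl] [[nEq ncq] [iU [hq ph]]]].
  have e1 : W q.1.1 (X q) = a q *: 'D_((0, 1), 0) X q + b q *: 'D_((0, 0), 1) X q.
    by have := fr (W q.1.1 (X q)); rewrite ph.
  have e2 : Xp q.1.1 (X q) = Xm q.1.1 (X q) + H q *: W q.1.1 (X q).
    by have := fields_diff setting iU; rewrite [h _ _]hq => <-; rewrite addrC addrNK.
  exact: (And5 fl e1 e2 nEq ncq).
have [T1 T10 box1] : exists2 T1 : R, 0 < T1 & forall p (t r : R), `|p| < T1 -> `|t| < T1 ->
    `|r| < T1 -> [/\ P1 ((p, t), r), P2 ((p, t), r) & P3 ((p, t), r)].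
  pose Q (pt : Pm * R) (e : R) := forall r : R, `|r| < e -> [/\ P1 (pt, r), P2 (pt, r) & P3 (pt, r)].
  have nQ : \forall q \near o3, [/\ P1 q, P2 q & P3 q].
    by apply: filterS3 n1 n2 n3 => q; split.
  have [e e0 He] := near_radius (near_ball_prod nQ).
  have He' : forall (pt : Pm * R) (r : R), `|pt| < e -> `|r| < e ->
      [/\ P1 (pt, r), P2 (pt, r) & P3 (pt, r)].
    move=> pt r pe re; apply: (He e); last by rewrite subr0.
      by rewrite sub0r add0r lexx andbT; lra.
    by have -> : pt - (0, 0) = pt by exact: subr0.
  exists e; first exact: e0.
  move=> p t r pe te re; apply: He'; last exact: re.
  by rewrite prod_normE /= gt_max pe te.
pose T := Num.min T1 r0.
have T0 : 0 < T by rewrite lt_min T10.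
have TT1 : T <= T1 by rewrite ge_min lexx.
have Tr0 : T <= r0 by rewrite ge_min lexx orbT.
pose P4 (w : Pm * V) := [/\ S w.2, `|tau w.1 w.2| < T / 2,
  smooth_near w (joint tau) & smooth_near w (joint I)].
have n4 : \forall w \near q0, P4 w.
  have nS : \forall w \near q0, S w.2.
    by have := near_dist (smooth_near_cont (smooth_snd q0)) r00.
  have nt : \forall w \near q0, `|tau w.1 w.2| < T / 2.
    have := near_dist (smooth_near_cont stau) (divr_gt0 T0 (ltr0Sn R 1)).
    have -> : joint tau q0 = 0 by exact: nbhs_singleton (tau_contact fb_time).
    by apply: filterS => w; rewrite subr0.
  apply: filterS3 nS nt (filterI (smooth_near_near stau) (smooth_near_near sI)).
  by move=> w s1 s2 [s4 s5]; split.
pose P5 (w : Pm * V) := [/\ Lie (Xm w.1) (tau w.1) w.2 = 1, Lie (Xm w.1) (I w.1) w.2 = 0,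
   X ((w.1, tau w.1 w.2), I w.1 w.2) = w.2 & N w.2].
have n5 : \forall w \near q0, P5 w.
  have nN' : \forall w \near q0, N w.2 by exact: (near_cont (smooth_near_cont (smooth_snd q0)) nN).
  apply: filterS3 (Lie_tau fb_time) (Lie_I first_int) (filterI XtauI nN') => w s1 s2 [s3 s4].
  by split.
have [r1 r10 ball1] : exists2 r1 : R, 0 < r1 & forall p x, `|p| < r1 -> `|x - z 0| < r1 ->
    P4 (p, x) /\ P5 (p, x).
  have [e e0 He] := near_radius (near_ball_prod (filterI n4 n5)); exists e => // p x pe xe.
  apply: (He e) => //; first by rewrite sub0r add0r lexx andbT; lra.
  by rewrite subr0.
pose d := Num.min T r1.
have d0 : 0 < d by rewrite lt_min T0.
have dT : d <= T by rewrite ge_min lexx.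
have dr1 : d <= r1 by rewrite ge_min lexx orbT.
exists X, E1, a, b, c, d, T, L, S, (ball (z 0) r1); split => //.
- split=> //; [exact: ball_open | exact: ballxx | ].
  move=> x; rewrite -ball_normE /= distrC => xr.
  have z1 : `|0 : Pm| < r1 by rewrite normr0.
  by have [_ [_ _ _ ?]] := ball1 0 x z1 xr.
- split=> //; exact: (beta_along setting first_int fb_time XtauI).
move=> p pd.
have pT1 : `|p| < T1 by apply: lt_le_trans pd (le_trans dT TT1).
have boxT (t r : R) : `|t| < T -> `|r| < T -> [/\ P1 ((p, t), r), P2 ((p, t), r) & P3 ((p, t), r)].
  by move=> tT rT; apply: box1 => //; [exact: lt_le_trans tT TT1 | exact: lt_le_trans rT TT1].
split.
- move=> [t r] [/= tT rT]; have [[p1 p2 p3] [p5 p6 p7 p8 p9] [p10 p11 p12 p13 p14]] := boxT t r tT rT.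
  have [dY DY] := derive_slice (q := (t, r)) (smooth_diff p1).
  have cs (G : (Pm * R) * R -> R) : smooth_near ((p, t), r) G -> {for (t, r), continuous (slice G p)}.
    by move=> sG; apply: differentiable_continuous; have [] := derive_slice (q := (t, r)) (smooth_diff sG).
  have e1 : 'D_(1, 0) (slice X p) (t, r) = Xm p (slice X p (t, r)) by rewrite DY.
  have e2 : W p (slice X p (t, r)) = slice a p (t, r) *: 'D_(1, 0) (slice X p) (t, r) +
      slice b p (t, r) *: 'D_(0, 1) (slice X p) (t, r) by rewrite !DY.
  split; last exact: p1.
  exact: (FlowChart dY (cs _ p2) (cs _ p3) p5 p6 p7 p8 p9 e1 e2 p12).
- by move=> [t r] [/= tT rT]; have [_ _ [_ _ _ ? _]] := boxT t r tT rT.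
- move=> t tT; have z0 : `|0 : R| < T by rewrite normr0.
  by have [_ _ [_ _ _ _ ?]] := boxT t 0 tT z0.
- move=> x; rewrite -ball_normE /= distrC => xr.
  have [[p1 p2 p4 p5] [p6 p7 p8 p9]] := ball1 p x (lt_le_trans pd dr1) xr.
  have [dt _] := diff_partial (smooth_diff p4); have [dI _] := diff_partial (smooth_diff p5).
  split; last by split.
  exact: (FlowCoordinates p1 p2 dt dI p6 p7 p8).
- by move=> x y Sx Sy; apply: lip0 => //; apply: lt_le_trans pd (le_trans dT Tr0).
Qed.

End LocalPicture.

Section PassageAt.
Variables (R : realType) (m nu : nat).
Local Notation Pm := 'rV[R]_m.
Local Notation V := 'rV[R]_2.
Hypothesis nu_even : ~~ odd nu.
Variables (h : V -> R) (Xm Xp W : V -> V) (tau I : V -> R)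
  (X : (Pm * R) * R -> V) (E1 a b : (Pm * R) * R -> R) (c : Pm * R -> R)
  (p : Pm) (T L k0 : R) (S B : set V).
Let H (q : (Pm * R) * R) := q.2 * E1 q - q.1.2 ^+ nu * c q.1.
Let F := physical h Xm Xp.
Let Y := slice X p.
Hypotheses (T_gt0 : 0 < T) (L_ge0 : 0 <= L) (k0_gt0 : 0 < k0)
  (chart : forall q : R * R, `|q.1| < T /\ `|q.2| < T ->
    flow_chart h Xm Xp W tau I Y (slice H p) (slice a p) (slice b p) S q)
  (E1_le : forall q : R * R, `|q.1| < T /\ `|q.2| < T -> 2^-1 <= slice E1 p q <= 2)
  (c_ge : forall t : R, `|t| < T -> k0 / 2 <= c (p, t))
  (Flip : forall x y : V, S x -> S y -> forall i, `|F x 0 i - F y 0 i| <= L * dist1 x y)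
  (BS : B `<=` S) (Btau : forall x, B x -> `|tau x| < T / 2).

Let passageP := passage_of_profile T_gt0 L_ge0 (fun q Tq => fc_diff (chart Tq))
  (fun q Tq => fc_H (chart Tq)) (fun q Tq => fc_a (chart Tq))
  (fun q Tq => fc_h (chart Tq)) (fun q Tq => fc_tau (chart Tq)) (fun q Tq => fc_S (chart Tq))
  (fun q Tq => fc_small (chart Tq)) (fun q Tq => fc_Xm (chart Tq)) (fun q Tq => fc_W (chart Tq))
  (fun q Tq => fc_Xp (chart Tq)) Flip BS Btau.

(** nu is even, hence r E1 - t ^ nu c <= 0 for r <= 0: the orbit never enters
    the positive side. *)
Lemma passage_inside (rho C : R) : rho <= 0 -> - T < rho -> 0 <= C ->
  exists theta Tf, passage h F Y B (T / 2) rho rho C 0 0 theta Tf (fun=> rho).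
Proof.
move=> rho0 Trho C0.
have rT : `|rho| < T by rewrite ler0_norm//; lra.
have H_le t : `|t| < T -> slice H p (t, rho) <= 0.
  move=> tT; have /andP[e1 e2] := E1_le (q := (t, rho)) (conj tT rT).
  have ct := c_ge tT; rewrite /slice /H /= subr_le0.
  apply: (@le_trans _ _ 0); first by apply: mulr_le0_ge0 => //; apply: le_trans e1.
  by apply: mulr_ge0; [exact: exprn_even_ge0 | apply: le_trans ct; rewrite ltW// divr_gt0].
apply: passageP => //; rewrite ?normr0//.
- move=> t tT; apply: (is_derive_eq (is_derive_cst rho t (1 : R))).
  by rewrite /pos_part max_r ?mul0r ?mulr0 ?mul0r//; exact: H_le.
- by rewrite oppr_lt0 divr_gt0.
- by move=> t Tt t0; apply: H_le; rewrite ler0_norm//; lra.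
- by rewrite ltNge rho0.
Qed.

Variables (M : R) (ue ux : Pm * R -> R) (wf : Pm * R -> R -> R) (s Aq : R).
Let q : Pm * R := (p, s).
Let K (u w : R) := height nu E1 c ((q, u), w).
Hypotheses (M_gt0 : 0 < M) (M_big : 8 < M ^+ nu * k0) (s_gt0 : 0 < s)
  (sM : s * M < T / 2) (sT : 2 * s ^+ nu < T)
  (ueI : - M < ue q < 0) (uxI : 0 < ux q < M)
  (Kb : forall u : R, - M <= u -> u < ue q -> K u 1 < 0) (Ke : K (ue q) 1 = 0)
  (Km : forall u : R, ue q < u -> u < ux q -> 0 < K u (wf q u))
  (Kx : K (ux q) (wf q (ux q)) = 0)
  (Ka : forall u : R, ux q < u -> u <= M -> K u (wf q (ux q)) < 0)
  (wfe : wf q (ue q) = 1) (wfx : wf q (ux q) = 1 + s * Aq)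
  (dwf : forall u : R, ue q <= u <= ux q ->
     is_derive u 1 (wf q) (s * drift nu E1 a b c ((q, u), wf q u)) /\ 2^-1 <= wf q u <= 2).

Let snu_gt0 : 0 < s ^+ nu. Proof. exact: exprn_gt0. Qed.

Let H_scale (u w : R) : slice H p (s * u, s ^+ nu * w) = s ^+ nu * K u w.
Proof. by rewrite /slice /H /K /height /unscale /= exprMn; ring. Qed.

Let H_scale' (t w : R) : slice H p (t, s ^+ nu * w) = s ^+ nu * K (t / s) w.
Proof. by rewrite -H_scale mulrCA mulfV ?mulr1// gt_eqF. Qed.

(** Here 4 bounds w E1, and M ^ nu k0 / 2 > 4. *)
Let H_far (t w : R) : `|t| < T -> s * M < `|t| -> 2^-1 <= w <= 2 -> slice H p (t, s ^+ nu * w) < 0.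
Proof.
move=> tT tM /andP[w1 w2].
have w0 : 0 <= w by apply: le_trans w1.
have rT : `|s ^+ nu * w| < T.
  rewrite ger0_norm; last by apply: mulr_ge0 => //; exact: ltW.
  apply: le_lt_trans sT.
  by rewrite mulrC ler_pM2r.
have /andP[e1 e2] := E1_le (q := (t, s ^+ nu * w)) (conj tT rT).
have ct := c_ge tT; rewrite /slice /H /= subr_lt0.
have tnu : s ^+ nu * M ^+ nu <= t ^+ nu.
  rewrite -(ger0_norm (exprn_even_ge0 t nu_even)) normrX -exprMn.
  have sM0 : 0 < s * M by exact: mulr_gt0.
  by apply: lerXn2r; rewrite ?nnegrE// ltW.
apply: (@le_lt_trans _ _ (s ^+ nu * 4)).
  rewrite -mulrA ler_pM2l//.
  have -> : (4 : R) = 2 * 2 by rewrite -natrM.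
  by apply: ler_pM => //; apply: le_trans e1.
apply: (@lt_le_trans _ _ (s ^+ nu * (M ^+ nu * (k0 / 2)))).
  rewrite ltr_pM2l// mulrA ltr_pdivlMr//.
  by have -> : (4 * 2 : R) = 8 by rewrite -natrM.
rewrite mulrA; apply: ler_pM => //; last by rewrite ltW// divr_gt0.
by apply: mulr_ge0; apply: exprn_ge0; exact: ltW.
Qed.

(** Undoes the scaling of [blow_up]. For |t| > s M, outside the range of the
    scaled description, the height is negative because t ^ nu c dominates. *)
Lemma passage_through (rho C : R) : rho = s ^+ nu -> M * s <= C ->
  exists theta Tf rr,
    passage h F Y B (T / 2) rho (rho + s ^+ nu.+1 * Aq) C (s * ue q) (s * ux q) theta Tf rr /\
    forall t, `|rr t| <= 2 * rho.
Proof.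
move=> rhoE MC; have [ue1 ue2] := andP ueI; have [ux1 ux2] := andP uxI.
pose te := s * ue q; pose tx := s * ux q; pose r1 (t : R) := s ^+ nu * wf q (t / s).
have sK u : s * u / s = u by rewrite mulrAC mulfV ?mul1r// gt_eqF.
have te_tx : te < tx by rewrite ltr_pM2l//; apply: lt_trans ux1.
have rho1 : rho = s ^+ nu * 1 by rewrite mulr1.
have rxE : rho + s ^+ nu.+1 * Aq = s ^+ nu * wf q (ux q).
  by rewrite wfx rhoE exprSr mulrDr mulr1 mulrA.
have r1te : r1 te = rho by rewrite /r1 /te sK wfe mulr1.
have r1tx : r1 tx = rho + s ^+ nu.+1 * Aq by rewrite /r1 /tx sK rxE.
have uIn u : ue q <= u <= ux q -> - M <= u <= M by move=> /andP[u1 u2]; apply/andP; split; lra.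
have wxI : 2^-1 <= wf q (ux q) <= 2 by have [] := dwf (u := ux q); rewrite ?lexx ?andbT//; lra.
have tI t : te <= t <= tx -> ue q <= t / s <= ux q.
  by rewrite ler_pdivlMr// ler_pdivrMr// !(mulrC _ s).
have Kge u : ue q <= u <= ux q -> 0 <= K u (wf q u).
  move=> /andP[]; rewrite le_eqVlt => /predU1P[<- _|u1]; first by rewrite wfe Ke.
  rewrite le_eqVlt => /predU1P[->|u2]; first by rewrite Kx.
  exact/ltW/Km.
have dr1 (t : R) : te <= t <= tx -> is_derive t 1 r1
    (pos_part (slice H p) (t, r1 t) * slice b p (t, r1 t) /
     (1 + pos_part (slice H p) (t, r1 t) * slice a p (t, r1 t))).
  move=> /tI ti; have [d1 _] := dwf ti.
  have d0 : is_derive t 1 (fun t : R => s^-1 *: t) (s^-1).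
    by have := is_deriveZ s^-1 (is_derive_id t (1 : R)); rewrite [_ *: _]mulr1.
  have d0' : is_derive t 1 (fun t : R => t / s) (s^-1).
    by apply: near_eq_is_derive d0; apply: near_all => y; rewrite [RHS]mulrC.
  have d2 := @is_derive1_comp R (wf q) (fun t : R => t / s) t _ _ d1 d0'.
  have d3 := is_deriveZ (s ^+ nu) d2; apply: (is_derive_eq d3).
  have Hr : pos_part (slice H p) (t, r1 t) = s ^+ nu * K (t / s) (wf q (t / s)).
    by rewrite /pos_part H_scale' max_l//; apply: mulr_ge0; [exact: ltW | exact: Kge].
  have un : unscale nu ((q, t / s), wf q (t / s)) = ((p, t), r1 t).
    by rewrite /unscale /q /= mulrCA mulfV ?mulr1 ?gt_eqF.
  have E (n k y d : R) : n * ((s * (k * (y / d))) * s^-1) = n * k * y / d.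
    by rewrite (mulrC s) mulfK ?gt_eqF// !mulrA.
  rewrite Hr /drift un; exact: E.
have far1 : 2^-1 <= (1 : R) <= 2 by apply/andP; split; lra.
have Hb t : - T < t -> t < te -> slice H p (t, rho) < 0.
  move=> Tt tte.
  have t0 : t < 0 by apply: lt_trans tte _; rewrite /te pmulr_rlt0.
  have tT : `|t| < T by rewrite ltr0_norm//; lra.
  rewrite rho1; have [l|l] := ltrP (s * M) `|t|; first exact: H_far.
  rewrite H_scale' pmulr_rlt0//; apply: Kb.
    by rewrite ler_pdivlMr// mulrC mulrN lerNl -(ltr0_norm t0).
  by rewrite ltr_pdivrMr// mulrC.
have Ha t : tx < t -> t < T -> slice H p (t, rho + s ^+ nu.+1 * Aq) < 0.
  move=> txt tT'.
  have t0 : 0 < t by apply: lt_trans txt; rewrite /tx mulr_gt0.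
  have tT : `|t| < T by rewrite gtr0_norm.
  rewrite rxE; have [l|l] := ltrP (s * M) `|t|; first exact: H_far.
  rewrite H_scale' pmulr_rlt0//; apply: Ka.
    by rewrite ltr_pdivlMr// mulrC.
  by rewrite ler_pdivrMr// mulrC -(gtr0_norm t0).
have He : slice H p (te, rho) = 0 by rewrite rho1 /te H_scale Ke mulr0.
have Hx : slice H p (tx, rho + s ^+ nu.+1 * Aq) = 0 by rewrite rxE /tx H_scale Kx mulr0.
have Hm t : te < t -> t < tx -> 0 < slice H p (t, r1 t).
  move=> t1 t2; rewrite /r1 H_scale' pmulr_rgt0//; apply: Km.
    by rewrite ltr_pdivlMr// mulrC.
  by rewrite ltr_pdivrMr// mulrC.
pose rr := profile te tx rho (rho + s ^+ nu.+1 * Aq) r1.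
have rho0 : 0 < rho by rewrite rhoE.
have wI w : 2^-1 <= w <= 2 -> `|s ^+ nu * w| <= 2 * rho.
  move=> /andP[w1 w2]; have w0 : 0 <= w by apply: le_trans w1.
  rewrite ger0_norm; last by apply: mulr_ge0 => //; exact: ltW.
  by rewrite rhoE mulrC ler_pM2r.
have rr_le t : `|rr t| <= 2 * rho.
  rewrite /rr /profile; case: ifPn => [_|]; first by rewrite {1}rho1 wI.
  rewrite -ltNge => t1; case: ifPn => t2; last by rewrite rxE wI.
  by apply: wI; have [] := dwf (u := t / s) (tI t _); rewrite // ltW.
have teM : `|te| <= C.
  apply: le_trans MC; rewrite /te normrM gtr0_norm// mulrC ler_pM2r// ler_norml.
  by apply/andP; split; lra.
have txM : `|tx| <= C.
  apply: le_trans MC; rewrite /tx normrM gtr0_norm// mulrC ler_pM2r// ler_norml.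
  by apply/andP; split; lra.
have [||||||||||theta [Tf pas]] := passageP (rr := rr) (te := te) (tx := tx) (rho := rho)
  (rx := rho + s ^+ nu.+1 * Aq) (C := C).
11: by exists theta, Tf, rr.
- by move=> t tT; apply: le_lt_trans (rr_le t) _; rewrite rhoE.
- by move=> t; rewrite ltr_norml => tT; exact: (profile_derive te_tx r1te r1tx dr1 Hb He Hx Ha).
- have : `|te| < T / 2.
    by apply: le_lt_trans sM; rewrite /te normrM gtr0_norm// ler_pM2l// ler_norml; apply/andP; split; lra.
  by rewrite ltr_norml.
- move=> t Tt; rewrite le_eqVlt => /predU1P[->|tte].
    by rewrite /rr profile_before// He.
  by rewrite /rr profile_before ?ltW// Hb.
- exact: ltW.
- exact: teM.
- exact: txM.
- by move=> t tt; exact: profile_before.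
- by move=> t tt; apply: profile_after.
- move=> _; split=> // t tT; exact: (profile_sign te_tx r1te r1tx Hb He Hm Hx Ha).
Qed.

End PassageAt.

Section GrazingBox.
Variables (R : realType) (m nu : nat).
Local Notation Pm := 'rV[R]_m.
Local Notation V := 'rV[R]_2.
Variables (U : set (Pm * V)) (h : Pm -> V -> R) (Xm Xp W : Pm -> V -> V)
  (z : Pm -> V) (I tau : Pm -> V -> R).
Hypotheses (nu_ge2 : (1 < nu)%N) (nu_even : ~~ odd nu).
Hypotheses (setting : contact_setting nu U h Xm Xp W z)
  (first_int : first_integral h Xm z I) (fb_time : flow_box_time Xm z tau).
Local Notation o3 := ((0 : Pm, 0 : R), 0 : R).
Local Notation o2 := (0 : Pm, 0 : R).

(** The variable s = rho_+ ^ (1 / nu) of the expansion. *)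
Definition scale_of (rho : R) : R := Num.max rho 0 `^ nu%:R^-1.

Lemma scale_of_ge0 rho : 0 <= scale_of rho.
Proof. exact: powR_ge0. Qed.

Lemma scale_of_pos rho : 0 < rho -> 0 < scale_of rho /\ scale_of rho ^+ nu = rho.
Proof.
move=> rho0; have e : Num.max rho 0 = rho by apply/max_l/ltW.
by rewrite /scale_of e powR_gt0// root_powR// ltW.
Qed.

Lemma scale_of_neg rho : rho <= 0 -> scale_of rho = 0.
Proof.
move=> rho0; rewrite /scale_of max_r// powR0// invr_eq0 pnatr_eq0.
by rewrite -lt0n ltnW.
Qed.

Lemma scale_of_lt rho e : 0 < e -> rho < e ^+ nu -> scale_of rho < e.
Proof.
move=> e0 re; have [r0|r0] := lerP rho 0; first by rewrite scale_of_neg.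
have [s0 sE] := scale_of_pos r0; rewrite ltNge; apply/negP => es.
move: re; rewrite -sE ltNge => /negP; apply.
by apply: lerXn2r => //; rewrite nnegrE ltW.
Qed.

(** The first integral passes from s ^ nu to s ^ nu (1 + s A), and c and b at
    the contact turn the value of A at s = 0 into the grazing coefficient. *)
Lemma grazing_box (N : set V) : nbhs (z 0) N ->
  exists (X : (Pm * R) * R -> V) (A : Pm * R -> R) (T d C : R) (S B : set V),
  [/\ [/\ smooth_near o3 X, X o3 = z 0, open B, B (z 0) & B `<=` N],
      smooth_near o2 A /\
        \forall p \near (0 : Pm), A (p, 0) = grazing_coeff nu h Xm W z p,
      [/\ 0 < d, 0 < T & 0 < C],
      forall p : Pm, `|p| < d ->
        (forall x, B x -> flow_coordinates (Xm p) (tau p) (I p) (slice X p) S T x /\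
            (smooth_near (p, x) (joint tau) /\ smooth_near (p, x) (joint I))) /\
        forall t r : R, `|t| < T -> `|r| < T ->
          [/\ tau p (slice X p (t, r)) = t, I p (slice X p (t, r)) = r,
              'D_(1, 0) (slice X p) (t, r) = Xm p (slice X p (t, r)) &
              smooth_near ((p, t), r) X] &
      forall (p : Pm) (rho : R), `|p| < d -> `|rho| < d ->
        exists (te tx : R) (theta Tf rr : R -> R),
          passage (h p) (physical (h p) (Xm p) (Xp p)) (slice X p) B (T / 2)
            rho (rho + scale_of rho ^+ nu.+1 * A (p, scale_of rho))
            (C * scale_of rho) te tx theta Tf rr /\
          forall t, `|rr t| <= 2 * `|rho|].
Proof.
move=> nN.
have [X [E1 [a [b [c [d [T [L [S [B]]]]]]]]]] := local_picture setting first_int fb_time nN.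
cbv zeta => -[geo [sE sa sb sc] [E10 c0 b0] [d0 T0 L0] box].
have k0 : 0 < c (0, 0).
  by rewrite (nbhs_singleton c0) divr_gt0 ?(nbhs_singleton (contact_kappa setting))//
    ltr0n fact_gt0.
have [M [ue [ux [A [wf [[M0 Mbig] sA A0 bl]]]]]] :=
  blow_up (@findim_row R m) nu_ge2 nu_even sE sa sb sc E10 k0.
have [e e0 He] := near_radius (near_ball_prod bl).
pose e1 := Num.min e (T / 2 / M).
have e10 : 0 < e1 by rewrite lt_min e0 !divr_gt0.
pose d1 := Num.min (Num.min d e) (Num.min (e1 ^+ nu) (T / 2)).
exists X, A, T, d1, M, S, B; split=> //.
- split=> //; apply: filterS3 A0 c0 b0 => p -> -> ->.
  by rewrite /grazing_coeff invf_div.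
- by split=> //; rewrite !lt_min d0 e0 exprn_gt0//= divr_gt0.
- move=> p; rewrite !lt_min => /andP[/andP[pd _] _].
  have [fc _ _ fco _] := box p pd; split=> // t r tT rT.
  have [fq sq] := fc (t, r) (conj tT rT).
  by split; [exact: fc_tau fq | exact: fc_I fq | exact: fc_Xm fq | exact: sq].
move=> p rho; rewrite !lt_min => /andP[/andP[pd pe] _] /andP[_ /andP[re1 rT]].
have [fc E1b cb fco Flip] := box p pd.
have rT' : `|rho| < T by apply: lt_trans rT _; rewrite ltr_pdivrMr// ltr_pMr// ltr1n.
have fc' q (bq : `|q.1| < T /\ `|q.2| < T) := proj1 (fc q bq).
have BS : B `<=` S by move=> x /fco[fx _]; exact: fco_S fx.
have Bt x : B x -> `|tau p x| < T / 2 by move=> /fco[fx _]; exact: fco_tau fx.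
have [r0|r0] := lerP rho 0.
  have Trho : - T < rho by move: rT'; rewrite ltr_norml => /andP[].
  have CM : 0 <= M * scale_of rho by rewrite scale_of_neg ?mulr0.
  have [theta [Tf pas]] := passage_inside nu_even T0 L0 k0 fc' E1b cb Flip BS Bt r0 Trho CM.
  exists 0, 0, theta, Tf, (fun=> rho); split; last by move=> t; rewrite ler_peMl// ler1n.
  have -> : rho + scale_of rho ^+ nu.+1 * A (p, scale_of rho) = rho.
    by rewrite scale_of_neg// expr0n mul0r addr0.
  exact: pas.
have [s0 sE'] := scale_of_pos r0; set s := scale_of rho in s0 sE' *.
have se1 : s < e1 by apply: scale_of_lt => //; rewrite -(gtr0_norm r0).
have [se sM] : s < e /\ s < T / 2 / M by apply/andP; rewrite -lt_min.
have [|||[ueI uxI] [Kb Ke] [Km Kx] [Ka [we wx]] dw] := He e _ p s.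
- by rewrite sub0r add0r lexx andbT; lra.
- by rewrite subr0.
- by rewrite subr0 gtr0_norm.
have sMT : s * M < T / 2 by rewrite -ltr_pdivlMr.
have sT : 2 * s ^+ nu < T by rewrite sE' mulrC -ltr_pdivlMr// -(gtr0_norm r0).
have [theta [Tf [rr [pas rrl]]]] := passage_through nu_even T0 L0 k0 fc' E1b cb Flip BS Bt
  M0 Mbig s0 sMT sT ueI uxI Kb Ke Km Kx Ka we wx dw (esym sE') (lexx (M * s)).
exists (s * ue (p, s)), (s * ux (p, s)), theta, Tf, rr; split; first exact: pas.
by move=> t; rewrite (gtr0_norm r0).
Qed.

End GrazingBox.

(** * Excursions between sections *)

Section Orbits.
Variables (R : realType).
Local Notation V := 'rV[R]_2.

Lemma diff_of_is_derive (E : normedModType R) (f : R -> E) (t : R) (l : E) :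
  is_derive t 1 f l -> differentiable f t.
Proof. by move=> [d _]; apply/derivable1_diffP. Qed.

Lemma orbit_shift (E : normedModType R) (B : set E) (F : E -> E) (a b k : R) (phi : R -> E) :
  orbit B F a b phi -> orbit B F (a - k) (b - k) (fun t => phi (t + k)).
Proof.
move=> [ab cphi dphi Bphi].
have cs : continuous (fun t : R => t + k).
  by move=> t; apply: cvgD; [exact: cvg_id | exact: cvg_cst].
split.
- by rewrite lerD2r.
- apply/subspace_continuousP => t; rewrite /= in_itv /= => /andP[t1 t2] N nN.
  have tk : `[a, b]%classic (t + k) by rewrite /= in_itv /=; apply/andP; split; lra.
  have := (proj1 (subspace_continuousP _ _)) cphi (t + k) tk N nN.
  rewrite !nbhs_simpl /= => H; have := near_cont (cs t) H; apply: filterS => u Hu.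
  rewrite /= in_itv /= => /andP[u1 u2]; apply: Hu.
  by rewrite /= in_itv /=; apply/andP; split; lra.
- move=> t /andP[t1 t2].
  have d0 : is_derive t 1 (fun t : R => t + k) (1 : R).
    by apply: (is_derive_eq (is_deriveD (is_derive_id t (1 : R)) (is_derive_cst k t (1 : R)))); rewrite addr0.
  have tk : a < t + k < b by apply/andP; split; lra.
  have d1 := dphi (t + k) tk.
  have [dsh Dsh] := derive_comp1 (1 : R) (diff_of_is_derive d0) (diff_of_is_derive d1).
  apply: DeriveDef; first exact: diff_derivable.
  by rewrite Dsh; case: d0 => _ ->; case: d1 => _ ->.
- by move=> t /andP[t1 t2]; apply: Bphi; apply/andP; split; lra.
Qed.

(** Applied to tau, with c = 1, and to I, with c = 0. *)
Lemma orbit_Lie (B : set V) (F : V -> V) (f : V -> R) (c a b : R) (phi : R -> V) :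
  (forall x, B x -> differentiable f x /\ Lie F f x = c) -> orbit B F a b phi ->
  forall t, a <= t <= b -> f (phi t) = f (phi a) + c * (t - a).
Proof.
move=> Bf [ab cphi dphi Bphi] t tI.
pose g (t : R) := f (phi t) - c * (t - a).
suff H : g t = g a.
  by move: H; rewrite /g subrr mulr0 subr0 => <-; rewrite subrK.
apply: (is_derive0_cst _ _ tI).
- move=> u uI.
  have uI' : a <= u <= b by case/andP: uI => *; apply/andP; split; exact: ltW.
  have [df Lf] := Bf _ (Bphi u uI'); have du := dphi u uI.
  have dphu := diff_of_is_derive du.
  have [d1 D1] := derive_comp1 (1 : R) dphu df.
  have dfp : is_derive u 1 (fun t => f (phi t)) c.
    apply: DeriveDef; first exact: diff_derivable.
    by rewrite D1 derive_val deriveE.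
  have dl : is_derive u 1 (fun t : R => c * (t - a)) c.
    apply: (is_derive_eq (is_deriveZ c (is_deriveB (is_derive_id u (1 : R)) (is_derive_cst a u (1 : R))))).
    by rewrite subr0 [LHS]mulr1.
  by apply: (is_derive_eq (is_deriveB dfp dl)); rewrite subrr.
- apply/subspace_continuousP => u uab.
  have uI : a <= u <= b by move: uab; rewrite /= in_itv.
  have [df _] := Bf _ (Bphi u uI).
  have cphu := (proj1 (subspace_continuousP _ _)) cphi u uab.
  apply: cvgB; first exact: (cvg_comp _ _ cphu (differentiable_continuous df)).
  apply: cvg_within_filter.
  have sc : smooth_near u (fun t : R => c * (t - a)) by smooth_tac.
  exact: smooth_near_cont sc.
Qed.

End Orbits.

Section Transversality.
Variables (R : realType) (m : nat).
Local Notation Pm := 'rV[R]_m.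
Local Notation V := 'rV[R]_2.

Lemma flow_line (B : set V) (F : V -> V) (Y : R * R -> V) (t0 t1 r : R) : t0 <= t1 ->
  (forall t, t0 <= t <= t1 ->
    [/\ differentiable Y (t, r), 'D_(1, 0) Y (t, r) = F (Y (t, r)) & B (Y (t, r))]) ->
  orbit B F t0 t1 (fun t => Y (t, r)).
Proof.
move=> t01 H.
have d t : t0 <= t <= t1 -> is_derive t 1 (fun t => Y (t, r)) (F (Y (t, r))).
  move=> /H[dY <- _].
  have di : differentiable (fun u : R => u) t by apply: smooth_diff; smooth_tac.
  have [d1 D1] := derive_comp_pair (1 : R) di (differentiable_cst r t) dY.
  apply: DeriveDef; first exact: diff_derivable.
  by rewrite D1 derive_id derive_cst.
split=> //.
- apply: within_cont => t tI; apply: differentiable_continuous; exact: diff_of_is_derive (d t tI).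
- by move=> t /andP[a b]; apply: d; rewrite !ltW.
- by move=> t /H[].
Qed.

(** With L = dI and x = Xm: I has a nonzero derivative along any curve
    transverse to Xm. *)
Lemma free_pair_lin (L : V -> R) (x v w : V) : linear L -> free [:: x; v] ->
  L x = 0 -> L w != 0 -> L v != 0.
Proof.
move=> linL fr Lx; apply: contra => /eqP Lv; apply/eqP.
have L0 : L 0 = 0 by have := linL (-1) 0 0; rewrite scaler0 addr0 scaleN1r addNr.
have bas : basis_of {:V} [:: x; v].
  by rewrite basisEfree fr subvf dimvf /dim /=.
have := coord_basis bas (memvf w); rewrite big_ord_recl big_ord1 /= => ->.
by rewrite linL Lx scaler0 add0r -[X in L X]addr0 linL Lv scaler0 L0 addr0.
Qed.

(** g 0 takes values of opposite signs on either side of 0; the signs persist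
    for p near 0 and survive the subtraction of a small rho, so that the
    intermediate value theorem applies at distance less than r. *)
Lemma crossing (g : Pm -> R -> R) (r : R) : smooth_near (0, 0) (joint g) -> g 0 0 = 0 ->
  'D_1 (g 0) 0 != 0 -> 0 < r ->
  exists2 d : R, 0 < d & forall (p : Pm) (rho : R), `|p| < d -> `|rho| < d ->
    exists2 u : R, `|u| < r & g p u = rho.
Proof.
move=> sg g0 l0 r0; set l := 'D_1 (g 0) 0 in l0 *.
have [e e0 He] := near_radius (near_ball_prod (smooth_near_near sg)).
have se p u : `|p| < e -> `|u| < e -> smooth_near (p, u) (joint g).
  move=> pe ue; apply: (He e); rewrite ?subr0//.
  by rewrite sub0r add0r lexx andbT; lra.
have z0 : `|0 : Pm| < e by rewrite normr0.
have sl p u : smooth_near (p, u) (joint g) -> {for u, continuous (g p)}.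
  by move=> /smooth_diff /diff_partial[/differentiable_continuous].
have dg : is_derive (0 : R) 1 (g 0) l.
  apply: DeriveDef => //; apply: diff_derivable.
  by have [] := diff_partial (smooth_diff sg).
have l2 : 0 < `|l| / 2 by rewrite divr_gt0 ?normr_gt0.
have [e1 e10 He1] := near_radius ((proj1 (is_derive_epsP _ _ _)) dg _ l2).
pose v := Num.min (Num.min (r / 2) (e / 2)) e1.
have v0 : 0 < v by rewrite !lt_min !divr_gt0.
have [vr ve ve1] : [/\ v < r, v < e & v <= e1].
  split; [| |by rewrite /v ge_min lexx orbT].
  - by apply: le_lt_trans (_ : r / 2 < r); [rewrite /v !ge_min lexx | lra].
  - by apply: le_lt_trans (_ : e / 2 < e); [rewrite /v !ge_min lexx orbT | lra].
have sgn u : `|u| <= e1 -> `|l * g 0 u - u * l ^+ 2| <= l ^+ 2 / 2 * `|u|.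
  rewrite ler_norml => uI; have := He1 u; rewrite sub0r add0r => /(_ uI).
  rewrite g0 !subr0 => H.
  have -> : l * g 0 u - u * l ^+ 2 = l * (g 0 u - u * l) by ring.
  rewrite normrM -(real_normK (num_real l)) expr2 -mulrA -mulrA.
  by rewrite ler_pM2l ?normr_gt0// mulrA.
have l20 : 0 < l ^+ 2 by rewrite exprn_even_gt0.
have Gv : 0 < l * g 0 v.
  have := sgn v; rewrite gtr0_norm// => /(_ ve1); rewrite ler_norml => /andP[H _].
  have : 0 < v * l ^+ 2 by rewrite mulr_gt0.
  by rewrite mulrC in H *; nra.
have GNv : l * g 0 (- v) < 0.
  have := sgn (- v); rewrite normrN gtr0_norm// => /(_ ve1); rewrite ler_norml => /andP[_ H].
  have : 0 < v * l ^+ 2 by rewrite mulr_gt0.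
  by nra.
have cG u : `|u| < e -> {for (0 : Pm, 0 : R), continuous (fun z : Pm * R => l * g z.1 u - l * z.2)}.
  move=> ue; have sg1 : smooth_near ((0 : Pm), (0 : R)) (fun z : Pm * R => g z.1 u).
    have fP := findim_prod (@findim_row R m) (@findim_real R).
    apply: (@smooth_comp _ _ _ _ (fun z : Pm * R => (z.1, u)) (joint g)) => //; last exact: se.
    by smooth_tac.
  have s : smooth_near ((0 : Pm), (0 : R)) (fun z : Pm * R => l * g z.1 u - l * z.2).
    by smooth_by ltac:(first [exact: sg1]).
  exact: smooth_near_cont s.
have n1 : \forall z \near ((0 : Pm), (0 : R)), 0 < l * g z.1 v - l * z.2.
  by apply: near_gt0; [apply: cG; rewrite gtr0_norm | rewrite /= mulr0 subr0].
have n2 : \forall z \near ((0 : Pm), (0 : R)), l * g z.1 (- v) - l * z.2 < 0.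
  by apply: near_lt0; [apply: cG; rewrite normrN gtr0_norm | rewrite /= mulr0 subr0].
have [e2 e20 He2] := near_radius (near_ball_prod (filterI n1 n2)).
exists (Num.min e e2); first by rewrite lt_min e0.
move=> p rho; rewrite !lt_min => /andP[pe pe2] /andP[_ re2].
have [|||G1 G2] := He2 e2 _ p rho; rewrite ?subr0//.
  by rewrite sub0r add0r lexx andbT; lra.
have [|||u] := @IVT R (fun u => l * g p u) (- v) v (l * rho).
- by lra.
- apply: within_cont => u uI; apply: cvgM; first exact: cvg_cst.
  by apply: sl; apply: se => //; apply: le_lt_trans ve; rewrite ler_norml.
- rewrite ge_min le_max; apply/andP; split; apply/orP; [left|right]; rewrite /= in G1 G2; lra.
rewrite in_itv /= => uI ug; exists u.
  by apply: le_lt_trans vr; rewrite ler_norml.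
exact: (mulfI l0).
Qed.

End Transversality.

Section Excursion.
Variables (R : realType).
Local Notation V := 'rV[R]_2.
Variables (h : V -> R) (Xm Xp : V -> V) (tau I : V -> R) (Y : R * R -> V) (S B : set V) (T : R).
Let F := physical h Xm Xp.
Hypotheses (T0 : 0 < T)
  (coords : forall x, B x -> flow_coordinates Xm tau I Y S T x)
  (chart : forall t r : R, `|t| < T -> `|r| < T ->
    [/\ tau (Y (t, r)) = t, I (Y (t, r)) = r, 'D_(1, 0) Y (t, r) = Xm (Y (t, r)) &
        differentiable Y (t, r)]).

Lemma reference_orbit (a b : R) phi : orbit B Xm a b phi -> forall t, a <= t <= b ->
  [/\ tau (phi t) = tau (phi a) + (t - a), I (phi t) = I (phi a) &
      Y (tau (phi t), I (phi t)) = phi t].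
Proof.
move=> o t tI; have [_ _ _ Bphi] := o.
have Lt x : B x -> differentiable tau x /\ Lie Xm tau x = 1.
  by move=> /coords co; split; [exact: fco_dtau co | exact: fco_Lie_tau co].
have LI x : B x -> differentiable I x /\ Lie Xm I x = 0.
  by move=> /coords co; split; [exact: fco_dI co | exact: fco_Lie_I co].
split; last exact: fco_chart (coords (Bphi t tI)).
  by rewrite (orbit_Lie Lt o tI) mul1r.
by rewrite (orbit_Lie LI o tI) mul0r addr0.
Qed.

Variables (rho rx C te tx : R) (theta Tf rr : R -> R).
Hypothesis pas : passage h F Y B (T / 2) rho rx C te tx theta Tf rr.

Let theta_lt s t : - (T / 2) <= s <= T / 2 -> - (T / 2) <= t <= T / 2 ->
  (theta s < theta t) = (s < t).
Proof.
have mono u v : - (T / 2) <= u <= T / 2 -> - (T / 2) <= v <= T / 2 -> u < v -> theta u < theta v.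
  move=> /andP[u1 _] /andP[_ v2] uv; have /andP[m _] := pas_mono pas u1 (ltW uv) v2.
  by rewrite -subr_gt0; apply: lt_le_trans m; rewrite mulr_gt0 ?subr_gt0.
move=> sI tI; apply/idP/idP; last exact: mono.
by move=> st; rewrite ltNge le_eqVlt; apply/negP => /predU1P[e|/mono]; move: st;
  [rewrite e ltxx | move=> st /(_ tI sI); rewrite ltNge (ltW st)].
Qed.

Let theta_inj s t : - (T / 2) <= s <= T / 2 -> - (T / 2) <= t <= T / 2 ->
  theta s = theta t -> s = t.
Proof. by move=> sI tI e; rewrite -(pas_Tf pas sI) e (pas_Tf pas tI). Qed.

Variables (lo hi eta : R) (Sin Sout : set V).
Hypotheses (eta_T : eta <= T) (rr_small : forall t, `|rr t| < eta)
  (tube : forall t r, lo <= t <= hi -> `|r| < eta -> B (Y (t, r)))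
  (inS : forall x, Sin x -> B x /\ lo <= tau x < te)
  (outS : forall y, Sout y -> B y /\ tx < tau y <= hi).

Let rr_T t : `|rr t| < T. Proof. exact: lt_le_trans (rr_small t) eta_T. Qed.

Let half_T t : - (T / 2) <= t <= T / 2 -> `|t| < T.
Proof.
move=> tI; apply: (@le_lt_trans _ _ (T / 2)); first by rewrite ler_norml.
by rewrite ltr_pdivrMr// ltr_pMr// ltr1n.
Qed.

Let tau_half x : B x -> - (T / 2) < tau x < T / 2.
Proof. by move=> /coords/fco_tau; rewrite ltr_norml. Qed.

(** The orbit of the passage, cut off at the outgoing section, stays in B since
    its chart coordinates stay in the tube. *)
Lemma excursion (x y : V) : Sin x -> I x = rho -> Sout y -> I y = rx ->
  [/\ orbit B F (tau x) (theta (tau y)) (fun s => Y (Tf s, rr (Tf s))),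
      Y (Tf (tau x), rr (Tf (tau x))) = x,
      Y (Tf (theta (tau y)), rr (Tf (theta (tau y)))) = y &
      tau x < theta tx < theta (tau y)].
Proof.
move=> /inS[Bx /andP[lox xte]] Ix /outS[By /andP[txy yhi]] Iy.
have /andP[x1 x2] := tau_half Bx; have /andP[y1 y2] := tau_half By.
have tex := pas_le pas.
have xI : - (T / 2) <= tau x <= T / 2 by rewrite !ltW.
have yI : - (T / 2) <= tau y <= T / 2 by rewrite !ltW.
have thx : theta (tau x) = tau x by rewrite (pas_theta pas)// !ltW.
have xtx : tau x < tx by apply: lt_le_trans tex.
have xy : tau x < tau y by apply: lt_trans txy.
have txI : - (T / 2) <= tx <= T / 2.
  by rewrite (ltW (lt_trans x1 xtx)) (ltW (lt_trans txy y2)).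
have loI : - (T / 2) <= - (T / 2) <= T / 2 by rewrite lexx /= (le_trans (ltW x1) (ltW x2)).
have hiI : - (T / 2) <= T / 2 <= T / 2 by rewrite lexx andbT (le_trans (ltW x1) (ltW x2)).
have thlt : tau x < theta tx < theta (tau y).
  by rewrite -{1}thx !theta_lt// xtx.
have [_ cphi dphi _] := pas_orbit pas.
have o : orbit setT F (tau x) (theta (tau y)) (fun s => Y (Tf s, rr (Tf s))).
  apply: orbit_sub (pas_orbit pas) _ _ _.
  - by rewrite -thx ltW// theta_lt.
  - by have /andP[a1 a2] := thlt; rewrite ltW// (lt_trans a1).
  - by rewrite ltW// theta_lt.
split=> //.
- have [n1 n2 n3 _] := o; split=> // s /andP[s1 s2].
  have sI : theta (- (T / 2)) <= s <= theta (T / 2).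
    apply/andP; split.
      by apply: le_trans s1; rewrite -thx ltW// theta_lt.
    by apply: le_trans s2 _; rewrite ltW// theta_lt.
  have [TfI thTf] := pas_inv pas sI.
  apply: tube; last exact: rr_small.
  apply/andP; split; rewrite leNgt; apply/negP => k.
    have : theta (Tf s) < theta (tau x) by rewrite theta_lt//; apply: lt_le_trans lox.
    by rewrite thTf thx ltNge s1.
  have : theta (tau y) < theta (Tf s) by rewrite theta_lt//; apply: le_lt_trans k.
  by rewrite thTf ltNge s2.
- rewrite -{1 2}thx (pas_Tf pas xI) (pas_before pas) 1?ltW// -Ix.
  exact: fco_chart (coords Bx).
- rewrite (pas_Tf pas yI) (pas_after pas) 1?ltW// -Iy.
  exact: fco_chart (coords By).
Qed.

(** Uniqueness of orbits: the point reached at any time is on the graph of rr. *)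
Lemma physical_orbit_at (x : V) (a b : R) phi : Sin x -> I x = rho ->
  orbit B F a b phi -> a <= tau x <= b -> phi (tau x) = x ->
  forall t, a <= t <= b -> exists u,
    [/\ - (T / 2) <= u <= T / 2, t = theta u, phi t = Y (u, rr u) & tau (phi t) = u].
Proof.
move=> /inS[Bx /andP[_ xte]] Ix o abx phx t tI.
have /andP[x1 x2] := tau_half Bx.
have xI : - (T / 2) <= tau x <= te by rewrite !ltW.
have phx' : phi (tau x) = Y (tau x, rho) by rewrite phx -Ix (fco_chart (coords Bx)).
have [a1 b1 E] := pas_unique pas xI o abx phx'.
have [a2 b2] := andP tI.
have [TfI thTf] := pas_inv pas (introT andP (conj (le_trans a1 a2) (le_trans b2 b1))).
exists (Tf t); split=> //; first exact: E.
by rewrite E//; have [] := chart (half_T TfI) (rr_T (Tf t)).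
Qed.

Lemma grazing_passage (x : V) : 0 < rho -> Sin x -> I x = rho ->
  (exists2 y, Sout y & I y = rx) ->
  one_grazing_passage B Sout h F tau x (5 * C).
Proof.
move=> rho0 Sx Ix [y Sy Iy].
have [ophi0 ox oy /andP[n1 n2]] := excursion Sx Ix Sy Iy.
have [lt_te_tx sgn] := pas_sign pas rho0.
have [Bx /andP[_ xte]] := inS Sx; have [By /andP[txy _]] := outS Sy.
have /andP[x1 x2] := tau_half Bx; have /andP[y1 y2] := tau_half By.
have teI : - (T / 2) <= te <= T / 2.
  by rewrite (ltW (lt_trans x1 xte)) (ltW (lt_trans (lt_trans lt_te_tx txy) y2)).
have txI : - (T / 2) <= tx <= T / 2.
  by rewrite (ltW (lt_trans x1 (lt_trans xte lt_te_tx))) (ltW (lt_trans txy y2)).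
have thte : theta te = te by rewrite (pas_theta pas)// lexx andbT; case/andP: teI.
have teC := pas_te pas; have txC := pas_tx pas.
have C0 : 0 <= C by apply: le_trans teC.
have thtxC : `|theta tx| <= 5 * C.
  have [[t1 _] [_ t2]] := (andP teI, andP txI).
  have /andP[m1 m2] := pas_mono pas t1 (ltW lt_te_tx) t2.
  rewrite thte in m1 m2; move: teC txC; rewrite !ler_norml.
  by move=> /andP[? ?] /andP[? ?]; apply/andP; split; lra.
have [e1 e2] : `|te| <= 5 * C /\ `|tx| <= 5 * C by split; lra.
exists te, (theta tx); split=> //.
- by rewrite xte /= -thte theta_lt.
- by exists (theta (tau y)), (fun s => Y (Tf s, rr (Tf s))); split=> //; rewrite oy.
move=> a b phi ophi abx phx t tI.
have [u [uI tE phE tauE]] := physical_orbit_at Sx Ix ophi abx phx tI.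
have [s1 s2] := sgn u uI.
rewrite tauE phE tE; split.
- by rewrite -{1}thte !theta_lt.
- split.
    by move=> /s2[->|->]; [left|right].
  by rewrite -{1}thte => -[/theta_inj|/theta_inj] H; apply/s2; [left|right]; exact: H.
- by move=> /s2[->|->].
Qed.

(** Existence is [excursion]. Conversely a physical orbit from x to the
    outgoing section is that of the passage; its end has flow-box time beyond
    tx, where the first integral is rx. *)
Lemma displacement (d : R) : (exists2 x, Sin x & I x = rho) ->
  (exists2 y, Sout y & I y = rho) -> (exists2 y, Sout y & I y = rx) ->
  is_displacement B Sin Sout h Xm Xp I rho d <-> d = rx - rho.
Proof.
move=> [x Sx Ix] [yr Syr Iyr] [yp Syp Iyp]; split; last first.
  move=> ->; exists x, yp, yr; rewrite Iyp Iyr.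
  have [orb ox oy /andP[n1 n2]] := excursion Sx Ix Syp Iyp.
  have [Bx /andP[lox xte]] := inS Sx; have [By /andP[txy yhi]] := outS Syr.
  have /andP[x1 x2] := tau_half Bx; have /andP[y1 y2] := tau_half By.
  have xy : tau x < tau yr by apply: lt_trans xte (le_lt_trans (pas_le pas) txy).
  have rhoE : rr (tau x) = rho by rewrite (pas_before pas)// ltW.
  have rho_eta : `|rho| < eta by rewrite -rhoE.
  split=> //.
    split=> //; exists (tau x), (theta (tau yp)), (fun s => Y (Tf s, rr (Tf s))); split=> //.
    exact: lt_trans n1 n2.
  split=> //; exists (tau x), (tau yr), (fun t => Y (t, rho)); split=> //.
  - apply: flow_line; first exact: ltW.
    move=> t /andP[t1 t2].
    have tT : `|t| < T by apply: half_T; apply/andP; split; lra.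
    have [_ _ DY dY] := chart tT (lt_le_trans rho_eta eta_T).
    split=> //; apply: tube => //; apply/andP; split; lra.
  - by rewrite -Ix (fco_chart (coords Bx)).
  - by rewrite -Iyr (fco_chart (coords By)).
move=> [x' [yp' [yr' [[Sx' Ix'] [Syp' [a [b [phi [ab ophi phia phib]]]]]
  [Syr' [a' [b' [psi [ab' opsi psia psib]]]]] ->]]]].
congr (_ - _).
  pose k := a - tau x'.
  have osh := orbit_shift k ophi.
  have aE : a - k = tau x' by rewrite /k; lra.
  have bI : a - k <= b - k <= b - k by rewrite lexx andbT lerD2r ltW.
  have xI : a - k <= tau x' <= b - k by rewrite -aE lexx lerD2r ltW.
  have phx : phi (tau x' + k) = x' by rewrite -aE subrK.
  have [u [uI tE]] := physical_orbit_at Sx' Ix' osh xI phx bI.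
  rewrite /= subrK phib => yE tauE.
  have [_ /andP[txy _]] := outS Syp'.
  have [_ -> _ _] : [/\ tau yp' = u, I yp' = rr u, True & True].
    by rewrite yE; have [? ? _ _] := chart (half_T uI) (rr_T u).
  by rewrite (pas_after pas)// -tauE ltW.
have bI : a' <= b' <= b' by rewrite lexx andbT ltW.
by have [_ E _] := reference_orbit opsi bI; rewrite -psib E psia.
Qed.

End Excursion.

Section Sections.
Variables (R : realType) (m : nat).
Local Notation Pm := 'rV[R]_m.
Local Notation V := 'rV[R]_2.
Variables (Xm : Pm -> V -> V) (z : Pm -> V) (I tau : Pm -> V -> R)
  (X : (Pm * R) * R -> V) (S B : set V) (T d : R).
Hypotheses (T0 : 0 < T) (d0 : 0 < d) (Xz : X ((0, 0), 0) = z 0) (oB : open B)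
  (coords : forall p, `|p| < d -> forall x, B x ->
     flow_coordinates (Xm p) (tau p) (I p) (slice X p) S T x /\
     (smooth_near (p, x) (joint tau) /\ smooth_near (p, x) (joint I)))
  (chart : forall p, `|p| < d -> forall t r : R, `|t| < T -> `|r| < T ->
     [/\ tau p (slice X p (t, r)) = t, I p (slice X p (t, r)) = r,
         'D_(1, 0) (slice X p) (t, r) = Xm p (slice X p (t, r)) &
         smooth_near ((p, t), r) X]).

Let p0 : `|0 : Pm| < d. Proof. by rewrite normr0. Qed.
Let r0 : `|0 : R| < T. Proof. by rewrite normr0. Qed.
Let coords0 x (Bx : B x) := proj1 (coords p0 Bx).
Let fPR := findim_prod (@findim_row R m) (@findim_real R).

Let z_coords : tau 0 (z 0) = 0 /\ I 0 (z 0) = 0.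
Proof. by have [t i _ _] := chart p0 r0 r0; rewrite -Xz. Qed.

(** At p = 0 the orbit from the section to the contact is a segment of the
    line r = 0 of the chart, which therefore lies in B. *)
Lemma incoming_position (x : V) : reaches B (Xm 0) x (z 0) -> exists t : R,
  [/\ 0 < t < T, x = X ((0, - t), 0), B x &
      forall u : R, - t <= u <= 0 -> B (X ((0, u), 0))].
Proof.
move=> [a [b [phi [ab o phia phib]]]]; have [_ _ _ Bphi] := o.
have ref := reference_orbit coords0 o.
have aI : a <= a <= b by rewrite lexx ltW.
have bI : a <= b <= b by rewrite lexx ltW.
have [tz Iz] := z_coords.
have [tb Ib _] := ref b bI; rewrite phib tz in tb; rewrite phib Iz in Ib.
have E u : a - b <= u <= 0 -> B (X ((0, u), 0)) /\ phi (u + b) = X ((0, u), 0).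
  move=> /andP[u1 u2]; have uI : a <= u + b <= b by apply/andP; split; lra.
  have [tu Iu <-] := ref _ uI.
  have -> : X ((0, u), 0) = slice X 0 (tau 0 (phi (u + b)), I 0 (phi (u + b))).
    by rewrite Iu -Ib tu /slice /=; congr (X ((_, _), _)); lra.
  by split=> //; have [_ _ ->] := ref _ uI; exact: Bphi.
have Bx := Bphi a aI; rewrite phia in Bx.
exists (b - a); split=> //.
- rewrite subr_gt0 ab /=; have := fco_tau (coords0 Bx).
  have -> : tau 0 x = a - b by rewrite -phia; lra.
  rewrite distrC gtr0_norm ?subr_gt0// => lt; apply: lt_trans lt _.
  by rewrite ltr_pdivrMr// ltr_pMr// ltr1n.
- have abI : a - b <= a - b <= 0 by rewrite lexx subr_le0 ltW.
  by rewrite opprB -phia; have [_ <-] := E _ abI; rewrite subrK.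
- by rewrite opprB => u uI; have [] := E u uI.
Qed.

Lemma outgoing_position (x : V) : reaches B (Xm 0) (z 0) x -> exists t : R,
  [/\ 0 < t < T, x = X ((0, t), 0), B x &
      forall u : R, 0 <= u <= t -> B (X ((0, u), 0))].
Proof.
move=> [a [b [phi [ab o phia phib]]]]; have [_ _ _ Bphi] := o.
have ref := reference_orbit coords0 o.
have bI : a <= b <= b by rewrite lexx ltW.
have [tz Iz] := z_coords.
have E u : 0 <= u <= b - a -> B (X ((0, u), 0)) /\ phi (u + a) = X ((0, u), 0).
  move=> /andP[u1 u2]; have uI : a <= u + a <= b by apply/andP; split; lra.
  have [tu Iu <-] := ref _ uI.
  have -> : X ((0, u), 0) = slice X 0 (tau 0 (phi (u + a)), I 0 (phi (u + a))).
    by rewrite Iu tu phia tz Iz /slice /=; congr (X ((_, _), _)); lra.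
  by split=> //; have [_ _ ->] := ref _ uI; exact: Bphi.
have Bx := Bphi b bI; rewrite phib in Bx.
exists (b - a); split=> //.
- rewrite subr_gt0 ab /=; have := fco_tau (coords0 Bx).
  have [tb _ _] := ref b bI; rewrite -phib tb phia tz add0r.
  rewrite gtr0_norm ?subr_gt0// => lt; apply: lt_trans lt _.
  by rewrite ltr_pdivrMr// ltr_pMr// ltr1n.
- have baI : 0 <= b - a <= b - a by rewrite lexx subr_ge0 ltW.
  by rewrite -phib; have [_ <-] := E _ baI; rewrite subrK.
- by move=> u uI; have [] := E u uI.
Qed.

(** The margin e is for the sections at p <> 0, which are crossed a little
    earlier or later than t0 and t1. *)
Lemma tube_around (t0 t1 : R) : - T < t0 -> t1 < T ->
  (forall t, t0 <= t <= t1 -> B (X ((0, t), 0))) -> t0 <= t1 ->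
  exists2 e : R, 0 < e & forall p t r, `|p| < e -> t0 - e <= t <= t1 + e -> `|r| < e ->
    B (slice X p (t, r)).
Proof.
move=> Tt0 t1T Bt t01.
have nq t : t0 <= t <= t1 -> \forall q \near ((0 : Pm, t), 0 : R), B (X q).
  move=> tI; have [t2 t3] := andP tI.
  have tT : `|t| < T by rewrite ltr_norml; apply/andP; split; lra.
  have [_ _ _ sX] := chart p0 tT r0.
  exact: near_cont (smooth_near_cont sX) (near_open oB (Bt t tI) (fun y By => By)).
have end_ t : t0 <= t <= t1 -> exists2 e : R, 0 < e & forall p u r, `|p| < e ->
    `|u - t| < e -> `|r| < e -> B (slice X p (u, r)).
  move=> /nq H; have [e e0 He] := near_radius (near_ball_prod H); exists e => // p u r pe ue re.
  apply: (He e) => //; rewrite ?subr0//; first by rewrite sub0r add0r lexx andbT; lra.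
  by rewrite [ltLHS](_ : _ = Num.max `|p - 0| `|u - t|)// gt_max subr0 pe.
have [e0 e00 H0] := end_ t0 (introT andP (conj (lexx _) t01)).
have [e1 e10 H1] := end_ t1 (introT andP (conj t01 (lexx _))).
have : \forall pr \near ((0 : Pm), (0 : R)), forall t, t0 <= t <= t1 -> B (X ((pr.1, t), pr.2)).
  apply: (tube_seg (P := fun (pr : Pm * R) t => B (X ((pr.1, t), pr.2)))) => t /nq H.
  have s : smooth_near (((0 : Pm), (0 : R)), t) (fun y : (Pm * R) * R => ((y.1.1, y.2), y.1.2)).
    by smooth_tac.
  exact: near_cont (smooth_near_cont s) H.
move=> /near_ball_prod/near_radius[e2 e20 H2].
exists (Num.min (Num.min (e0 / 2) (e1 / 2)) e2); first by rewrite !lt_min !divr_gt0.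
set e := Num.min _ _.
have [ee0 ee1 ee2] : [/\ e <= e0 / 2, e <= e1 / 2 & e <= e2].
  by rewrite /e !ge_min !lexx !orbT.
move=> p t r pe /andP[t2 t3] re.
have [k|k] := ltrP t t0.
  by apply: H0; [lra | rewrite ltr_norml; apply/andP; split; lra | lra].
have [k'|k'] := ltrP t1 t.
  by apply: H1; [lra | rewrite ltr_norml; apply/andP; split; lra | lra].
apply: (H2 e2 _ p r); rewrite ?subr0 ?k ?k'//; [|lra|lra].
by rewrite sub0r add0r lexx andbT; lra.
Qed.

Variables (sigma : Pm -> R -> V) (ts : R).
Hypotheses (trans : transverse_section Xm sigma) (tsT : `|ts| < T)
  (sE : sigma 0 0 = X ((0, ts), 0)) (Bs : B (sigma 0 0)).

Lemma section_near (e : R) : 0 < e -> exists2 r : R, 0 < r & forall p u,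
  `|p| < r -> `|u| < r -> B (sigma p u) /\ `|tau p (sigma p u) - ts| < e.
Proof.
move=> e0; have [ss _] := trans; have [_ [st _]] := coords p0 Bs.
have [tE _ _ _] := chart p0 tsT r0.
have n1 : \forall q \near ((0 : Pm), (0 : R)), B (sigma q.1 q.2).
  exact: near_cont (smooth_near_cont ss) (near_open oB Bs (fun y By => By)).
have s2 : smooth_near ((0 : Pm), (0 : R)) (fun q => joint tau (q.1, joint sigma q)).
  apply: (@smooth_comp _ _ _ _ (fun q : Pm * R => (q.1, joint sigma q)) (joint tau)) => //.
    exact: findim_prod (@findim_row R m) (@findim_row R 2).
  by smooth_by ltac:(first [exact: ss]).
have n2 := near_dist (smooth_near_cont s2) e0.
have [r r1 H] := near_radius (near_ball_prod (filterI n1 n2)).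
exists r => // p u pr ur; have [||| /= b] := H r _ p u; rewrite ?subr0//.
  by rewrite sub0r add0r lexx andbT; lra.
by rewrite /joint /= sE [tau 0 _]tE.
Qed.

(** By transversality I is a coordinate along the section. *)
Lemma section_crossing (r : R) : 0 < r -> exists2 d' : R, 0 < d' & forall p rho,
  `|p| < d' -> `|rho| < d' -> exists2 x, section_of_size sigma r p x & I p x = rho.
Proof.
move=> r1; have [ss fr] := trans; have [co [_ sI]] := coords p0 Bs.
have [_ IE _ sX] := chart p0 tsT r0.
have sg : smooth_near ((0 : Pm), (0 : R)) (joint (fun p u => I p (sigma p u))).
  apply: (@smooth_comp _ _ _ _ (fun q : Pm * R => (q.1, joint sigma q)) (joint I)) => //.
    exact: findim_prod (@findim_row R m) (@findim_row R 2).
  by smooth_by ltac:(first [exact: ss]).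
have g0 : I 0 (sigma 0 0) = 0 by rewrite sE.
have [dI _] := diff_partial (smooth_diff sI).
have [ds _] := diff_partial (smooth_diff ss).
have [_ Dg] := derive_comp1 (1 : R) ds dI.
have [dY _] := derive_slice (q := (ts, 0)) (smooth_diff sX).
have Lw : 'd (I 0) (sigma 0 0) ('D_(0, 1) (slice X 0) (ts, 0)) != 0.
  have dI' : differentiable (I 0) (slice X 0 (ts, 0)) by rewrite -[slice _ _ _]sE.
  have [_ E] := derive_comp1 ((0, 1) : R * R) dY dI'.
  rewrite sE -[X _]/(slice X 0 (ts, 0)) -deriveE// -E.
  have -> : 'D_((0, 1) : R * R) (fun y => I 0 (slice X 0 y)) (ts, 0) =
      'D_((0, 1) : R * R) (fun y : R * R => y.2) (ts, 0).
    apply: near_eq_derive.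
    have n1 : \forall y \near ((ts, 0) : R * R), `|y.1| < T.
      have : \forall y \near ((ts, 0) : R * R), `|y.1| - T < 0.
        apply: near_lt0; last by rewrite subr_lt0.
        apply: cvgB; last exact: cvg_cst.
        by apply: cvg_norm; exact: smooth_near_cont (smooth_fst _).
      by apply: filterS => y; rewrite subr_lt0.
    have n2 : \forall y \near ((ts, 0) : R * R), `|y.2| < T.
      have := near_dist (smooth_near_cont (smooth_snd ((ts, 0) : R * R))) T0.
      by apply: filterS => y /=; rewrite subr0.
    apply: filterS2 n1 n2 => -[t r'] /= tT rT.
    by have [_ ->] := chart p0 tT rT.
  by rewrite derive_snd oner_eq0.
have l0 : 'D_1 (fun u => I 0 (sigma 0 u)) 0 != 0.
  rewrite Dg deriveE//.
  apply: (free_pair_lin (L := 'd (I 0) (sigma 0 0)) _ (nbhs_singleton fr) _ Lw).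
    exact: linearP.
  exact: fco_Lie_I co.
have [d' d'0 H] := crossing sg g0 l0 r1.
exists d' => // p rho pd rd; have [u ur uE] := H p rho pd rd.
by exists (sigma p u) => //; exists u.
Qed.

End Sections.

(** * The grazing displacement *)

Lemma smooth_near_uniform (R : realType) (E F : normedModType R) (p0 : E) (A : E * R -> F) :
  smooth_near (p0, 0) A -> exists2 e : R, 0 < e & forall (p : E) (s : R),
    `|p - p0| < e -> `|s| < e -> smooth_near (p, s) A.
Proof.
move=> sA; have [e e0 He] := near_radius (near_ball_prod (smooth_near_near sA)).
exists e => // p s pe se; apply: (He e); rewrite ?subr0//.
by rewrite sub0r add0r lexx andbT; lra.
Qed.

(** The swap of (p, s) turns germs at the origin into functions on the
    one-sided domain. *)
Lemma smooth_within_swap (R : realType) (m nu : nat) (A : 'rV[R]_m * R -> R) (e delta : R) :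
  (1 < nu)%N -> 0 < e -> delta <= e -> delta <= e ^+ nu ->
  (forall (p : 'rV[R]_m) (s : R), `|p| < e -> `|s| < e -> smooth_near (p, s) A) ->
  smooth_within [set q : R * 'rV[R]_m |
    [/\ 0 <= q.1, q.1 ^+ nu < delta & `|q.2| < delta]] (joint (fun s p => A (p, s))).
Proof.
move=> nu2 e0 de de' sA.
exists [set q : R * 'rV[R]_m | `|q.1| < e /\ `|q.2| < e], (joint (fun s p => A (p, s))).
split=> //.
- move=> [s p] /= [s0 sd pd]; split; last exact: lt_le_trans de.
  rewrite ger0_norm// ltNge; apply/negP => es.
  have := lt_le_trans sd de'; rewrite ltNge => /negP; apply.
  by apply: lerXn2r => //; rewrite nnegrE ltW.
- apply: smooth_onP.
    have o1 : open [set y : R | `|y| < e].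
      have -> : [set y : R | `|y| < e] = ball (0 : R) e.
        by apply/seteqP; split=> y; rewrite -ball_normE /= sub0r normrN.
      exact: ball_open.
    have o2 : open [set y : 'rV[R]_m | `|y| < e].
      have -> : [set y : 'rV[R]_m | `|y| < e] = ball (0 : 'rV[R]_m) e.
        by apply/seteqP; split=> y; rewrite -ball_normE /= sub0r normrN.
      exact: ball_open.
    have o3 : open ((fst : R * 'rV[R]_m -> R) @^-1` [set y : R | `|y| < e]).
      by apply: open_cont_preimage => // y; exact: cvg_fst.
    have o4 : open ((snd : R * 'rV[R]_m -> 'rV[R]_m) @^-1` [set y | `|y| < e]).
      by apply: open_cont_preimage => // y; exact: cvg_snd.
    exact: openI o3 o4.
  move=> [s p] /= [se pe].
  apply: (@smooth_comp _ _ _ _ (fun q : R * 'rV[R]_m => (q.2, q.1)) A) => //.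
  - exact: findim_prod (@findim_row R m) (@findim_real R).
  - by smooth_tac.
  - exact: sA.
Qed.

Lemma powR_scale (R : realType) (nu k : nat) (rho : R) : (1 < nu)%N -> 0 <= rho ->
  rho `^ (1 + k%:R / nu%:R) = (rho `^ nu%:R^-1) ^+ (nu + k).
Proof.
move=> nu2 r0; have nu0 : (0 : R) < nu%:R by rewrite ltr0n ltnW.
rewrite powRD; last first.
  apply/implyP => /eqP H; have : (0 : R) < 1 + k%:R / nu%:R.
    by rewrite ltr_pwDl// divr_ge0// ltW.
  by rewrite H ltxx.
by rewrite powRr1// exprD root_powR// (mulrC k%:R) powRrM powR_mulrn// powR_ge0.
Qed.

Lemma before_entry (R : realType) (tin e e1 c te t : R) : e1 <= e -> e1 <= c ->
  c <= tin / 2 -> - c < te -> `|t - - tin| < e1 -> - tin - e <= t < te.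
Proof. by rewrite ltr_norml => ? ? ? ? /andP[? ?]; apply/andP; split; lra. Qed.

Lemma after_exit (R : realType) (tout e e1 c tx t : R) : e1 <= e -> e1 <= c ->
  c <= tout / 2 -> tx < c -> `|t - tout| < e1 -> tx < t <= tout + e.
Proof. by rewrite ltr_norml => ? ? ? ? /andP[? ?]; apply/andP; split; lra. Qed.

Theorem proposition2p1 (R : realType) (m nu : nat)
    (U : set ('rV[R]_m * 'rV[R]_2))
    (h : 'rV[R]_m -> 'rV[R]_2 -> R)
    (Xm Xp W : 'rV[R]_m -> 'rV[R]_2 -> 'rV[R]_2)
    (z : 'rV[R]_m -> 'rV[R]_2)
    (I tau : 'rV[R]_m -> 'rV[R]_2 -> R)
    (nu_ge2 : (2 <= nu)%N) (nu_even : ~~ odd nu)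
    (setting : contact_setting nu U h Xm Xp W z)
    (first_int : first_integral h Xm z I)
    (fb_time : flow_box_time Xm z tau)
    (N : set 'rV[R]_2) (contact_N : nbhs (z 0) N) :
  exists B : set 'rV[R]_2,
    [/\ open B, B (z 0), B `<=` N
      & forall sigma_in sigma_out : 'rV[R]_m -> R -> 'rV[R]_2,
          incoming_section B Xm z sigma_in -> outgoing_section B Xm z sigma_out ->
          exists (r delta C : R) (Dgr A Bnu : R -> 'rV[R]_m -> R),
            [/\ 0 < r /\ 0 < delta,
                (forall p rho x, `|p| < delta -> 0 < rho < delta ->
                   section_of_size sigma_in r p x -> I p x = rho ->
                   one_grazing_passage B (section_of_size sigma_out r p) (h p)
                     (physical (h p) (Xm p) (Xp p)) (tau p) x
                     (C * rho `^ (nu%:R^-1))),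
                (forall p rho d, `|p| < delta -> `|rho| < delta ->
                   is_displacement B (section_of_size sigma_in r p)
                     (section_of_size sigma_out r p) (h p) (Xm p) (Xp p) (I p) rho d
                   <-> d = Dgr rho p),
                [/\ smooth_within
                      [set q : R * 'rV[R]_m |
                        [/\ 0 <= q.1, q.1 ^+ nu < delta & `|q.2| < delta]]
                      (joint A),
                    (forall p rho, `|p| < delta -> - delta < rho <= 0 ->
                       Dgr rho p = 0),
                    (forall p rho, `|p| < delta -> 0 <= rho < delta ->
                       Dgr rho p = rho `^ (1 + nu%:R^-1) *
                                   A (rho `^ (nu%:R^-1)) p)
                  & (forall p, `|p| < delta ->
                       A 0 p = grazing_coeff nu h Xm W z p)]
              & smooth_within
                  [set q : R * 'rV[R]_m |
                    [/\ 0 <= q.1, q.1 ^+ nu < delta & `|q.2| < delta]]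
                  (joint Bnu) /\
                (forall p rho, `|p| < delta -> `|rho| < delta ->
                   Dgr rho p =
                     grazing_coeff nu h Xm W z p *
                       Num.max rho 0 `^ (1 + nu%:R^-1) +
                     Num.max rho 0 `^ (1 + 2 / nu%:R) *
                       Bnu (Num.max rho 0 `^ (nu%:R^-1)) p)]].
Proof.
have [X [A [T [d [C [S [B [[sX X0 oB Bz BN] [sA A0] [d0 T0 C0] box pas]]]]]]]] :=
  grazing_box nu_ge2 nu_even setting first_int fb_time contact_N.
exists B; split=> // sin sout [trin rin] [trout rout].
have coords p (pd : `|p| < d) := proj1 (box p pd).
have chart p (pd : `|p| < d) := proj2 (box p pd).
have [tin [/andP[tin0 tinT] sinE Bin segin]] := incoming_position T0 d0 X0 coords chart rin.
have [tout [/andP[tout0 toutT] soutE Bout segout]] :=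
  outgoing_position T0 d0 X0 coords chart rout.
have seg t : - tin <= t <= tout -> B (X ((0, t), 0)).
  move=> /andP[t1 t2]; have [k|k] := lerP t 0; first by apply: segin; rewrite t1.
  by apply: segout; rewrite ltW.
have [|||e e0 tube] := tube_around T0 d0 oB chart (t0 := - tin) (t1 := tout) _ _ seg.
- by lra.
- exact: toutT.
- by lra.
(* c0 separates the event times, which are O(s), from both sections *)
pose c0 := Num.min (tin / 2) (tout / 2).
have c00 : 0 < c0 by rewrite lt_min !divr_gt0.
have [c0in c0out] : c0 <= tin / 2 /\ c0 <= tout / 2 by rewrite /c0 !ge_min !lexx orbT.
pose e1 := Num.min e c0.
have e10 : 0 < e1 by rewrite lt_min e0.
have [e1e e1c] : e1 <= e /\ e1 <= c0 by split; rewrite ge_min lexx ?orbT.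
have tinT' : `|- tin| < T by rewrite normrN gtr0_norm.
have toutT' : `|tout| < T by rewrite gtr0_norm.
have [r1 r10 near_in] := section_near T0 d0 oB coords chart trin tinT' sinE Bin e10.
have [r2 r20 near_out] := section_near T0 d0 oB coords chart trout toutT' soutE Bout e10.
pose r := Num.min r1 r2; have r0 : 0 < r by rewrite lt_min r10.
have [d1 d10 cross_in] := section_crossing T0 d0 coords chart trin tinT' sinE Bin r0.
have [d2 d20 cross_out] := section_crossing T0 d0 coords chart trout toutT' soutE Bout r0.
have [g [sg Ag _]] := hadamard_near (@findim_row R m) sA.
have [e2 e20 smA] := smooth_near_uniform sA.
have [e3 e30 smg] := smooth_near_uniform sg.
have [e4 e40 AgE] := near_radius (near_ball_prod Ag).
have [e5 e50 A0E] : exists2 e5 : R, 0 < e5 & forall p, `|p| < e5 ->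
    A (p, 0) = grazing_coeff nu h Xm W z p.
  move: A0 => /nbhs_ballP[e5 /= e50 H]; exists e5 => // p pe.
  by apply: H; rewrite -ball_normE /= sub0r normrN.
pose eta := Num.min e T.
have eta0 : 0 < eta by rewrite lt_min e0.
have [eta_e eta_T] : eta <= e /\ eta <= T by split; rewrite ge_min lexx ?orbT.
pose ea := Num.min (Num.min e2 e3) e4.
have ea0 : 0 < ea by rewrite !lt_min e20 e30.
have [ea2 ea3 ea4] : [/\ ea <= e2, ea <= e3 & ea <= e4].
  by split; rewrite !ge_min lexx ?orbT.
(* below sm the germs of A and B_nu are defined and C * s < c0 *)
pose sm := Num.min ea (c0 / C).
have sm0 : 0 < sm by rewrite lt_min ea0 divr_gt0.
have [sm_ea sm_C] : sm <= ea /\ sm <= c0 / C by split; rewrite ge_min lexx ?orbT.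
(* the halves allow for rr, which may reach twice rho *)
pose delta := Num.min (Num.min (Num.min d r) (Num.min (eta / 2) d1))
  (Num.min (Num.min (d2 / 2) ea) (Num.min (sm ^+ nu) e5)).
have mn (x y : R) : 0 < x -> 0 < y -> 0 < Num.min x y by move=> x0 y0; rewrite lt_min x0.
have mnl (x y : R) : Num.min x y <= x by rewrite ge_min lexx.
have mnr (x y : R) : Num.min x y <= y by rewrite ge_min lexx orbT.
have h0 (x : R) : 0 < x -> 0 < x / 2 by move=> x0; rewrite divr_gt0.
have delta0 : 0 < delta.
  exact: mn (mn _ _ (mn _ _ d0 r0) (mn _ _ (h0 _ eta0) d10))
    (mn _ _ (mn _ _ (h0 _ d20) ea0) (mn _ _ (exprn_gt0 nu sm0) e50)).
have [[de_d de_r de_eta de_d1] [de_d2 de_ea de_sm de_e5]] :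
    [/\ delta <= d, delta <= r, delta <= eta / 2 & delta <= d1] /\
    [/\ delta <= d2 / 2, delta <= ea, delta <= sm ^+ nu & delta <= e5].
  split; split.
  - exact: le_trans (mnl _ _) (le_trans (mnl _ _) (mnl d r)).
  - exact: le_trans (mnl _ _) (le_trans (mnl _ _) (mnr d r)).
  - exact: le_trans (mnl _ _) (le_trans (mnr _ _) (mnl (eta / 2) d1)).
  - exact: le_trans (mnl _ _) (le_trans (mnr _ _) (mnr (eta / 2) d1)).
  - exact: le_trans (mnr _ _) (le_trans (mnl _ _) (mnl (d2 / 2) ea)).
  - exact: le_trans (mnr _ _) (le_trans (mnl _ _) (mnr (d2 / 2) ea)).
  - exact: le_trans (mnr _ _) (le_trans (mnr _ _) (mnl (sm ^+ nu) e5)).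
  - exact: le_trans (mnr _ _) (le_trans (mnr _ _) (mnr (sm ^+ nu) e5)).
pose D (rho : R) p := scale_of nu rho ^+ nu.+1 * A (p, scale_of nu rho).
have core p rho : `|p| < delta -> `|rho| < delta ->
    (forall x, 0 < rho -> section_of_size sin r p x -> I p x = rho ->
       one_grazing_passage B (section_of_size sout r p) (h p)
         (physical (h p) (Xm p) (Xp p)) (tau p) x (5 * (C * scale_of nu rho))) /\
    (forall x, is_displacement B (section_of_size sin r p) (section_of_size sout r p)
       (h p) (Xm p) (Xp p) (I p) rho x <-> x = D rho p).
  move=> pde rde.
  have pd : `|p| < d by exact: lt_le_trans de_d.
  have rd : `|rho| < d by exact: lt_le_trans de_d.
  have [te [tx [theta [Tf [rr [ps rr2]]]]]] := pas p rho pd rd.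
  have s_lt : scale_of nu rho < sm.
    by apply: scale_of_lt => //; apply: le_lt_trans (ler_norm _) (lt_le_trans rde de_sm).
  have Cs : C * scale_of nu rho < c0.
    by rewrite mulrC -ltr_pdivlMr//; exact: lt_le_trans s_lt sm_C.
  have teC := le_lt_trans (pas_te ps) Cs; have txC := le_lt_trans (pas_tx ps) Cs.
  move: teC txC; rewrite !ltr_norml => /andP[te1 te2] /andP[tx1 tx2].
  have rr_eta t : `|rr t| < eta.
    by apply: le_lt_trans (rr2 t) _; rewrite mulrC -ltr_pdivlMr//; exact: lt_le_trans rde de_eta.
  have co x (Bx : B x) := proj1 (coords p pd x Bx).
  have ch t q : `|t| < T -> `|q| < T -> [/\ tau p (slice X p (t, q)) = t,
      I p (slice X p (t, q)) = q, 'D_(1, 0) (slice X p) (t, q) = Xm p (slice X p (t, q)) &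
      differentiable (slice X p) (t, q)].
    move=> tT qT; have [c1 c2 c3 c4] := chart p pd t q tT qT; split=> //.
    by have [] := derive_slice (q := (t, q)) (smooth_diff c4).
  have tb t q : - tin - e <= t <= tout + e -> `|q| < eta -> B (slice X p (t, q)).
    move=> tI qe; apply: tube => //; last exact: lt_le_trans eta_e.
    apply: (lt_le_trans pde); apply: (le_trans de_eta); apply: le_trans _ eta_e.
    by rewrite ler_pdivrMr// ler_peMr ?ler1n// ltW.
  have inS x : section_of_size sin r p x -> B x /\ - tin - e <= tau p x < te.
    move=> [u /= ur <-].
    have [||Bx] := near_in p u; [by apply: lt_le_trans pde (le_trans de_r _); rewrite /r ge_min lexx
      | by apply: lt_le_trans ur _; rewrite /r ge_min lexx|].
    by move=> tn; split=> //; exact: before_entry e1e e1c c0in te1 tn.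
  have outS x : section_of_size sout r p x -> B x /\ tx < tau p x <= tout + e.
    move=> [u /= ur <-].
    have [||Bx] := near_out p u; [by apply: lt_le_trans pde (le_trans de_r _); rewrite /r ge_min lexx orbT
      | by apply: lt_le_trans ur _; rewrite /r ge_min lexx orbT|].
    by move=> tn; split=> //; exact: after_exit e1e e1c c0out tx2 tn.
  have p_d1 : `|p| < d1 by exact: lt_le_trans de_d1.
  have d2d2 : d2 / 2 <= d2 by rewrite ler_pdivrMr// ler_peMr ?ler1n// ltW.
  have p_d2 : `|p| < d2 by apply: lt_le_trans pde (le_trans de_d2 d2d2).
  have [xi Sxi Ixi] := cross_in p rho p_d1 (lt_le_trans rde de_d1).
  have [yr Syr Iyr] := cross_out p rho p_d2 (lt_le_trans rde (le_trans de_d2 d2d2)).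
  have rx2 : `|rho + scale_of nu rho ^+ nu.+1 * A (p, scale_of nu rho)| < d2.
    rewrite -(pas_after ps (lexx tx)); apply: le_lt_trans (rr2 tx) _.
    by rewrite mulrC -ltr_pdivlMr//; exact: lt_le_trans rde de_d2.
  have [yp Syp Iyp] := cross_out p _ p_d2 rx2.
  split.
    move=> x rho0 Sx Ix.
    apply: (grazing_passage T0 co ch ps eta_T rr_eta tb inS outS rho0 Sx Ix).
    by exists yp.
  move=> x.
  have := displacement T0 co ch ps eta_T rr_eta tb inS outS x (ex_intro2 _ _ xi Sxi Ixi)
    (ex_intro2 _ _ yr Syr Iyr) (ex_intro2 _ _ yp Syp Iyp).
  by rewrite addrC addKr.
have ea_sm : ea ^+ nu >= sm ^+ nu by apply: lerXn2r; rewrite // nnegrE ltW.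
have A0p p : `|p| < delta -> A (p, 0) = grazing_coeff nu h Xm W z p.
  by move=> pde; apply: A0E; exact: lt_le_trans pde de_e5.
have powA rho : 0 <= rho -> rho `^ (1 + nu%:R^-1) = (rho `^ nu%:R^-1) ^+ nu.+1.
  by move=> rho0; have := powR_scale 1 nu_ge2 rho0; rewrite mul1r addn1.
exists r, delta, (5 * C), D, (fun s p => A (p, s)), (fun s p => g (p, s)); split=> //.
- move=> p rho x pde /andP[rho0 rde] Sx Ix.
  have rde' : `|rho| < delta by rewrite gtr0_norm.
  have [H _] := core p rho pde rde'.
  have := H x rho0 Sx Ix; rewrite /scale_of max_l ?ltW//.
  by rewrite mulrA.
- by move=> p rho x pde rde; have [_ H] := core p rho pde rde.
- split=> //.
  + apply: (smooth_within_swap (e := ea)) => //; first exact: le_trans ea_sm.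
    move=> p s pe se; apply: smA; rewrite ?subr0//; exact: lt_le_trans ea2.
  + by move=> p rho _ /andP[_ r_le]; rewrite /D scale_of_neg// expr0n mul0r.
  + by move=> p rho _ /andP[r_ge _]; rewrite /D /scale_of max_l// powA.
- split.
    apply: (smooth_within_swap (e := ea)) => //; first exact: le_trans ea_sm.
    move=> p s pe se; apply: smg; rewrite ?subr0//; exact: lt_le_trans ea3.
  move=> p rho pde rde.
  have m0 : 0 <= Num.max rho 0 by rewrite le_max lexx orbT.
  have s0 := scale_of_ge0 nu rho.
  have s_lt : scale_of nu rho < sm.
    by apply: scale_of_lt => //; apply: le_lt_trans (ler_norm _) (lt_le_trans rde de_sm).
  rewrite powA// powR_scale// addn2 /D -/(scale_of nu rho); set s := scale_of nu rho in s0 s_lt *.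
  have -> : A (p, s) = A (p, 0) + s * g (p, s).
    have pe4 : `|p - 0| < e4.
      by rewrite subr0; apply: lt_le_trans pde (le_trans de_ea ea4).
    have se4 : `|s - 0| < e4.
      by rewrite subr0 ger0_norm//; apply: lt_le_trans s_lt (le_trans sm_ea ea4).
    apply: (AgE e4 _ p s pe4 se4); by rewrite sub0r add0r lexx andbT; lra.
  rewrite A0p//; rewrite [s ^+ nu.+2]exprSr; ring.
Qed.
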